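(* Let $\Omega$ and $U$ be two (open Euclidean) balls in $\mathbb{C}^n$ of radii $R$ and $r$, respectively, such that $U\subset\Omega$, and let $\delta$ denote the distance from the center of $U$ to the boundary of $\Omega$. Then $$\left(\frac{r}{R}\right)^n\le \|R_U\|\le\left(\frac{\delta}{R}\right)^{\frac{n-1}{2}}.$$ The inequalities are sharp in the following sense: the lower bound is attained, i.e. $\|R_U\|=(r/R)^n$, when $U$ and $\Omega$ are concentric, and the upper bound is attained, i.e. $\|R_U\|=(\delta/R)^{(n-1)/2}$, when the boundaries of the two balls touch at a point.
   Context: For an open set $W\subset\mathbb{C}^n$, $A^2(W)$ is the Bergman space: the Hilbert space of holomorphic functions on $W$ that are square integrable with respect to Lebesgue measure, with the $L^2(W)$ inner product. For a non-empty open subset $U\subset\Omega$, the restriction operator is $R_U:A^2(\Omega)\to A^2(U)$, $R_Uf=f|_U$; $\|R_U\|$ is its operator norm. *)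

(* Defs.v *)
From HB Require Import structures.
From mathcomp Require Import all_boot all_order all_algebra.
From mathcomp Require Import complex.
From mathcomp Require Import all_classical all_reals all_analysis measurable_realfun.

Set Implicit Arguments.
Unset Strict Implicit.
Unset Printing Implicit Defensive.

Import Order.TTheory GRing.Theory Num.Theory.
Import numFieldNormedType.Exports.

Local Open Scope classical_set_scope.
Local Open Scope complex_scope.
Local Open Scope ring_scope.

(* Makes [R[i]] a normed module over itself, so that ['rV[R[i]]_n] carries the
   library's (max norm) topology over the complex field and [differentiable]
   on it is complex-linear Frechet differentiability. *)
HB.instance Definition _ (R : realType) := NormedModule.copy R[i] R[i]^o.

Section sigma_finite_measures.
Context d1 d2 (T1 : measurableType d1) (T2 : measurableType d2) (R : realType).

Lemma sigma_finite_product (m1 : {sigma_finite_measure set T1 -> \bar R})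
    (m2 : {sigma_finite_measure set T2 -> \bar R}) :
  sigma_finite setT (m1 \x m2)%E.
Proof.
have /sigma_finiteP[F [TF ndF Foo]] := sigma_finiteT m1.
have /sigma_finiteP[G [TG ndG Goo]] := sigma_finiteT m2.
exists (fun n => F n `*` G n).
  rewrite -setXTT TF TG predeqE => -[x y]; split.
    move=> [/= [n _ Fnx] [k _ Gky]]; exists (maxn n k) => //; split.
    - by move: x Fnx; exact/subsetPset/ndF/leq_maxl.
    - by move: y Gky; exact/subsetPset/ndG/leq_maxr.
  by move=> [n _ []/= ? ?]; split; exists n.
move=> k; have [? ?] := Foo k; have [? ?] := Goo k.
split; first exact: measurableX.
by rewrite product_measure1E// lte_mul_pinfty// ge0_fin_numE.
Qed.

Lemma sigma_finite_pushforward (m : {measure set T1 -> \bar R})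
    (f : T1 -> T2) (g : T2 -> T1) :
  measurable_fun setT g -> cancel f g ->
  sigma_finite setT m -> sigma_finite setT (pushforward m f).
Proof.
move=> mg fK [F FT Foo].
exists (fun k => g @^-1` F k); first by rewrite -preimage_bigcup -FT preimage_setT.
move=> k; have [mF mFoo] := Foo k; split.
  by rewrite -[X in measurable X]setTI; exact: mg.
rewrite /pushforward -comp_preimage (_ : g \o f = id) //.
by apply/funext => x /=; exact: fK.
Qed.

Lemma pushforward_sigma_finite_measure (m : {measure set T1 -> \bar R})
    (f : T1 -> T2) (g : T2 -> T1) :
  measurable_fun setT f -> measurable_fun setT g -> cancel f g ->
  sigma_finite setT m ->
  exists m' : {sigma_finite_measure set T2 -> \bar R},
    m' = pushforward m f :> (set T2 -> \bar R).
Proof.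
move=> mf mg fK sm.
pose nu : {measure set T2 -> \bar R} :=
  measure_function_pushforward__canonical__measure_function_Measure m mf.
have snu : sigma_finite setT nu := sigma_finite_pushforward mg fK sm.
pose H1 := isSFinite.Build _ _ _ nu (sfinite_measure_sigma_finite snu).
pose H2 := isSigmaFinite.Build _ _ _ nu snu.
by exists (HB.pack_for (SigmaFiniteMeasure.type T2 R) (Measure.sort nu) H1 H2).
Qed.

End sigma_finite_measures.

Section power_measure.
Context d (T : measurableType d) (R : realType).
Variable mu : {sigma_finite_measure set T -> \bar R}.

Fixpoint power_measure n : set (n.-tuple T) -> \bar R :=
  if n is m.+1 then
    pushforward (mu \x @power_measure m)%E (fun p => [tuple of p.1 :: p.2])
  else \d_[tuple].

Lemma power_measure_sigma_finite_measure n :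
  exists m : {sigma_finite_measure set (n.-tuple T) -> \bar R},
    m = @power_measure n :> (set (n.-tuple T) -> \bar R).
Proof.
elim: n => [|n [m mE]]; first by exists \d_[tuple].
rewrite /= -mE.
pose M := [the {measure set _ -> \bar R} of (mu \x m)%E].
apply: (pushforward_sigma_finite_measure (m := M)
  (g := fun t : n.+1.-tuple T => (thead t, [tuple of behead t]))).
- exact: measurable_cons.
- apply: measurable_fun_pair; first exact: measurable_tnth.
  exact: measurable_behead.
- by move=> [x t] /=; congr pair; apply: val_inj.
- exact: sigma_finite_product.
Qed.

Let power_measure0 n : @power_measure n set0 = 0%E.
Proof. by have [m <-] := power_measure_sigma_finite_measure n. Qed.

Let power_measure_ge0 n A : (0 <= @power_measure n A)%E.
Proof. by have [m <-] := power_measure_sigma_finite_measure n. Qed.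

Let power_measure_sigma_additive n : semi_sigma_additive (@power_measure n).
Proof.
have [m <-] := power_measure_sigma_finite_measure n.
exact: measure_semi_sigma_additive.
Qed.

Let power_measure_sigma_finite n : sigma_finite setT (@power_measure n).
Proof.
have [m <-] := power_measure_sigma_finite_measure n.
exact: sigma_finiteT.
Qed.

HB.instance Definition _ n := isMeasure.Build _ _ _ (@power_measure n)
  (@power_measure0 n) (@power_measure_ge0 n) (@power_measure_sigma_additive n).
HB.instance Definition _ n := Measure_isSigmaFinite.Build _ _ _
  (@power_measure n) (@power_measure_sigma_finite n).

End power_measure.

Section lebesgue_area.
Variable R : realType.

Definition lebesgue_area :
    set (measurableTypeR R * measurableTypeR R)%type -> \bar R :=
  (@lebesgue_measure R \x @lebesgue_measure R)%E.

HB.instance Definition _ := Measure.on lebesgue_area.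
HB.instance Definition _ := Measure_isSigmaFinite.Build _ _ _ lebesgue_area
  (sigma_finite_product (@lebesgue_measure R) (@lebesgue_measure R)).

End lebesgue_area.

(* Operator norm of a map [T] from the space [A] normed by [normA] into a space
   normed by [normB]; it is [+oo] for unbounded [T]. *)
Definition operator_norm (R : realType) (V W : Type) (A : set V)
    (normA : V -> R) (normB : W -> R) (T : V -> W) : \bar R :=
  ereal_sup [set (normB (T f))%:E | f in [set f | A f /\ normA f <= 1]].

Section complex_space.
Context (R : realType) (n : nat).
Local Notation RR := (measurableTypeR R * measurableTypeR R)%type.

(* Borel sigma-algebra. *)
HB.instance Definition _ :=
  Measurable.copy 'rV[R[i]]_n (g_sigma_algebraType (@open 'rV[R[i]]_n)).

Definition complex_row (t : n.-tuple RR) : 'rV[R[i]]_n :=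
  \row_j ((tnth t j).1 +i* (tnth t j).2).

Definition pair_row (z : 'rV[R[i]]_n) : n.-tuple RR :=
  [tuple (complex.Re (z 0 j), complex.Im (z 0 j)) | j < n].

Lemma complex_rowK : cancel complex_row pair_row.
Proof.
move=> t; apply: eq_from_tnth => j; rewrite tnth_mktuple mxE /=.
by case: (tnth t j).
Qed.

Lemma pair_rowK : cancel pair_row complex_row.
Proof.
have eta (w : R[i]) : complex.Re w +i* complex.Im w = w by case: w.
by move=> z; apply/rowP => j; rewrite mxE tnth_mktuple; exact: eta.
Qed.

Let normc_le_add (a b : R) : Normc.normc (a +i* b) <= `|a| + `|b|.
Proof.
rewrite -[leRHS]ger0_norm ?addr_ge0 // -sqrtr_sqr ler_wsqrtr //.
rewrite sqrrD !real_normK ?num_real // lerD2r lerDl.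
by rewrite mulrn_wge0 // mulr_ge0.
Qed.

Lemma measurable_complex_row : measurable_fun setT complex_row.
Proof.
apply: (measurability (@open 'rV[R[i]]_n)) => // _ [A oA <-]; rewrite setTI.
pose box (q : (n.-tuple (rat * rat)%type * nat)%type) : set (n.-tuple RR) :=
  \bigcap_(j in [set: 'I_n])
    (@tnth n RR ^~ j) @^-1` (ball (ratr (tnth q.1 j).1 : R) q.2.+1%:R^-1 `*`
                            ball (ratr (tnth q.1 j).2 : R) q.2.+1%:R^-1).
pose F q := [set t | box q t /\ box q `<=` complex_row @^-1` A].
have mbox q : measurable (box q).
  apply: fin_bigcap_measurable => // j _.
  rewrite -[X in measurable X]setTI; apply: measurable_tnth => //.
  by apply: measurableX; exact: measurable_ball.
have -> : complex_row @^-1` A = \bigcup_q F q.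
  apply/seteqP; split => [t At|t [q _ [qt]]]; last by apply.
  have /nbhs_ballP[[e e'] /= e0 eA] : nbhs (complex_row t) A by exact: open_nbhs_nbhs.
  move: e0; rewrite ltcE /= => /andP[/eqP e'0 e0]; subst e'.
  have [k ke] : exists k, 4 * k.+1%:R^-1 < e.
    have [k] := ltr_add_invr (divr_gt0 e0 (@ltr0Sn R 3)).
    by rewrite add0r ltr_pdivlMr // mulrC; exists k.
  have rat_near (x : R) : exists q : rat, ball x k.+1%:R^-1 (ratr q).
    have : x - k.+1%:R^-1 < x + k.+1%:R^-1 by rewrite ltrD2l gtrN ?invr_gt0.
    by move=> /rat_in_itvoo[q]; rewrite in_itv /= -ltr_distlC; exists q.
  have /choice[q qP] : forall j, exists q : rat * rat,
      ball (tnth t j).1 k.+1%:R^-1 (ratr q.1 : R) /\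
      ball (tnth t j).2 k.+1%:R^-1 (ratr q.2 : R).
    move=> j; have [q1 ?] := rat_near (tnth t j).1.
    by have [q2 ?] := rat_near (tnth t j).2; exists (q1, q2).
  exists ([tuple q j | j < n], k) => //; split.
    by move=> j _; split; rewrite /= tnth_mktuple; apply: ball_sym; apply qP.
  move=> u bu; apply: eA; split.
    by rewrite ltcE /= eqxx.
  move=> i j; rewrite !mxE.
  have [/= b1 b2] := bu j Logic.I; have [q1 q2] := qP j.
  rewrite tnth_mktuple in b1 b2.
  set e1 : R := k.+1%:R^-1 in ke q1 q2 b1 b2.
  set x := (tnth t j).1 - (tnth u j).1; set y := (tnth t j).2 - (tnth u j).2.
  have i1 : `|x| < e1 + e1 by exact: ball_triangle q1 b1.
  have i2 : `|y| < e1 + e1 by exact: ball_triangle q2 b2.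
  rewrite /ball /= ltcR (le_lt_trans _ ke) //.
  apply: le_trans (normc_le_add x y) _.
  by rewrite mulrC mulr_natr (mulrnDr e1 2 2) lerD // ltW.
apply: countable_bigcupT_measurable => // q.
have [sub|nsub] := pselect (box q `<=` complex_row @^-1` A).
  by rewrite (_ : F q = box q) //; apply/seteqP; split => [t []|].
by rewrite (_ : F q = set0) //; apply/seteqP; split => [t []|].
Qed.

(* Lebesgue measure on Borel sets, transported from the n-fold power of the
   plane measure along (x_j, y_j)_j |-> (x_j + i y_j)_j. *)
Definition lebesgue_complex : set 'rV[R[i]]_n -> \bar R :=
  pushforward (@power_measure _ _ R (@lebesgue_area R) n) complex_row.

HB.instance Definition _ := Measure.copy lebesgue_complex
  (measure_function_pushforward__canonical__measure_function_Measure
     (@power_measure _ _ R (@lebesgue_area R) n) measurable_complex_row).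

Definition euclid_norm (z : 'rV[R[i]]_n) : R :=
  Num.sqrt (\sum_j Normc.normc (z 0 j) ^+ 2).

Definition euclid_ball (c : 'rV[R[i]]_n) (r : R) : set 'rV[R[i]]_n :=
  [set z | euclid_norm (z - c) < r].

Definition boundary (W : set 'rV[R[i]]_n) : set 'rV[R[i]]_n :=
  closure W `\` W°.

Definition euclid_dist (z : 'rV[R[i]]_n) (W : set 'rV[R[i]]_n) : R :=
  inf [set euclid_norm (z - w) | w in W].

Definition sq_integral (W : set 'rV[R[i]]_n) (f : 'rV[R[i]]_n -> R[i]) : \bar R :=
  (\int[lebesgue_complex]_(z in W) (Normc.normc (f z) ^+ 2)%:E)%E.

(* A function on [W] is encoded by its extension by zero (the default point of
   [R[i]] is 0), so that distinct elements of [bergman_space W] are distinct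
   functions on [W]. *)
Definition bergman_space (W : set 'rV[R[i]]_n) : set ('rV[R[i]]_n -> R[i]) :=
  [set f | (forall z, W z -> differentiable f z) /\
           (sq_integral W f < +oo)%E /\ f \_ W = f].

Definition bergman_norm (W : set 'rV[R[i]]_n) (f : 'rV[R[i]]_n -> R[i]) : R :=
  Num.sqrt (fine (sq_integral W f)).

Definition restriction_op (U : set 'rV[R[i]]_n) (f : 'rV[R[i]]_n -> R[i]) :
    'rV[R[i]]_n -> R[i] :=
  f \_ U.

(* [restriction_op U : bergman_space Omega -> bergman_space U] *)
Definition restriction_norm (Omega U : set 'rV[R[i]]_n) : \bar R :=
  operator_norm (bergman_space Omega) (bergman_norm Omega) (bergman_norm U)
    (restriction_op U).

End complex_space.

(* Main.v *)
(* Write c - a = d e with e a unit vector, delta = R - d and t = sqrt (delta / R), and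
   let S_z act as the identity on the line spanned by e and as multiplication by z on
   its orthogonal complement. Completing a square shows that U lies in
   a + S_t (Omega - a), and S_t multiplies volumes by t ^ (2 (n - 1)), so the upper
   bound follows once |f|^2 integrated over the ball does not increase when f is
   composed with S_t. For fixed x the function w |-> f (S_phi(w) x)^2, where phi is the
   Moebius map (w + t) / (1 + t w), is holomorphic near the closed unit disc and equals
   f (S_t x)^2 at 0, so the mean value property bounds |f (S_t x)|^2 by the mean of
   |f (S_phi(w) x)|^2 over |w| = 1. There |phi(w)| = 1, hence S_phi(w) is an isometry of
   the ball, and integrating over x gives the claim. The same argument with S_z = z
   (e = 0) settles concentric balls, and the constant function 1 gives the lower bound.

   When the balls touch at p, both are invariant in the limit under the dilations
   (s, v) |-> (eps s, sqrt eps v), s = <x - p, e>. The functions (eps + s) ^ (- m)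
   rescale to (1 + s) ^ (- m) on paraboloids increasing to Siegel domains, which S_t maps
   onto each other; so their norm ratio tends to t ^ (n - 1) as eps tends to 0.

   Orthogonal invariance of Lebesgue measure comes from the uniqueness of
   translation-invariant measures, and the mean value property from Goursat's bisection
   argument applied in logarithmic polar coordinates. *)

Require Import Defs.
From HB Require Import structures.
From mathcomp Require Import all_boot all_order all_algebra.
From mathcomp Require Import complex.
From mathcomp Require Import all_classical all_reals all_analysis measurable_realfun.
From mathcomp Require Import lra ring.

Set Implicit Arguments.
Unset Strict Implicit.
Unset Printing Implicit Defensive.

Import Order.TTheory GRing.Theory Num.Theory.
Import numFieldNormedType.Exports.

Local Open Scope classical_set_scope.
Local Open Scope complex_scope.
Local Open Scope ring_scope.

(** * Goursat's lemma for closed real one-forms *)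

(** Membership in [bergman_space] provides differentiability at each point but no continuity of the
    derivative, so Green's theorem cannot be quoted and Goursat's argument takes its place. In
    logarithmic polar coordinates circles about 0 become vertical segments, and periodicity in the
    angle cancels the horizontal sides of a rectangle, so circular means do not depend on the
    radius.

    [S_t] shrinks only the orthogonal complement of [e], which is why the exponent is [n - 1]; in
    statements about rows of length [n.+1] it reads [n].

    For sharpness the limit [eps -> 0] is never taken. The masses of the rescaled peak over
    paraboloids are bounded uniformly, and a paraboloid whose mass is close to their supremum
    already gives the ratio up to a factor [l < 1]. The uniform bound comes without evaluating an
    integral: one dilation by [(4, 2)] bounds four times the mass by the mass plus a constant, and a
    finite mass can be absorbed. *)

Section green_goursat.
Variables (R : realType) (P Q F G : R -> R -> R) (a b c d : R).
Hypotheses (ab : a < b) (cd : c < d).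
Hypothesis dF : forall x y, x \in `[a, b] -> y \in `[c, d] ->
  is_derive x (1 : R) (F ^~ y) (P x y).
Hypothesis dG : forall x y, x \in `[a, b] -> y \in `[c, d] ->
  is_derive y (1 : R) (G x) (Q x y).
(** The shared [B] is the [y]-derivative of [P] and the [x]-derivative of [Q]: the form
    [P dx + Q dy] is closed at the point, in the pointwise sense only. *)
Hypothesis dPQ : forall x y, x \in `[a, b] -> y \in `[c, d] ->
  exists A B D : R, forall e : R, 0 < e -> exists2 k : R, 0 < k & forall x' y',
    `|x' - x| <= k -> `|y' - y| <= k ->
    `|P x' y' - P x y - (A * (x' - x) + B * (y' - y))|
      <= e * (`|x' - x| + `|y' - y|) /\
    `|Q x' y' - Q x y - (B * (x' - x) + D * (y' - y))|
      <= e * (`|x' - x| + `|y' - y|).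

(** Counterclockwise circulation of [P dx + Q dy] around the rectangle with lower left corner
    [(x, y)] and sides [w], [h]; increments of the partial primitives [F], [G] stand for the line
    integrals. *)
Let circ (x y w h : R) := F (x + w) y - F x y + (G (x + w) (y + h) - G (x + w) y)
  - (F (x + w) (y + h) - F x (y + h)) - (G x (y + h) - G x y).

Let circ_split (x y w h : R) : circ x y w h =
  circ x y (w / 2) (h / 2) + circ (x + w / 2) y (w / 2) (h / 2)
  + circ x (y + h / 2) (w / 2) (h / 2)
  + circ (x + w / 2) (y + h / 2) (w / 2) (h / 2).
Proof.
have hf (u v : R) : u + v / 2 + v / 2 = u + v by field.
by rewrite /circ !hf; ring.
Qed.

Let mvt_bound (f f' : R -> R) (x w C E : R) : 0 < w ->
  (forall u, u \in `[x, x + w] -> is_derive u (1 : R) f (f' u)) ->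
  (forall u, u \in `[x, x + w] -> `|f' u - C| <= E) ->
  `|f (x + w) - f x - C * w| <= E * w.
Proof.
move=> w0 df fE.
have xw : x < x + w by rewrite ltrDl.
have df1 u : u \in `]x, x + w[ -> is_derive u (1 : R) f (f' u).
  by move=> uI; apply: df; exact: subset_itv_oo_cc.
have cf : {within `[x, x + w], continuous f}.
  by apply: derivable_within_continuous => u uI; have [] := df _ uI.
have [u uI ->] := MVT xw df1 cf.
rewrite (_ : x + w - x = w); last by ring.
rewrite -mulrBl normrM (gtr0_norm w0) ler_pM2r//.
apply: fE; exact: subset_itv_oo_cc.
Qed.

(** Opposite sides are paired and estimated by the mean value theorem: bottom minus top is about
    [- B * h * w], right minus left about [B * w * h]. Closedness makes these cancel, leaving an
    error that is small compared with the area scale [(w + h) ^+ 2]. *)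
Let circ_local (x y e : R) : x \in `[a, b] -> y \in `[c, d] -> 0 < e ->
  exists2 k : R, 0 < k & forall u v w h : R, 0 < w -> 0 < h ->
    a <= u -> u + w <= b -> c <= v -> v + h <= d ->
    u <= x <= u + w -> v <= y <= v + h -> w <= k -> h <= k ->
    `|circ u v w h| <= e * (w + h) ^+ 2.
Proof.
move=> xI yI e0; have [A [B [D]]] := dPQ xI yI.
move=> /(_ (e / 2)) []; first by rewrite divr_gt0.
move=> k k0 PQ; exists k => // u v w h w0 h0 au ub cv vd ux vy wk hk.
have near x' y' : x' \in `[u, u + w] -> y' \in `[v, v + h] ->
    [/\ `|x' - x| <= w & `|y' - y| <= h].
  by rewrite !in_itv /= => i1 i2; split; rewrite ler_norml; lra.
have bnd x' y' : x' \in `[u, u + w] -> y' \in `[v, v + h] ->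
    `|P x' y' - P x y - (A * (x' - x) + B * (y' - y))| <= e / 2 * (w + h) /\
    `|Q x' y' - Q x y - (B * (x' - x) + D * (y' - y))| <= e / 2 * (w + h).
  move=> i1 i2; have [n1 n2] := near _ _ i1 i2.
  have [||p q] := PQ x' y'; [exact: le_trans wk|exact: le_trans hk|].
  by split; [apply: le_trans p _|apply: le_trans q _];
    rewrite ler_wpM2l ?divr_ge0 ?(ltW e0)// lerD.
have vI : v \in `[v, v + h] by rewrite in_itv /=; lra.
have vhI : v + h \in `[v, v + h] by rewrite in_itv /=; lra.
have uI : u \in `[u, u + w] by rewrite in_itv /=; lra.
have uwI : u + w \in `[u, u + w] by rewrite in_itv /=; lra.
have sub1 z : z \in `[u, u + w] -> z \in `[a, b] by rewrite !in_itv /=; lra.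
have sub2 z : z \in `[v, v + h] -> z \in `[c, d] by rewrite !in_itv /=; lra.
have dE1 z : z \in `[u, u + w] ->
    is_derive z (1 : R) (F^~ v \- F^~ (v + h)) ((P^~ v \- P^~ (v + h)) z).
  by move=> /sub1 zI; apply: is_deriveB; apply: dF => //; exact: sub2.
have bE1 z : z \in `[u, u + w] ->
    `|(P^~ v \- P^~ (v + h)) z - (- B * h)| <= e * (w + h).
  move=> zI; have [p1 _] := bnd _ _ zI vI; have [p2 _] := bnd _ _ zI vhI.
  by move: p1 p2; rewrite /= !ler_norml; lra.
have E1 := mvt_bound w0 dE1 bE1; rewrite /= in E1.
have dE2 z : z \in `[v, v + h] ->
    is_derive z (1 : R) (G (u + w) \- G u) ((Q (u + w) \- Q u) z).
  by move=> /sub2 zI; apply: is_deriveB; apply: dG => //; exact: sub1.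
have bE2 z : z \in `[v, v + h] ->
    `|(Q (u + w) \- Q u) z - B * w| <= e * (w + h).
  move=> zI; have [_ p1] := bnd _ _ uwI zI; have [_ p2] := bnd _ _ uI zI.
  by move: p1 p2; rewrite /= !ler_norml; lra.
have E2 := mvt_bound h0 dE2 bE2; rewrite /= in E2.
rewrite expr2 mulrA [leRHS]mulrDr /circ.
apply: le_trans (lerD E1 E2); apply: le_trans (ler_normD _ _).
by rewrite le_eqVlt; apply/orP; left; apply/eqP; congr `| _ |; ring.
Qed.

(** Circulation is additive under quartering, so a nested chain of quarters keeps at least
    [M / 4 ^+ k]; at the common point of the chain [circ_local] makes it smaller than any multiple
    of that, hence [M = 0]. *)
Lemma green_goursat :
  F b c - F a c + (G b d - G b c) - (F b d - F a d) - (G a d - G a c) = 0.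
Proof.
pose w k := (b - a) / 2 ^+ k; pose h k := (d - c) / 2 ^+ k.
have ba0 : 0 < b - a by rewrite subr_gt0.
have dc0 : 0 < d - c by rewrite subr_gt0.
have w0 k : 0 < w k by rewrite divr_gt0// exprn_gt0.
have h0 k : 0 < h k by rewrite divr_gt0// exprn_gt0.
have wS k : w k.+1 = w k / 2 by rewrite /w exprSr invfM mulrA.
have hS k : h k.+1 = h k / 2 by rewrite /h exprSr invfM mulrA.
pose M := `|circ a c (b - a) (d - c)|.
have [step stepP] : exists step : nat -> R * R -> R * R, forall k p,
    [/\ ((step k p).1 = p.1 \/ (step k p).1 = p.1 + w k / 2),
        ((step k p).2 = p.2 \/ (step k p).2 = p.2 + h k / 2) &
        `|circ p.1 p.2 (w k) (h k)| / 4 <=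
        `|circ (step k p).1 (step k p).2 (w k / 2) (h k / 2)|].
  have ex k (p : R * R) : exists q : R * R,
    [/\ (q.1 = p.1 \/ q.1 = p.1 + w k / 2),
        (q.2 = p.2 \/ q.2 = p.2 + h k / 2) &
        `|circ p.1 p.2 (w k) (h k)| / 4 <=
        `|circ q.1 q.2 (w k / 2) (h k / 2)|].
    case: p => x y /=; set m := _ / 4.
    have [l1|l1] := lerP m `|circ x y (w k / 2) (h k / 2)|.
      by exists (x, y); split => //=; left.
    have [l2|l2] := lerP m `|circ (x + w k / 2) y (w k / 2) (h k / 2)|.
      by exists (x + w k / 2, y); split => //=; [right|left].
    have [l3|l3] := lerP m `|circ x (y + h k / 2) (w k / 2) (h k / 2)|.
      by exists (x, y + h k / 2); split => //=; [left|right].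
    exists (x + w k / 2, y + h k / 2); split => //=; [by right|by right|].
    rewrite leNgt; apply/negP => l4.
    have := circ_split x y (w k) (h k); move: l1 l2 l3 l4; rewrite {}/m.
    set c0 := circ x y (w k) (h k).
    move: (circ x y _ _) (circ (x + _) y _ _) (circ x (y + _) _ _)
      (circ (x + _) (y + _) _ _) => c1 c2 c3 c4.
    rewrite !ltr_norml; have [] := ger0P c0; lra.
  have [s sP] := choice (fun kp : nat * (R * R) => ex kp.1 kp.2).
  by exists (fun k p => s (k, p)) => k p; exact: (sP (k, p)).
pose fix z k := if k is j.+1 then step j (z j) else (a, c).
pose x k := (z k).1; pose y k := (z k).2.
have xS k : x k <= x k.+1 /\ x k.+1 + w k.+1 <= x k + w k.
  have [+ _ _] := stepP k (z k); have p := w0 k; rewrite wS /x /=.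
  by case=> ->; lra.
have yS k : y k <= y k.+1 /\ y k.+1 + h k.+1 <= y k + h k.
  have [_ + _] := stepP k (z k); have p := h0 k; rewrite hS /y /=.
  by case=> ->; lra.
have cM k : M / 4 ^+ k <= `|circ (x k) (y k) (w k) (h k)|.
  elim: k => [|k IH]; first by rewrite /w /h expr0 !divr1.
  have [_ _] := stepP k (z k); rewrite -wS -hS; apply: le_trans.
  by rewrite exprSr invfM mulrA ler_pM2r ?invr_gt0.
have nested (u v : nat -> R) : (forall k, 0 < v k) ->
    (forall k, u k <= u k.+1 /\ u k.+1 + v k.+1 <= u k + v k) ->
    exists l, forall k, u k <= l <= u k + v k.
  move=> v0 uv.
  have mono i j : u i <= u (i + j)%N /\ u (i + j)%N + v (i + j)%N <= u i + v i.
    elim: j => [|j [IH1 IH2]]; first by rewrite addn0.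
    have [p1 p2] := uv (i + j)%N; rewrite addnS; split; first exact: le_trans p1.
    exact: le_trans IH2.
  have le i j : u i <= u j + v j.
    have [ij|/ltnW ji] := leqP i j.
      have [+ _] := mono i (j - i)%N; rewrite subnKC// => /le_trans; apply.
      by rewrite lerDl ltW.
    have [_] := mono j (i - j)%N; rewrite subnKC// => /(le_trans _); apply.
    by rewrite lerDl ltW.
  exists (sup (range u)) => k; apply/andP; split.
    apply: ub_le_sup; last by exists k.
    by exists (u 0%N + v 0%N) => _ [i _ <-].
  apply: ge_sup; first by exists (u 0%N), 0%N.
  by move=> _ [i _ <-].
have [lx lxP] := nested _ _ w0 xS; have [ly lyP] := nested _ _ h0 yS.
have xab k : a <= x k /\ x k + w k <= b.
  elim: k => [|k [? ?]]; first by rewrite /x /w /= expr0 divr1; lra.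
  by have := xS k; lra.
have ycd k : c <= y k /\ y k + h k <= d.
  elim: k => [|k [? ?]]; first by rewrite /y /h /= expr0 divr1; lra.
  by have := yS k; lra.
have lxI : lx \in `[a, b] by have := lxP 0%N; have := xab 0%N; rewrite in_itv /=; lra.
have lyI : ly \in `[c, d] by have := lyP 0%N; have := ycd 0%N; rewrite in_itv /=; lra.
set S := (b - a) + (d - c).
have S0 : 0 < S by rewrite addr_gt0.
suff M0 : M <= 0.
  move: M0; rewrite normr_le0 /circ => /eqP.
  have -> : a + (b - a) = b by ring.
  by have -> : c + (d - c) = d by ring.
apply/ler_addgt0Pl => e e0; rewrite addr0.
(* With this tolerance the bound at depth [N] reads [M / 4 ^+ N <= e / S ^+ 2 * (S / 2 ^+ N) ^+ 2],
   and the powers of four cancel to [M <= e]. *)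
have e'0 : 0 < e / S ^+ 2 by rewrite divr_gt0// exprn_gt0.
have [k k0 cb] := circ_local lxI lyI e'0.
have [N NS] : exists N, S / 2 ^+ N <= k.
  have [N] := ltr_add_invr (divr_gt0 k0 S0); rewrite add0r => NP; exists N.
  rewrite ler_pdivrMr ?exprn_gt0// mulrC -ler_pdivrMr//.
  rewrite -[leLHS]invf_div -[leRHS]invrK lef_pV2 ?posrE ?divr_gt0// ?invr_gt0 ?exprn_gt0//.
  apply: le_trans (ltW NP); rewrite lef_pV2 ?posrE ?exprn_gt0//.
  by rewrite -natrX ler_nat ltn_expl.
have wN : w N <= k.
  by apply: le_trans NS; rewrite ler_pM2r ?invr_gt0 ?exprn_gt0// lerDl ltW.
have hN : h N <= k.
  by apply: le_trans NS; rewrite ler_pM2r ?invr_gt0 ?exprn_gt0// lerDr ltW.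
have [xa xb] := xab N; have [yc yd] := ycd N.
have := cb _ _ _ _ (w0 N) (h0 N) xa xb yc yd (lxP N) (lyP N) wN hN.
move=> /(le_trans (cM N)).
rewrite /w /h -mulrDl -/S exprMn exprVn -exprM mulnC exprM (_ : 2 ^+ 2 = 4); last by ring.
by rewrite mulrA divfK ?gt_eqF ?exprn_gt0// ler_pM2r ?invr_gt0 ?exprn_gt0.
Qed.
End green_goursat.

(** * Complex derivatives and the mean value inequality *)

Section normc.
Variable R : rcfType.
Implicit Types z w : R[i].
Local Notation normc := (@Normc.normc R).

Lemma normc_ge0 z : 0 <= normc z.
Proof. by case: z => x y; rewrite sqrtr_ge0. Qed.

Lemma sqr_normc_def z : normc z ^+ 2 = complex.Re z ^+ 2 + complex.Im z ^+ 2.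
Proof. by case: z => x y /=; rewrite sqr_sqrtr// addr_ge0 ?sqr_ge0. Qed.

Lemma normc_sub z w : normc (z - w) = normc (w - z).
Proof. by rewrite -normcN opprB. Qed.

Lemma normc_conj z : normc z^*%C = normc z.
Proof. by case: z => x y /=; rewrite sqrrN. Qed.

Lemma normc_real (x : R) : normc x%:C = `|x|.
Proof. by rewrite /= expr0n addr0 sqrtr_sqr. Qed.

Lemma normcX z n : normc (z ^+ n) = normc z ^+ n.
Proof. by elim: n => [|n IH]; rewrite ?expr0 ?Normc.normc1// !exprS Normc.normcM IH. Qed.

Lemma normc_eq0 z : (normc z == 0) = (z == 0).
Proof.
by apply/eqP/eqP => [/Normc.eq0_normc|->]; last exact: Normc.normc0.
Qed.

Lemma normc_gt0 z : (0 < normc z) = (z != 0).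
Proof. by rewrite lt_def normc_ge0 andbT normc_eq0. Qed.

Lemma abs_Re_le_normc z : `|complex.Re z| <= normc z.
Proof.
by case: z => x y /=; rewrite -sqrtr_sqr ler_wsqrtr// lerDl sqr_ge0.
Qed.

Lemma abs_Im_le_normc z : `|complex.Im z| <= normc z.
Proof.
by case: z => x y /=; rewrite -sqrtr_sqr ler_wsqrtr// lerDr sqr_ge0.
Qed.

Lemma normc_le_absD (x y : R) : normc (x +i* y) <= `|x| + `|y|.
Proof.
have D0 : 0 <= `|x| + `|y| by rewrite addr_ge0.
rewrite -(ger0_norm D0) -(sqrtr_sqr (`|x| + `|y|)) /= ler_wsqrtr //.
by rewrite sqrrD !real_normK ?num_real // lerD2r lerDl mulrn_wge0 // mulr_ge0.
Qed.

Lemma mulc_conj z : z * z^*%C = (normc z ^+ 2)%:C.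
Proof.
rewrite sqr_normc_def; case: z => x y; apply/eqP; rewrite eq_complex /=.
by apply/andP; split; apply/eqP; ring.
Qed.

End normc.

Section has_cderiv.
Variable R : realType.
Implicit Types (f g h : R[i] -> R[i]) (c w z : R[i]).
Local Notation normc := (@Normc.normc R).

(** Stated with real tolerances through [normc], because the library norm on [R[i]] has its values
    in [R[i]]. The closed, multiplied-out form also covers [z = w] and composes well. *)
Definition has_cderiv f w c := forall e : R, 0 < e -> exists2 k : R, 0 < k &
  forall z, normc (z - w) <= k ->
  normc (f z - f w - c * (z - w)) <= e * normc (z - w).

Definition cdifferentiable f w := exists c, has_cderiv f w c.

Lemma has_cderiv_lipschitz f w c : has_cderiv f w c -> exists2 k : R, 0 < k &
  forall z, normc (z - w) <= k ->
  normc (f z - f w) <= (normc c + 1) * normc (z - w).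
Proof.
move=> /(_ 1 ltr01)[k k0 fk]; exists k => // z zk.
rewrite (_ : f z - f w = (f z - f w - c * (z - w)) + c * (z - w)); last by rewrite subrK.
apply: le_trans (le_normcD _ _) _; rewrite Normc.normcM mulrDl mul1r addrC.
by rewrite lerD2l; have := fk _ zk; rewrite mul1r.
Qed.

Lemma has_cderiv_quadratic f w c (k C : R) : 0 < k ->
  (forall z, normc (z - w) <= k ->
    normc (f z - f w - c * (z - w)) <= C * normc (z - w) ^+ 2) ->
  has_cderiv f w c.
Proof.
move=> k0 fC e e0; have C1 : 0 < `|C| + 1 by rewrite ltr_wpDl.
exists (Num.min k (e / (`|C| + 1))); first by rewrite lt_min k0 divr_gt0.
move=> z; rewrite le_min => /andP[zk ze]; apply: le_trans (fC _ zk) _.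
rewrite expr2 mulrA ler_wpM2r ?normc_ge0//.
apply: le_trans (ler_wpM2r (normc_ge0 _) (_ : C <= `|C| + 1)) _.
  by rewrite (le_trans (ler_norm _))// lerDl.
by move: ze; rewrite ler_pdivlMr// mulrC.
Qed.

Lemma has_cderiv_comp f g w c c' : has_cderiv f w c -> has_cderiv g (f w) c' ->
  has_cderiv (g \o f) w (c' * c).
Proof.
move=> df dg e e0; have [k1 k10 f1] := has_cderiv_lipschitz df.
have L0 : 0 < normc c + 1 by rewrite ltr_wpDl ?normc_ge0.
have L'0 : 0 < normc c' + 1 by rewrite ltr_wpDl ?normc_ge0.
have [|k2 k20 g2] := dg (e / 2 / (normc c + 1)); first by rewrite !divr_gt0.
have [|k3 k30 f3] := df (e / 2 / (normc c' + 1)); first by rewrite !divr_gt0.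
exists (Num.min k1 (Num.min (k2 / (normc c + 1)) k3)).
  by rewrite !lt_min k10 k30 divr_gt0.
move=> z; rewrite !le_min => /and3P[z1 z2 z3] /=.
have fz := f1 _ z1.
have /g2 : normc (f z - f w) <= k2.
  by apply: le_trans fz _; rewrite mulrC -ler_pdivlMr.
have {}f3 := f3 _ z3.
set A := g _ - g _ - _ => hA; set B := f z - f w - _ in f3.
have -> : g (f z) - g (f w) - c' * c * (z - w) = A + c' * B.
  by rewrite /A /B; ring.
apply: le_trans (le_normcD _ _) _; rewrite Normc.normcM.
rewrite [e]splitr mulrDl; apply: lerD.
  apply: le_trans hA _; rewrite -mulrA ler_pM2l ?divr_gt0// mulrC ler_pdivrMr//.
  by rewrite mulrC.
apply: le_trans (ler_wpM2l (normc_ge0 _) f3) _; rewrite !mulrA.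
rewrite ler_wpM2r ?normc_ge0// ler_pdivrMr// -mulrA mulrC ler_pM2l ?divr_gt0//.
by rewrite lerDl.
Qed.

Lemma has_cderiv_sqr w : has_cderiv (fun z => z ^+ 2) w (w *+ 2).
Proof.
apply: (@has_cderiv_quadratic _ _ _ 1 1) => // z _.
rewrite mul1r -normcX le_eqVlt; apply/orP; left; apply/eqP; congr Normc.normc.
by ring.
Qed.

Lemma has_cderiv_scale c w : has_cderiv (fun z => c * z) w c.
Proof.
apply: (@has_cderiv_quadratic _ _ _ 1 0) => // z _.
by rewrite mul0r -mulrBr subrr Normc.normc0.
Qed.

Lemma cdifferentiable_comp f g w :
  cdifferentiable f w -> cdifferentiable g (f w) -> cdifferentiable (g \o f) w.
Proof. by move=> [c df] [c' dg]; exists (c' * c); exact: has_cderiv_comp. Qed.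

End has_cderiv.

(** * The complex exponential *)

Section complex_exponential.
Variable R : realType.
Local Notation normc := (@Normc.normc R).

Definition cis (x : R) : R[i] := cos x +i* sin x.

Definition cexp (z : R[i]) : R[i] :=
  (expR (complex.Re z))%:C * cis (complex.Im z).

Lemma cisD x y : cis (x + y) = cis x * cis y.
Proof.
by rewrite /cis cosD sinD; congr (_ +i* _); rewrite addrC.
Qed.

Lemma normc_cis x : normc (cis x) = 1.
Proof. by rewrite /= cos2Dsin2 sqrtr1. Qed.

Lemma cexpD z w : cexp (z + w) = cexp z * cexp w.
Proof.
case: z w => [a b] [c d]; rewrite /cexp /= expRD cisD.
by rewrite rmorphM /=; ring.
Qed.

Lemma cexp0 : cexp 0 = 1.
Proof. by rewrite /cexp /= expR0 /cis cos0 sin0 mul1r. Qed.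

Lemma normc_cexp z : normc (cexp z) = expR (complex.Re z).
Proof. by rewrite Normc.normcM normc_cis mulr1 normc_real ger0_norm ?expR_ge0. Qed.

Lemma cexp2pi (z : R[i]) : cexp (z + (0 +i* (pi *+ 2))) = cexp z.
Proof.
case: z => x y; rewrite /cexp /= addr0 /cis.
by rewrite cosD2pi sinD2pi.
Qed.

Let derive_bound (f : R -> R) (x d e : R) : is_derive x (1 : R) f d -> 0 < e ->
  exists2 k : R, 0 < k & forall h, `|h| <= k -> `|f (h + x) - f x - d * h| <= e * `|h|.
Proof.
move=> [/derivable1_diffP df dE] e0.
have dE' : 'd f x (1 : R) = d by rewrite -dE; exact/esym/deriveE.
have /eqaddoP/(_ _ e0) := diff_locally df.
rewrite /= => /nbhs_ballP[k /= k0 kP].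
exists (k / 2); first by rewrite divr_gt0.
move=> h hk; have := kP h; rewrite -ball_normE /= sub0r normrN.
move=> /(_ (le_lt_trans hk _)); rewrite ltr_pdivrMr// ltr_pMr// ltr1n => /(_ isT).
rewrite !fctE /=; apply: le_trans.
have -> : 'd f x h = d * h.
  by rewrite -dE' -[in LHS](mulr1 h) -[h * 1]/(h *: (1 : R)) linearZ /= mulrC.
by rewrite le_eqVlt; apply/orP; left; apply/eqP; congr `| _ |; ring.
Qed.

Lemma has_cderiv_cexp z : has_cderiv cexp z (cexp z).
Proof.
(* The addition formula moves the difference quotient at [z] to the origin, at the price of the
   factor [cexp z]. *)
suff H0 : has_cderiv cexp 0 1.
  move=> e e0; have E0 : 0 < normc (cexp z) by rewrite normc_cexp expR_gt0.
  have [|k k0 kP] := H0 (e / normc (cexp z)); first by rewrite divr_gt0.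
  exists k => // w wk; have := kP (w - z); rewrite subr0 => /(_ wk) b.
  have -> : cexp w - cexp z - cexp z * (w - z)
      = cexp z * (cexp (w - z) - cexp 0 - 1 * (w - z)).
    have -> : cexp w = cexp (w - z) * cexp z by rewrite -cexpD subrK.
    by rewrite cexp0; ring.
  rewrite Normc.normcM; apply: le_trans (ler_wpM2l (ltW E0) b) _.
  by rewrite mulrA mulrCA divff ?gt_eqF// mulr1.
(* The error splits into four terms, bounded by 1, 2, 2 and 2 times [e / 8 * N]; the cap at 1,
   together with [N <= 1 / 2], gives the bound [expR s <= 2] used for them. *)
move=> e e0; have e8 : 0 < Num.min 1 (e / 8) by rewrite lt_min ltr01 divr_gt0.
have [k1 k10 hE] := derive_bound (is_derive_expR 0) e8.
have [k2 k20 hC] := derive_bound (is_derive_cos 0) e8.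
have [k3 k30 hS] := derive_bound (is_derive_sin 0) e8.
exists (Num.min (Num.min k1 k2) (Num.min k3 (Num.min (1 / 2) (e / 8)))).
  by rewrite !lt_min k10 k20 k30 !divr_gt0.
case=> s t; rewrite subr0 mul1r cexp0 !le_min.
set N := normc _ => /andP[/andP[n1 n2] /and3P[n3 n4 n5]].
have sN : `|s| <= N := abs_Re_le_normc (s +i* t).
have tN : `|t| <= N := abs_Im_le_normc (s +i* t).
have {hE} := hE s (le_trans sN n1); have {hC} := hC t (le_trans tN n2).
have {hS} := hS t (le_trans tN n3).
rewrite !addr0 expR0 sin0 cos0 oppr0 mul0r !mul1r !subr0 addr0.
set m := Num.min _ _ => hS hC hE.
have N0 : 0 <= N by exact: normc_ge0.
have [m0 m1 me] : [/\ 0 <= m, m <= 1 & m <= e / 8].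
  by rewrite ltW// ge_min lexx ge_min lexx orbT.
have mN (u : R) : `|u| <= N -> m * `|u| <= e / 8 * N.
  by move=> uN; rewrite ler_pM.
have E1 : `|expR s - 1| <= 2 * N.
  have : `|expR s - 1 - s| <= N.
    by apply: le_trans hE _; rewrite -[leRHS]mul1r ler_pM.
  by move: sN; rewrite !ler_norml; lra.
have E2 : 0 < expR s <= 2 by rewrite expR_gt0 /=; move: E1; rewrite ler_norml; lra.
have eE : expR s = (1 + s) + (expR s - 1 - s) by ring.
have hE' := le_trans hE (mN s sN); have hC' := le_trans hC (mN t tN).
have hS' := le_trans hS (mN t tN).
have b1 : `|expR s * (cos t - 1)| <= 2 * (e / 8 * N).
  by rewrite normrM ler_pM// ger0_norm; lra.
have b2 : `|expR s * (sin t - t)| <= 2 * (e / 8 * N).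
  by rewrite normrM ler_pM// ger0_norm; lra.
have b3 : `|(expR s - 1) * t| <= 2 * N * (e / 8).
  by rewrite normrM ler_pM//; lra.
rewrite /cexp /cis /= mul0r subr0 mul0r addr0.
apply: le_trans (normc_le_absD _ _) _.
have -> : expR s * cos t - 1 - s = (expR s - 1 - s) + expR s * (cos t - 1) by ring.
have -> : expR s * sin t - 0 - t = expR s * (sin t - t) + (expR s - 1) * t by ring.
have c1 := ler_normD (expR s - 1 - s) (expR s * (cos t - 1)).
have c2 := ler_normD (expR s * (sin t - t)) ((expR s - 1) * t).
have : 0 <= e * N by rewrite mulr_ge0// ltW.
lra.
Qed.

End complex_exponential.

(** * Mean value property and sub-mean value inequality on the unit circle *)

Section mean_value.
Variable R : realType.
Local Notation normc := (@Normc.normc R).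
Local Notation mu := (@lebesgue_measure R).

Lemma locally_lipschitz_continuous (f : R -> R) (x C k : R) : 0 < k ->
  (forall y, `|y - x| <= k -> `|f y - f x| <= C * `|y - x|) ->
  {for x, continuous f}.
Proof.
move=> k0 fC; apply/cvgrPdist_le => e e0.
have C1 : 0 < `|C| + 1 by rewrite ltr_wpDl.
exists (Num.min k (e / (`|C| + 1))); first by rewrite /= lt_min k0 divr_gt0.
move=> y /=; rewrite distrC lt_min => /andP[yk ye].
rewrite distrC; apply: le_trans (fC _ (ltW yk)) _.
apply: le_trans (_ : (`|C| + 1) * `|y - x| <= _); last by rewrite mulrC -ler_pdivlMr// ltW.
by rewrite ler_wpM2r// (le_trans (ler_norm _))// lerDl.
Qed.

(** The integral starts at [a - k] and continuity is asked up to [b + k], so that every point of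
    [[a, b]] is interior and the derivative is two-sided even at the endpoints. *)
Lemma exists_primitive (f : R -> R) (a b k : R) : 0 < k ->
  (forall x, x \in `[a - k, b + k] -> {for x, continuous f}) ->
  exists F : R -> R, forall x, x \in `[a, b] -> is_derive x (1 : R) F (f x).
Proof.
move=> k0 cf; pose F x := (\int[mu]_(t in [set` `[a - k, x]]) f t)%R.
exists F => x xab.
have itf : mu.-integrable `[a - k, b + k] (EFin \o f).
  apply: continuous_compact_integrable; first exact: segment_compact.
  by apply: continuous_in_subspaceT => y; rewrite inE; exact: cf.
have [||| dF FE] := @continuous_FTC1_closed R f (a - k) x (b + k) _ itf.
- by move: xab; rewrite in_itv /=; lra.
- by move: xab; rewrite in_itv /=; lra.
- by apply: cf; move: xab; rewrite !in_itv /=; lra.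
have D : 'D_1 F x = f x by rewrite -derive1E.
exact: DeriveDef dF D.
Qed.

Section mean_value_Re.
Variables (H : R[i] -> R[i]) (b : R).
Hypotheses (b0 : 0 < b) (dH : forall z, normc z < expR b -> cdifferentiable H z).

Let K (x y : R) := H (cexp (x +i* y)).

Let dK x y : x < b -> cdifferentiable (H \o @cexp R) (x +i* y).
Proof.
move=> xb; apply: cdifferentiable_comp.
  by exists (cexp (x +i* y)); exact: has_cderiv_cexp.
by apply: dH; rewrite normc_cexp ltr_expR.
Qed.

Let Kper x : K x (pi *+ 2) = K x 0.
Proof.
rewrite /K -(cexp2pi (x +i* 0)); congr (H (cexp _)).
by apply/eqP; rewrite eq_complex /= addr0 add0r !eqxx.
Qed.

Let lipK x y : x < b -> exists k C : R, 0 < k /\ forall x' y',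
  `|x' - x| <= k -> `|y' - y| <= k -> normc (K x' y' - K x y) <= C * (`|x' - x| + `|y' - y|).
Proof.
move=> /(dK y)[c dc]; have [k k0 kP] := has_cderiv_lipschitz dc.
exists (k / 2), (normc c + 1); split; first by rewrite divr_gt0.
move=> x' y' hx hy; have E : normc (x' +i* y' - x +i* y) <= `|x' - x| + `|y' - y|.
  exact: normc_le_absD.
apply: le_trans (kP _ _) _; last by rewrite ler_wpM2l// addr_ge0 ?normc_ge0.
by apply: le_trans E _; rewrite [k]splitr lerD.
Qed.

Let cK (p : R[i] -> R) x y : x < b -> (forall z w, `|p z - p w| <= normc (z - w)) ->
  {for y, continuous (fun v => p (K x v))}.
Proof.
move=> xb pL; have [k [C [k0 kP]]] := lipK y xb.
apply: (@locally_lipschitz_continuous _ _ C k) => // v vy.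
apply: le_trans (pL _ _) _; have := kP x v; rewrite subrr normr0 add0r.
by apply=> //; exact: ltW.
Qed.

Let cK' (p : R[i] -> R) x y : x < b -> (forall z w, `|p z - p w| <= normc (z - w)) ->
  {for x, continuous (fun u => p (K u y))}.
Proof.
move=> xb pL; have [k [C [k0 kP]]] := lipK y xb.
apply: (@locally_lipschitz_continuous _ _ C k) => // v vy.
apply: le_trans (pL _ _) _; have := kP v y; rewrite subrr normr0 addr0.
by apply=> //; exact: ltW.
Qed.

Let ReL (z w : R[i]) : `|complex.Re z - complex.Re w| <= normc (z - w).
Proof. by rewrite (le_trans _ (abs_Re_le_normc _))// raddfB. Qed.

Let ImL (z w : R[i]) : `|complex.Im z - complex.Im w| <= normc (z - w).
Proof. by rewrite (le_trans _ (abs_Im_le_normc _))// raddfB. Qed.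

Let normL (z w : R[i]) : `|normc z - normc w| <= normc (z - w).
Proof.
have h u v : normc u - normc v <= normc (u - v).
  by rewrite lerBlDr; apply: le_trans (le_normcD _ _); rewrite subrK.
by rewrite ler_norml h andbT lerNl opprB (le_trans (h _ _))// normc_sub.
Qed.

Let pi20 : 0 < pi *+ 2 :> R. Proof. by rewrite pmulrn_lgt0// pi_gt0. Qed.

Let exists_G : exists G : R -> R -> R, forall x, x < b -> forall y, y \in `[0, pi *+ 2] ->
  is_derive y (1 : R) (G x) (complex.Re (K x y)).
Proof.
have /choice[G GP] : forall x, exists g : R -> R, x < b -> forall y, y \in `[0, pi *+ 2] ->
    is_derive y (1 : R) g (complex.Re (K x y)).
  move=> x; have [xb|] := ltP x b; last by exists id.
  have [|g gP] := @exists_primitive (fun v => complex.Re (K x v)) 0 (pi *+ 2) 1 ltr01.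
    by move=> v _; apply: cK => //; exact: ReL.
  by exists g => _.
by exists G.
Qed.

(** The margin [b / 2] to the right of [x = 0] is where holomorphy beyond the closed unit disc is
    used: the primitive must be differentiable at [0], that is, on the unit circle. *)
Let exists_F (a : R) : exists F : R -> R -> R, forall x y, x \in `[a, 0] ->
  is_derive x (1 : R) (F ^~ y) (complex.Im (K x y)).
Proof.
have /choice[G GP] : forall y, exists g : R -> R, forall x, x \in `[a, 0] ->
    is_derive x (1 : R) g (complex.Im (K x y)).
  move=> y; have [||g gP] := @exists_primitive (fun v => complex.Im (K v y)) a 0 (b / 2).
  - by rewrite divr_gt0.
  - by move=> v; rewrite in_itv /= => vI; apply: cK'; [move: b0; lra|exact: ImL].
  by exists g.
by exists (fun x y => G y x) => x y; exact: GP.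
Qed.

(** With [z = x + i y] the closed form is [Im (K dz) = Im K dx + Re K dy], so [green_goursat]
    compares the integrals of [Re K] over two vertical segments, which are the circles of radius [1]
    and [expR a]. *)
Let G_const (G : R -> R -> R) : (forall x, x < b -> forall y, y \in `[0, pi *+ 2] ->
    is_derive y (1 : R) (G x) (complex.Re (K x y))) ->
  forall a, a < 0 -> G 0 (pi *+ 2) - G 0 0 = G a (pi *+ 2) - G a 0.
Proof.
move=> dG a a0; have [F dF] := exists_F a.
have dF' x y : x \in `[a, 0] -> y \in `[0, pi *+ 2] ->
  is_derive x (1 : R) (F ^~ y) (complex.Im (K x y)) by move=> xI _; exact: dF.
have dG' x y : x \in `[a, 0] -> y \in `[0, pi *+ 2] ->
  is_derive y (1 : R) (G x) (complex.Re (K x y)).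
  by rewrite in_itv /= => xI yI; apply: dG => //; move: b0; lra.
have CR x y : x \in `[a, 0] -> y \in `[0, pi *+ 2] ->
  exists A B D : R, forall e : R, 0 < e -> exists2 k : R, 0 < k & forall x' y',
    `|x' - x| <= k -> `|y' - y| <= k ->
    `|complex.Im (K x' y') - complex.Im (K x y) - (A * (x' - x) + B * (y' - y))|
      <= e * (`|x' - x| + `|y' - y|) /\
    `|complex.Re (K x' y') - complex.Re (K x y) - (B * (x' - x) + D * (y' - y))|
      <= e * (`|x' - x| + `|y' - y|).
   rewrite in_itv /= => xI _; have xb : x < b by move: b0; lra.
  have [[al be] dc] := dK y xb.
  (* Cauchy-Riemann: multiplying the increment by [al + i be] gives imaginary part [be dx + al dy]
     and real part [al dx - be dy], so the mixed coefficient is [al] in both. *)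
  exists be, al, (- be) => e e0; have [k k0 kP] := dc _ e0.
  exists (k / 2); first by rewrite divr_gt0.
  move=> x' y' hx hy; have E : normc (x' +i* y' - x +i* y) <= `|x' - x| + `|y' - y|.
    exact: normc_le_absD.
  have {kP} := kP (x' +i* y') (le_trans E _); rewrite {1}[k]splitr => /(_ (lerD hx hy)).
  move=> /le_trans /(_ (ler_wpM2l (ltW e0) E)) => bd.
  split.
    apply: le_trans bd; apply: le_trans (abs_Im_le_normc _).
    by rewrite !raddfB /= le_eqVlt; apply/orP; left; apply/eqP; congr `| _ |; ring.
  apply: le_trans bd; apply: le_trans (abs_Re_le_normc _).
  by rewrite !raddfB /= le_eqVlt; apply/orP; left; apply/eqP; congr `| _ |; ring.
have {CR} := green_goursat a0 pi20 dF' dG' CR.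
have mvt y : {within `[a, 0], continuous (fun x => F x y)}.
  by apply: derivable_within_continuous => x xI; have [] := dF _ y xI.
(* The primitives at heights [0] and [pi *+ 2] were chosen independently, but [Kper] gives them the
   same derivative; their increments agree and the horizontal sides cancel. *)
have dFF x : x \in `]a, 0[ -> is_derive x (1 : R) (fun u => F u 0 - F u (pi *+ 2)) 0.
  move=> /subset_itv_oo_cc xI.
  by have := is_deriveB (dF x 0 xI) (dF x (pi *+ 2) xI); rewrite Kper subrr.
have [|z _] := MVT a0 dFF.
  apply: derivable_within_continuous => x xI.
  by have [] := is_deriveB (dF x 0 xI) (dF x (pi *+ 2) xI).
by rewrite mul0r; lra.
Qed.

Lemma mean_value_Re : (\int[mu]_(v in `[(0 : R)%R, (pi *+ 2)%R]) (complex.Re (H (cis v)))%:E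
  = (pi *+ 2 * complex.Re (H 0))%R%:E)%E.
Proof.
have [G dG] := exists_G.
have K0 (v : R) : H (cis v) = K 0 v by rewrite /K /cexp /= expR0 mul1r.
have cG (x : R) : x < b -> {within `[(0 : R), pi *+ 2], continuous (G x)}.
  by move=> xb; apply: derivable_within_continuous => y yI; have [] := dG _ xb _ yI.
under eq_integral do rewrite K0.
rewrite (@continuous_FTC2 _ _ (G 0)) //; last 3 first.
- by apply: continuous_in_subspaceT => y _; apply: cK => //; exact: ReL.
- have [c1 c2 c3] := (continuous_within_itvP _ pi20).1 (cG 0 b0).
  split => // y /subset_itv_oo_cc yI.
  by have [] := dG _ b0 _ yI.
- by move=> y /subset_itv_oo_cc yI; rewrite derive1E; have [_] := dG _ b0 _ yI.
rewrite -EFinB; congr EFin; apply/eqP; rewrite -subr_eq0 -normr_le0.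
apply/ler_addgt0Pl => e e0; rewrite addr0.
have [|c dc] := dH (z := 0); first by rewrite Normc.normc0 expR_gt0.
have [k k0 kP] := has_cderiv_lipschitz dc.
have C0 : 0 < normc c + 1 by rewrite ltr_wpDl ?normc_ge0.
have e'0 : 0 < e / (pi *+ 2) / (normc c + 1) by rewrite !divr_gt0.
(* The radius of a small circle: [1 / 2] makes [ln rho] negative, [k] keeps the circle where the
   Lipschitz bound at 0 holds, and the last term makes the total error at most [e]. *)
pose rho := Num.min (1 / 2) (Num.min k (e / (pi *+ 2) / (normc c + 1))).
have r0 : 0 < rho by rewrite !lt_min k0 e'0 !divr_gt0.
have a0 : ln rho < 0 by rewrite ln_lt0// r0/= gt_min; apply/orP; left; lra.
have ab : ln rho < b by exact: lt_trans b0.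
rewrite (G_const dG a0).
have dGo y : y \in `]0, pi *+ 2[ -> is_derive y (1 : R) (G (ln rho)) (complex.Re (K (ln rho) y)).
  by move=> /subset_itv_oo_cc; exact: dG.
(* The mean over the small circle equals [Re H] at one point of that circle, which is close to
   [Re (H 0)]. *)
have [z zI ->] := MVT pi20 dGo (cG _ ab).
rewrite subr0 [X in X - _]mulrC -mulrBr normrM (gtr0_norm pi20) mulrC -ler_pdivlMr//.
apply: le_trans (ReL _ _) _.
have nz : normc (cexp (ln rho +i* z) - 0) = rho by rewrite subr0 normc_cexp /= lnK.
apply: le_trans (kP _ _) _; rewrite nz /rho.
  by rewrite !ge_min lexx !orbT.
by rewrite mulrC -ler_pdivlMr// !ge_min lexx !orbT.
Qed.

Lemma measurable_normc_circle :
  measurable_fun `[(0 : R), pi *+ 2] (fun v => normc (H (cis v))).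
Proof.
apply: subspace_continuous_measurable_fun => //.
apply: continuous_in_subspaceT => y _.
have K0 : (fun v => normc (H (cis v))) = (fun v => normc (K 0 v)).
  by apply/funext => v; rewrite /K /cexp /= expR0 mul1r.
by rewrite K0; apply: cK => //; exact: normL.
Qed.

Lemma measurable_Re_circle :
  measurable_fun `[(0 : R), pi *+ 2] (fun v => complex.Re (H (cis v))).
Proof.
apply: subspace_continuous_measurable_fun => //.
apply: continuous_in_subspaceT => y _.
have K0 : (fun v => complex.Re (H (cis v))) = (fun v => complex.Re (K 0 v)).
  by apply/funext => v; rewrite /K /cexp /= expR0 mul1r.
by rewrite K0; apply: cK => //; exact: ReL.
Qed.

End mean_value_Re.

(** The real mean value property suffices: multiply [H] by the unimodular constant [c] that makes
    [c * H 0] real and positive, and bound the real part by the modulus under the integral. *)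
Lemma sub_mean_value (H : R[i] -> R[i]) (b : R) : 0 < b ->
  (forall z, normc z < expR b -> cdifferentiable H z) ->
  ((pi *+ 2 * normc (H 0))%R%:E <=
   \int[mu]_(v in `[(0 : R)%R, (pi *+ 2)%R]) (normc (H (cis v)))%:E)%E.
Proof.
move=> b0 dH; have [H0|H0] := eqVneq (H 0) 0.
  rewrite H0 Normc.normc0 mulr0; apply: integral_ge0 => v _.
  by rewrite lee_fin normc_ge0.
pose c := ((normc (H 0))^-1)%:C * (H 0)^*%C.
have nH : 0 < normc (H 0) by rewrite normc_gt0.
have nc : normc c = 1.
  by rewrite Normc.normcM normc_conj normc_real gtr0_norm ?invr_gt0// mulVf// gt_eqF.
have d z : normc z < expR b -> cdifferentiable (fun z => c * H z) z.
  move=> /dH dz; apply: (cdifferentiable_comp dz); exists c; exact: has_cderiv_scale.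
have := mean_value_Re b0 d.
have -> : complex.Re (c * H 0) = normc (H 0).
  rewrite /c -mulrA [_^*%C * _]mulrC mulc_conj -rmorphM /= expr2 mulKf// gt_eqF//.
move=> <-; have mR := measurable_Re_circle b0 d; have mN := measurable_normc_circle b0 dH.
apply: le_trans (lee_abs _) _.
apply: le_trans (le_abse_integral _ _ _) _ => //.
  exact/measurable_EFinP.
apply: ge0_le_integral => //.
- by apply: measurableT_comp => //; exact/measurable_EFinP.
- exact/measurable_EFinP.
- move=> x _; rewrite lee_fin (le_trans (abs_Re_le_normc _))//.
  by rewrite Normc.normcM nc mul1r.
Qed.

End mean_value.

(** * Hermitian geometry of the space of row vectors *)

Section hermitian.
Variables (R : realType) (n : nat).
Local Notation V := 'rV[R[i]]_n.
Local Notation normc := (@Normc.normc R).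
Implicit Types (x y v e : V) (s t : R[i]).

Definition hdot x y : R[i] := \sum_j x 0 j * (y 0 j)^*%C.

Definition sqn x : R := \sum_j normc (x 0 j) ^+ 2.

Lemma hdotDl x y v : hdot (x + y) v = hdot x v + hdot y v.
Proof. by rewrite -big_split; apply: eq_bigr => j _; rewrite mxE mulrDl. Qed.

Lemma hdotZl s x y : hdot (s *: x) y = s * hdot x y.
Proof. by rewrite mulr_sumr; apply: eq_bigr => j _; rewrite mxE mulrA. Qed.

Lemma hdotC x y : hdot x y = (hdot y x)^*%C.
Proof.
by rewrite rmorph_sum; apply: eq_bigr => j _; rewrite rmorphM /= conjcK mulrC.
Qed.

Lemma hdotDr x y v : hdot v (x + y) = hdot v x + hdot v y.
Proof. by rewrite !(hdotC v) hdotDl rmorphD. Qed.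

Lemma hdotZr s x y : hdot x (s *: y) = s^*%C * hdot x y.
Proof. by rewrite !(hdotC x) hdotZl rmorphM. Qed.

Lemma hdotNl x y : hdot (- x) y = - hdot x y.
Proof. by rewrite -scaleN1r hdotZl mulN1r. Qed.

Lemma hdotNr x y : hdot x (- y) = - hdot x y.
Proof. by rewrite !(hdotC x) hdotNl rmorphN. Qed.

Lemma hdotBl x y v : hdot (x - y) v = hdot x v - hdot y v.
Proof. by rewrite hdotDl hdotNl. Qed.

Lemma hdotBr x y v : hdot v (x - y) = hdot v x - hdot v y.
Proof. by rewrite hdotDr hdotNr. Qed.

Lemma hdot0l x : hdot 0 x = 0.
Proof. by rewrite -(scale0r x) hdotZl mul0r. Qed.

Lemma hdot0r x : hdot x 0 = 0.
Proof. by rewrite hdotC hdot0l conjc0. Qed.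

Lemma hdotxx x : hdot x x = (sqn x)%:C.
Proof. by rewrite rmorph_sum; apply: eq_bigr => j _; rewrite mulc_conj. Qed.

Lemma sqn_ge0 x : 0 <= sqn x.
Proof. by apply: sumr_ge0 => j _; exact: sqr_ge0. Qed.

Lemma sqn_eq0 x : (sqn x == 0) = (x == 0).
Proof.
apply/eqP/eqP => [x0|->]; last first.
  by rewrite /sqn big1// => j _; rewrite mxE Normc.normc0 expr0n.
apply/rowP => j; rewrite mxE; apply: Normc.eq0_normc; apply/eqP.
rewrite -sqrf_eq0; apply/eqP.
by apply: (psumr_eq0P _ x0) => // i _; exact: sqr_ge0.
Qed.

Lemma sqnZ s x : sqn (s *: x) = normc s ^+ 2 * sqn x.
Proof.
by rewrite mulr_sumr; apply: eq_bigr => j _; rewrite mxE Normc.normcM exprMn.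
Qed.

Lemma sqnN x : sqn (- x) = sqn x.
Proof. by apply: eq_bigr => j _; rewrite mxE normcN. Qed.

Lemma sqnD x y : sqn (x + y) = sqn x + sqn y + complex.Re (hdot x y) *+ 2.
Proof.
have := hdotxx (x + y); rewrite hdotDl !hdotDr !hdotxx [hdot y x]hdotC.
move=> /(congr1 (@complex.Re R)); case: (hdot x y) => p q /= <-.
by ring.
Qed.

Lemma sqnB x y : sqn (x - y) = sqn x + sqn y - complex.Re (hdot x y) *+ 2.
Proof. by rewrite sqnD sqnN hdotNr raddfN /= mulNrn. Qed.

Lemma cauchy_schwarz x y : normc (hdot x y) ^+ 2 <= sqn x * sqn y.
Proof.
have [->|y0] := eqVneq y 0; first by rewrite hdot0r Normc.normc0 expr0n mulr_ge0 ?sqn_ge0.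
have sy : 0 < sqn y by rewrite lt_def sqn_eq0 y0 sqn_ge0.
have := sqn_ge0 ((sqn y)%:C *: x - hdot x y *: y).
rewrite sqnB !sqnZ hdotZl hdotZr normc_real (gtr0_norm sy).
rewrite [_^*%C * _]mulrC mulc_conj -rmorphM /=.
have -> : sqn y ^+ 2 * sqn x + normc (hdot x y) ^+ 2 * sqn y
   - (sqn y * normc (hdot x y) ^+ 2) *+ 2
  = sqn y * (sqn x * sqn y - normc (hdot x y) ^+ 2) by ring.
by rewrite pmulr_rge0// subr_ge0.
Qed.

Lemma euclid_normE x : euclid_norm x = Num.sqrt (sqn x).
Proof. by []. Qed.

Lemma sqr_euclid_norm x : euclid_norm x ^+ 2 = sqn x.
Proof. by rewrite euclid_normE sqr_sqrtr// sqn_ge0. Qed.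

Lemma euclid_norm_ge0 x : 0 <= euclid_norm x.
Proof. exact: sqrtr_ge0. Qed.

Lemma normc_hdot_le x y : normc (hdot x y) <= euclid_norm x * euclid_norm y.
Proof.
rewrite -(ler_pXn2r (n := 2)) ?nnegrE ?normc_ge0 ?mulr_ge0 ?euclid_norm_ge0//.
by rewrite exprMn !sqr_euclid_norm cauchy_schwarz.
Qed.

Lemma euclid_normD x y : euclid_norm (x + y) <= euclid_norm x + euclid_norm y.
Proof.
rewrite -(ler_pXn2r (n := 2)) ?nnegrE ?addr_ge0 ?euclid_norm_ge0//.
rewrite sqrrD !sqr_euclid_norm sqnD [leRHS]addrAC lerD2l lerMn2r /=.
exact: le_trans (le_trans (ler_norm _) (abs_Re_le_normc _)) (normc_hdot_le _ _).
Qed.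

Lemma euclid_normN x : euclid_norm (- x) = euclid_norm x.
Proof. by rewrite !euclid_normE sqnN. Qed.

Lemma euclid_normZ s x : euclid_norm (s *: x) = normc s * euclid_norm x.
Proof. by rewrite !euclid_normE sqnZ sqrtrM ?sqr_ge0// sqrtr_sqr ger0_norm ?normc_ge0. Qed.

Lemma euclid_norm_eq0 x : (euclid_norm x == 0) = (x == 0).
Proof. by rewrite -sqrf_eq0 sqr_euclid_norm sqn_eq0. Qed.

Lemma euclid_norm0 : euclid_norm (0 : V) = 0.
Proof. by apply/eqP; rewrite euclid_norm_eq0. Qed.

Lemma euclid_ballE x y (r : R) : 0 < r -> euclid_ball x r y <-> sqn (y - x) < r ^+ 2.
Proof.
move=> r0; rewrite /euclid_ball /= -sqr_euclid_norm.
by rewrite ltr_pXn2r// ?nnegrE ?euclid_norm_ge0// ltW.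
Qed.

Lemma normc_le_euclid_norm x j : normc (x 0 j) <= euclid_norm x.
Proof.
rewrite -(ler_pXn2r (n := 2)) ?nnegrE ?normc_ge0 ?euclid_norm_ge0//.
rewrite sqr_euclid_norm /sqn (bigD1 j)//= lerDl.
by apply: sumr_ge0 => i _; exact: sqr_ge0.
Qed.

Lemma euclid_norm_le_sum x : euclid_norm x <= \sum_j normc (x 0 j).
Proof.
have h0 : 0 <= \sum_j normc (x 0 j) by apply: sumr_ge0 => j _; exact: normc_ge0.
rewrite -(ler_pXn2r (n := 2)) ?nnegrE ?euclid_norm_ge0//.
rewrite sqr_euclid_norm expr2 mulr_suml; apply: ler_sum => i _.
rewrite expr2 ler_wpM2l ?normc_ge0// (bigD1 i)//= lerDl.
by apply: sumr_ge0 => j _; exact: normc_ge0.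
Qed.

Definition proj e x := hdot x e *: e.
Definition perp e x := x - proj e x.
(* acts as [s] on the line spanned by [e] and as [t] on its orthogonal
   complement, provided [e] is a unit vector; for [e = 0] it is [t *: x] *)
Definition dil e s t x := s *: proj e x + t *: perp e x.

Lemma hdot_isE s x y v : hdot (s *: x + y) v = s * hdot x v + hdot y v.
Proof. by rewrite hdotDl hdotZl. Qed.

Lemma projZD e s x y : proj e (s *: x + y) = s *: proj e x + proj e y.
Proof. by rewrite /proj hdot_isE scalerDl scalerA. Qed.

Lemma perpZD e s x y : perp e (s *: x + y) = s *: perp e x + perp e y.
Proof. by rewrite /perp projZD scalerBr opprD addrACA. Qed.

Lemma proj_perpK e x : proj e x + perp e x = x.
Proof. by rewrite /perp addrC subrK. Qed.

Lemma dilZD e s t (a : R[i]) x y : dil e s t (a *: x + y) = a *: dil e s t x + dil e s t y.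
Proof.
rewrite /dil projZD perpZD !scalerDr !scalerA [s * a]mulrC [t * a]mulrC.
by rewrite addrACA.
Qed.

Lemma dilD e s t x y : dil e s t (x + y) = dil e s t x + dil e s t y.
Proof. by rewrite -[x in LHS](scale1r x) dilZD scale1r. Qed.

Lemma dil11 e x : dil e 1 1 x = x.
Proof. by rewrite /dil !scale1r proj_perpK. Qed.

Lemma dil_zero s t x : dil 0 s t x = t *: x.
Proof. by rewrite /dil /perp /proj !scaler0 subr0 add0r. Qed.

Section idempotent.
Variable e : V.
(** Holds exactly when [proj e] is idempotent on [e]: for unit vectors and for [e = 0]. Both the
    general and the concentric case then share the same algebra. *)
Hypothesis he : hdot e e *: e = e.

Let hdot_e x : hdot x e * hdot e e = hdot x e.
Proof. by rewrite -{4}he hdotZr hdotxx conjc_real mulrC. Qed.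

Lemma hdot_proj x : hdot (proj e x) e = hdot x e.
Proof. by rewrite hdotZl hdot_e. Qed.

Lemma hdot_perp x : hdot (perp e x) e = 0.
Proof. by rewrite hdotBl hdot_proj subrr. Qed.

Lemma proj_proj x : proj e (proj e x) = proj e x.
Proof. by rewrite {1}/proj hdot_proj. Qed.

Lemma proj_perp x : proj e (perp e x) = 0.
Proof. by rewrite /proj hdot_perp scale0r. Qed.

Lemma proj_dil s t x : proj e (dil e s t x) = s *: proj e x.
Proof.
rewrite projZD proj_proj -[t *: _]addr0 projZD proj_perp scaler0 !add0r.
by rewrite {2}/proj hdot0l scale0r addr0.
Qed.

Lemma perp_dil s t x : perp e (dil e s t x) = t *: perp e x.
Proof. by rewrite {1}/perp proj_dil /dil addrAC subrr add0r. Qed.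

Lemma dil_comp s t s' t' x : dil e s t (dil e s' t' x) = dil e (s * s') (t * t') x.
Proof.
rewrite -[LHS]/(s *: proj e (dil e s' t' x) + t *: perp e (dil e s' t' x)).
by rewrite proj_dil perp_dil scalerA [t *: (t' *: _)]scalerA.
Qed.

Lemma dilK s t : s != 0 -> t != 0 -> cancel (dil e s t) (dil e s^-1 t^-1).
Proof. by move=> s0 t0 x; rewrite dil_comp !mulVf// dil11. Qed.

Lemma hdot_proj_perp x y : hdot (proj e x) (perp e y) = 0.
Proof. by rewrite hdotZl (hdotC e) hdot_perp conjc0 mulr0. Qed.

Lemma sqn_dil s t x :
  sqn (dil e s t x) = normc s ^+ 2 * sqn (proj e x) + normc t ^+ 2 * sqn (perp e x).
Proof. by rewrite sqnD hdotZl hdotZr hdot_proj_perp !mulr0 mul0rn addr0 !sqnZ. Qed.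

Lemma sqn_proj_perp x : sqn x = sqn (proj e x) + sqn (perp e x).
Proof. by rewrite -{1}(dil11 e x) sqn_dil Normc.normc1 expr1n !mul1r. Qed.

Lemma hdot_dil s t x : hdot (dil e s t x) e = s * hdot x e.
Proof. by rewrite hdotDl hdotZl hdot_proj [hdot (t *: _) _]hdotZl hdot_perp mulr0 addr0. Qed.

End idempotent.

Lemma unit_idem e : sqn e = 1 -> hdot e e *: e = e.
Proof. by move=> e1; rewrite hdotxx e1 scale1r. Qed.

Lemma zero_idem : hdot (0 : V) 0 *: (0 : V) = 0.
Proof. by rewrite scaler0. Qed.

Lemma sqn_proj e x : sqn e = 1 -> sqn (proj e x) = normc (hdot x e) ^+ 2.
Proof. by move=> e1; rewrite sqnZ e1 mulr1. Qed.

Definition householder v x := x - (2 * hdot x v / hdot v v) *: v.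

Lemma householderZD v s x y :
  householder v (s *: x + y) = s *: householder v x + householder v y.
Proof.
rewrite /householder hdot_isE.
have -> : 2 * (s * hdot x v + hdot y v) / hdot v v
    = s * (2 * hdot x v / hdot v v) + 2 * hdot y v / hdot v v by ring.
by rewrite scalerDl -scalerA opprD addrACA scalerBr.
Qed.

Lemma hdot_householder v x y : hdot (householder v x) (householder v y) = hdot x y.
Proof.
have [->|v0] := eqVneq v 0; first by rewrite /householder !scaler0 !subr0.
have sv0 : hdot v v != 0 by rewrite hdotxx fmorph_eq0 sqn_eq0.
have cb : (2 * hdot y v / hdot v v)^*%C = 2 * hdot v y / hdot v v.
  rewrite !rmorphM fmorphV rmorph_nat; congr (_ * _ / _).
    by rewrite [RHS]hdotC.
  by rewrite [RHS]hdotC.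
rewrite /householder hdotBl !hdotBr !hdotZl !hdotZr cb.
by field.
Qed.

Lemma householderK v : involutive (householder v).
Proof.
move=> x; have [->|v0] := eqVneq v 0; first by rewrite /householder !scaler0 !subr0.
have sv0 : hdot v v != 0 by rewrite hdotxx fmorph_eq0 sqn_eq0.
set a := 2 * hdot x v / hdot v v.
have E : 2 * hdot (x - a *: v) v / hdot v v = - a.
  by rewrite hdotBl hdotZl /a; field.
by rewrite -[householder v x]/(x - a *: v) /householder E scaleNr opprK subrK.
Qed.

(** A reflection is self-adjoint, so it can send [e] to [g] only if [hdot e g] is real. Hence [f] is
    first multiplied by the phase [l] of [hdot e f]; the reflection along [e - l *: f] then
    works. *)
Lemma householder_swap e f : sqn e = 1 -> sqn f = 1 -> exists v (l : R[i]),
  normc l = 1 /\ householder v e = l *: f.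
Proof.
move=> e1 f1; pose p := hdot e f; pose q := normc p.
pose l : R[i] := if p == 0 then 1 else (q^-1)%:C * p.
have lp : l^*%C * p = q%:C.
  rewrite /l; case: eqVneq => [p0|p0]; first by rewrite /q p0 Normc.normc0 mulr0.
  have q0 : q != 0 by rewrite normc_eq0.
  have -> : ((q^-1)%:C * p)^*%C = (q^-1)%:C * p^*%C.
    by rewrite rmorphM; congr (_ * _); exact: conjc_real.
  rewrite -mulrA [_^*%C * _]mulrC mulc_conj -rmorphM.
  by rewrite -/q expr2 mulKf.
have nl : normc l = 1.
  rewrite /l; case: eqVneq => [p0|p0]; first exact: Normc.normc1.
  have q0 : 0 < q by rewrite normc_gt0.
  by rewrite Normc.normcM normc_real gtr0_norm ?invr_gt0// mulVf// gt_eqF.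
exists (e - l *: f), l; split => //.
have [v0|v0] := eqVneq (e - l *: f) 0.
  by rewrite /householder v0 scaler0 subr0; apply/eqP; rewrite -subr_eq0 v0.
have lp' : l * p^*%C = q%:C.
  rewrite -[RHS]conjc_real -lp rmorphM; congr (_ * _).
  by rewrite /= conjcK.
have ll : l * l^*%C = 1 by rewrite mulc_conj nl expr1n.
have sv : hdot (e - l *: f) (e - l *: f) = 2 * hdot e (e - l *: f).
  have E1 : hdot (l *: f) (l *: f) = 1 by rewrite hdotZl hdotZr hdotxx f1 mulr1 ll.
  have E2 : hdot (l *: f) e = q%:C by rewrite hdotZl hdotC -/p lp'.
  have E3 : hdot e (l *: f) = q%:C by rewrite hdotZr -/p lp.
  by rewrite hdotBr !hdotBl E1 E2 !hdotBr E3 hdotxx e1; ring.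
have sv0 : hdot (e - l *: f) (e - l *: f) != 0 by rewrite hdotxx fmorph_eq0 sqn_eq0.
by rewrite /householder -sv divff// scale1r opprB addrC subrK.
Qed.

End hermitian.

(** * Lebesgue measure under linear maps *)

Section scales.
Local Open Scope ereal_scope.

(* For invertible [f], the image of a set under [f^-1] has [k] times its measure. *)
Definition scales d (T : measurableType d) (R : realType) (m : set T -> \bar R)
    (f : T -> T) (k : R) :=
  forall A, measurable A -> m (f @^-1` A) = k%:E * m A.

Section pushforward_measure.
Context d1 d2 (T1 : measurableType d1) (T2 : measurableType d2) (R : realType).
Variables (m : {measure set T1 -> \bar R}) (f : T1 -> T2).

Definition pushforward_measure (mf : measurable_fun setT f) :
    {measure set T2 -> \bar R} :=
  measure_function_pushforward__canonical__measure_function_Measure m mf.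

End pushforward_measure.

(** Rewrites a scaling law as an equality of two measures, the form to which uniqueness theorems for
    measures apply. *)
Lemma scalesP d (T : measurableType d) (R : realType) (m : {measure set T -> \bar R})
    (f : T -> T) (mf : measurable_fun setT f) (k : R) (k0 : (0 < k)%R) :
  scales m f k^-1 <->
  (forall A, measurable A ->
     m A = mscale (NngNum (ltW k0)) (pushforward_measure m mf) A).
Proof.
rewrite /mscale /=; split => [sc A mA|E A mA].
  rewrite -[RHS]/(k%:E * m (f @^-1` A)) sc// muleA -EFinM mulfV ?gt_eqF//.
  by rewrite mul1e.
rewrite [in RHS]E// -[X in _ = _ * X]/(k%:E * m (f @^-1` A)).
by rewrite muleA -EFinM mulVf ?gt_eqF// mul1e.
Qed.

Lemma scales_lebesgue (R : realType) (al be : R) : (0 < al)%R ->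
  scales (@lebesgue_measure R) (fun x => al * x + be)%R al^-1.
Proof.
move=> al0; pose f (x : measurableTypeR R) : measurableTypeR R := (al * x + be)%R.
have mf : measurable_fun setT f.
  by apply: measurable_funD => //; apply: measurable_funM.
apply: (proj2 (scalesP _ mf al0)); apply: lebesgue_measure_unique => _ [[a b]] _ <-.
rewrite /mscale /= -[X in _ = _ * X]/(lebesgue_measure (f @^-1` `]a, b])).
have -> : f @^-1` `]a, b] = `]((a - be) / al)%R, ((b - be) / al)%R]%classic.
  apply/seteqP; split => x /=; rewrite !in_itv /= ltr_pdivrMr// ler_pdivlMr//;
    by rewrite /f ltrBlDr lerBrDr mulrC.
rewrite !lebesgue_measure_itv /= !lte_fin ltr_pM2r ?invr_gt0// ltrD2r.
case: ifPn => _; last by rewrite mule0.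
by rewrite -!EFinD -EFinM; congr EFin; field; rewrite gt_eqF.
Qed.

Lemma scales_product d1 d2 (T1 : measurableType d1) (T2 : measurableType d2) (R : realType)
    (m1 : {sigma_finite_measure set T1 -> \bar R})
    (m2 : {sigma_finite_measure set T2 -> \bar R}) f1 f2 (k1 k2 : R) :
  measurable_fun setT f1 -> measurable_fun setT f2 -> (0 < k1)%R -> (0 < k2)%R ->
  scales m1 f1 k1 -> scales m2 f2 k2 ->
  scales (m1 \x m2) (fun p => (f1 p.1, f2 p.2)) (k1 * k2).
Proof.
move=> mf1 mf2 k10 k20 s1 s2.
have mF : measurable_fun setT (fun p : T1 * T2 => (f1 p.1, f2 p.2)).
  by apply: measurable_fun_pair; exact: measurableT_comp.
have k0 : (0 < (k1 * k2)^-1)%R by rewrite invr_gt0 mulr_gt0.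
rewrite -[(k1 * k2)%R]invrK; apply: (proj2 (scalesP _ mF k0)).
apply: product_measure_unique => A B mA mB.
rewrite -[LHS]/(((k1 * k2)^-1)%:E * (m1 \x m2) ((f1 @^-1` A) `*` (f2 @^-1` B))).
have p1 : measurable (f1 @^-1` A) by rewrite -[X in measurable X]setTI; exact: mf1.
have p2 : measurable (f2 @^-1` B) by rewrite -[X in measurable X]setTI; exact: mf2.
rewrite product_measure1E//.
rewrite -[X in _ * X = _]/(m1 (f1 @^-1` A) * m2 (f2 @^-1` B)) s1// s2//.
have -> : k1%:E * m1 A * (k2%:E * m2 B) = (k1 * k2)%:E * (m1 A * m2 B).
  by rewrite EFinM muleACA.
rewrite muleA -EFinM mulVf ?mul1e//.
by rewrite gt_eqF// mulr_gt0.
Qed.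

Section power.
Context d (T : measurableType d) (R : realType).
Variable mu : {sigma_finite_measure set T -> \bar R}.

Definition tuple_map n (g : 'I_n -> T -> T) (t : n.-tuple T) : n.-tuple T :=
  [tuple g j (tnth t j) | j < n].

Lemma measurable_tuple_map n (g : 'I_n -> T -> T) :
  (forall j, measurable_fun setT (g j)) -> measurable_fun setT (tuple_map g).
Proof.
move=> mg; apply/measurable_fun_tnthP => j.
apply: (@eq_measurable_fun _ _ _ _ _ (g j \o @tnth n T ^~ j)).
  by move=> t _ /=; rewrite tnth_mktuple.
by apply: measurableT_comp => //; exact: measurable_tnth.
Qed.

Let cons_tuple n (p : T * n.-tuple T) : n.+1.-tuple T := [tuple of p.1 :: p.2].

Let measurable_cons_tuple n : measurable_fun setT (@cons_tuple n).
Proof. exact: measurable_cons. Qed.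

Lemma scales_power n (g : 'I_n -> T -> T) (k : 'I_n -> R) :
  (forall j, measurable_fun setT (g j)) -> (forall j, 0 < k j)%R ->
  (forall j, scales mu (g j) (k j)) ->
  scales (@power_measure _ _ R mu n) (tuple_map g) (\prod_j k j)%R.
Proof.
elim: n g k => [|n IH] g k mg k0 sg.
  move=> A mA; rewrite big_ord0 mul1e /= !diracE.
  have E : tuple_map g [tuple] = [tuple] by exact: tuple0.
  have -> : ([tuple] \in tuple_map g @^-1` A) = ([tuple] \in A) :> bool.
    by apply/idP/idP; rewrite !inE /preimage /= E.
  by [].
have sF := scales_product (m1 := mu) (m2 := @power_measure _ _ R mu n)
   (mg ord0) (measurable_tuple_map (fun j => mg (lift ord0 j))) (k0 ord0)
   (prodr_gt0 _ (fun j _ => k0 (lift ord0 j))) (sg ord0)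
   (IH _ _ (fun j => mg (lift ord0 j)) (fun j => k0 (lift ord0 j))
      (fun j => sg (lift ord0 j))).
move=> A mA; rewrite big_ord_recl /= /pushforward.
rewrite -sF; last first.
  by rewrite -[X in measurable X]setTI; exact: measurable_cons_tuple.
congr ((mu \x @power_measure _ _ R mu n) _); apply/funext => -[x t] /=.
rewrite /preimage /=; congr (A _); apply: eq_from_tnth => j; rewrite tnth_mktuple.
case: (unliftP ord0 j) => [i|] ->; last by rewrite !tnth0.
by rewrite !tnthS tnth_mktuple.
Qed.

Lemma power_measure_cube n (D : set T) : measurable D ->
  @power_measure _ _ R mu n [set t | forall j, D (tnth t j)] = mu D ^+ n.
Proof.
move=> mD; elim: n => [|n IH].
  by rewrite /= diracE mem_set// => -[].
have mC : measurable [set t : n.-tuple T | forall j, D (tnth t j)].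
  rewrite (_ : [set t | _] = \bigcap_(j in [set: 'I_n]) ((@tnth n T ^~ j) @^-1` D)).
    apply: fin_bigcap_measurable => // j _; rewrite -[X in measurable X]setTI.
    exact: measurable_tnth.
  by apply/seteqP; split => t /= h; [move=> j _; exact: h|move=> j; exact: h].
rewrite expeS -IH -product_measure1E//= /pushforward; congr ((mu \x _) _).
apply/seteqP; split => -[x t] /=.
  move=> h; split => /=; first by have := h ord0; rewrite tnth0.
  by move=> j; have := h (lift ord0 j); rewrite tnthS.
move=> [/= Dx Dt] j; case: (unliftP ord0 j) => [i|] ->; last by rewrite tnth0.
by rewrite tnthS.
Qed.

End power.
End scales.

Section euclidean_topology.
Variables (R : realType) (n : nat).
Local Notation V := 'rV[R[i]]_n.
Local Notation normc := (@Normc.normc R).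

(** Bridge to the library topology, which uses the max norm and radii in [R[i]]; a positive radius
    there has imaginary part 0. *)
Lemma nbhs_euclidP (z : V) (A : set V) :
  nbhs z A <-> exists2 e : R, 0 < e & euclid_ball z e `<=` A.
Proof.
split.
  move=> /nbhs_ballP[[e e'] /= e0 eA].
  move: e0; rewrite ltcE /= => /andP[/eqP e'0 e0]; subst e'.
  exists e => // y zy; apply: eA; split; first by rewrite ltcE /= eqxx.
  move=> i j; rewrite (ord1 i) /ball /= ltcR.
  apply: le_lt_trans zy; rewrite (_ : z 0 j - y 0 j = - (y - z) 0 j).
    rewrite -[X in X <= _]/(normc (- (y - z) 0 j)) normcN; exact: normc_le_euclid_norm.
  by rewrite !mxE opprB.
move=> [e e0 eA]; apply/nbhs_ballP.
(* Summing [n] coordinates of size [e / n.+1%:R] stays strictly below [e], also when [n = 0]. *)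
have d0 : 0 < e / n.+1%:R by rewrite divr_gt0.
exists (e / n.+1%:R)%:C; first by rewrite /= ltcR.
move=> y [_ zy]; apply: eA; rewrite /euclid_ball /=.
apply: le_lt_trans (euclid_norm_le_sum _) _.
apply: (@le_lt_trans _ _ (\sum_(j < n) e / n.+1%:R)).
  apply: ler_sum => j _; rewrite !mxE; have := zy 0 j.
  rewrite /ball /= ltcR -[X in X < _]/(normc (z 0 j - y 0 j)) normc_sub; exact: ltW.
rewrite sumr_const card_ord -[X in X < _]mulr_natr mulrAC -mulrA gtr_pMr//.
by rewrite ltr_pdivrMr// mul1r ltr_nat.
Qed.

Lemma open_euclid_ball (z : V) (r : R) : open (euclid_ball z r).
Proof.
rewrite openE => y zy; apply/nbhs_euclidP.
exists (r - euclid_norm (y - z)); first by rewrite subr_gt0.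
move=> x xy; rewrite /euclid_ball /=.
rewrite (_ : x - z = (x - y) + (y - z)); last by rewrite addrA subrK.
by rewrite (le_lt_trans (euclid_normD _ _))// -ltrBrDr.
Qed.

Lemma open_measurable_rV (A : set V) : open A -> measurable A.
Proof. by move=> oA; apply: sub_sigma_algebra. Qed.

Lemma measurable_euclid_ball (z : V) (r : R) : measurable (euclid_ball z r).
Proof. by apply: open_measurable_rV; exact: open_euclid_ball. Qed.

Lemma open_continuous_measurable_rV (D : set V) (f : V -> R) : open D ->
  (forall x, D x -> {for x, continuous f}) -> measurable_fun D f.
Proof.
move=> oD cf.
apply: (measurability _ (RGenOInfty.measurableE R)) => //= _ [_ [a ->]] <-.
apply: open_measurable_rV; rewrite openE => x [Dx /= fx].
have : nbhs (f x) `]a, +oo[%classic.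
  by apply: open_nbhs_nbhs; split; [exact: rray_open|exact: fx].
move=> /(cf _ Dx) fn; apply: filterI => //; rewrite openE in oD; exact: oD.
Qed.

Lemma lipschitz_measurable_rV (f : V -> R) :
  (forall x y, `|f x - f y| <= euclid_norm (x - y)) -> measurable_fun setT f.
Proof.
move=> fL; apply: open_continuous_measurable_rV; first exact: openT.
move=> x _ A /nbhs_ballP[e /= e0 eA]; apply/nbhs_euclidP; exists e => // y xy.
apply: eA; rewrite -ball_normE /=.
by apply: le_lt_trans (fL _ _) _; rewrite -euclid_normN opprB.
Qed.

Lemma measurable_Re_coord (j : 'I_n) : measurable_fun setT (fun z : V => complex.Re (z 0 j)).
Proof.
apply: lipschitz_measurable_rV => x y.
have := le_trans (abs_Re_le_normc _) (normc_le_euclid_norm (x - y) j).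
by rewrite !mxE raddfB.
Qed.

Lemma measurable_Im_coord (j : 'I_n) : measurable_fun setT (fun z : V => complex.Im (z 0 j)).
Proof.
apply: lipschitz_measurable_rV => x y.
have := le_trans (abs_Im_le_normc _) (normc_le_euclid_norm (x - y) j).
by rewrite !mxE raddfB.
Qed.

Lemma measurable_pair_row : measurable_fun setT (@pair_row R n).
Proof.
apply/measurable_fun_tnthP => j.
apply: (@eq_measurable_fun _ _ _ _ _
  (fun z : V => (complex.Re (z 0 j), complex.Im (z 0 j)))).
  by move=> t _ /=; rewrite tnth_mktuple.
by apply: measurable_fun_pair; [exact: measurable_Re_coord|exact: measurable_Im_coord].
Qed.

End euclidean_topology.

Section complex_measurable.
Context d (T : measurableType d) (R : realType).

(* measurability of a complex function, [R[i]] carrying no sigma-algebra *)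
Definition cmeasurable (f : T -> R[i]) :=
  measurable_fun setT (fun x => complex.Re (f x)) /\
  measurable_fun setT (fun x => complex.Im (f x)).

Lemma cmeasurable_cst c : cmeasurable (fun=> c).
Proof. by split; exact: measurable_cst. Qed.

Lemma cmeasurableD f g : cmeasurable f -> cmeasurable g -> cmeasurable (fun x => f x + g x).
Proof.
move=> [f1 f2] [g1 g2]; split.
  have E x : complex.Re (f x + g x) = complex.Re (f x) + complex.Re (g x) by rewrite raddfD.
  by under eq_fun do rewrite E; exact: measurable_funD.
have E x : complex.Im (f x + g x) = complex.Im (f x) + complex.Im (g x) by rewrite raddfD.
by under eq_fun do rewrite E; exact: measurable_funD.
Qed.

Lemma cmeasurableM f g : cmeasurable f -> cmeasurable g -> cmeasurable (fun x => f x * g x).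
Proof.
move=> [f1 f2] [g1 g2]; split.
  have E x : complex.Re (f x * g x) =
    complex.Re (f x) * complex.Re (g x) - complex.Im (f x) * complex.Im (g x).
    by case: (f x) => a b; case: (g x).
  by under eq_fun do rewrite E; apply: measurable_funB; exact: measurable_funM.
have E x : complex.Im (f x * g x) =
    complex.Re (f x) * complex.Im (g x) + complex.Im (f x) * complex.Re (g x).
  by case: (f x) => a b; case: (g x).
by under eq_fun do rewrite E; apply: measurable_funD; exact: measurable_funM.
Qed.

Lemma cmeasurable_sum (I : Type) (s : seq I) (f : I -> T -> R[i]) :
  (forall i, cmeasurable (f i)) -> cmeasurable (fun x => \sum_(i <- s) f i x).
Proof.
move=> mf; elim: s => [|i s IH].
  by under eq_fun do rewrite big_nil; exact: cmeasurable_cst.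
by under eq_fun do rewrite big_cons; exact: cmeasurableD.
Qed.

Lemma cmeasurable_comp d' (T' : measurableType d') (h : T' -> T) (f : T -> R[i]) :
  measurable_fun setT h -> cmeasurable f ->
  measurable_fun setT (fun x => complex.Re (f (h x))) /\
  measurable_fun setT (fun x => complex.Im (f (h x))).
Proof.
by move=> mh [f1 f2]; split; [exact: (measurableT_comp f1)|exact: (measurableT_comp f2)].
Qed.

Lemma measurable_rV n (f : T -> 'rV[R[i]]_n) :
  (forall j, cmeasurable (fun x => f x 0 j)) -> measurable_fun setT f.
Proof.
move=> mf; have E : f = @complex_row R n \o (@pair_row R n \o f).
  by apply/funext => x /=; rewrite pair_rowK.
rewrite E; apply: measurableT_comp; first exact: measurable_complex_row.
apply/measurable_fun_tnthP => j.
apply: (@eq_measurable_fun _ _ _ _ _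
  (fun x => (complex.Re (f x 0 j), complex.Im (f x 0 j)))).
  by move=> t _ /=; rewrite tnth_mktuple.
by apply: measurable_fun_pair; case: (mf j).
Qed.

Lemma cmeasurable_coord n (f : T -> 'rV[R[i]]_n) j :
  measurable_fun setT f -> cmeasurable (fun x => f x 0 j).
Proof.
move=> mf; split.
  by apply: (measurableT_comp (f := fun z : 'rV[R[i]]_n => complex.Re (z 0 j)));
    [exact: measurable_Re_coord|].
by apply: (measurableT_comp (f := fun z : 'rV[R[i]]_n => complex.Im (z 0 j)));
  [exact: measurable_Im_coord|].
Qed.

Lemma measurable_rVD n (f g : T -> 'rV[R[i]]_n) : measurable_fun setT f ->
  measurable_fun setT g -> measurable_fun setT (fun x => f x + g x).
Proof.
move=> mf mg; apply: measurable_rV => j; under eq_fun do rewrite mxE.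
by apply: cmeasurableD; exact: cmeasurable_coord.
Qed.

Lemma measurable_rVZ n (c : T -> R[i]) (f : T -> 'rV[R[i]]_n) : cmeasurable c ->
  measurable_fun setT f -> measurable_fun setT (fun x => c x *: f x).
Proof.
move=> mc mf; apply: measurable_rV => j; under eq_fun do rewrite mxE.
by apply: cmeasurableM => //; exact: cmeasurable_coord.
Qed.

Lemma measurable_rVN n (f : T -> 'rV[R[i]]_n) : measurable_fun setT f ->
  measurable_fun setT (fun x => - f x).
Proof.
move=> mf; under eq_fun do rewrite -scaleN1r.
by apply: measurable_rVZ => //; exact: cmeasurable_cst.
Qed.

Lemma cmeasurable_hdot n (f : T -> 'rV[R[i]]_n) e : measurable_fun setT f ->
  cmeasurable (fun x => hdot (f x) e).
Proof.
move=> mf; apply: cmeasurable_sum => j.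
by apply: cmeasurableM; [exact: cmeasurable_coord|exact: cmeasurable_cst].
Qed.

Lemma measurable_dil_comp n (e : 'rV[R[i]]_n) (s t : T -> R[i]) (f : T -> 'rV[R[i]]_n) :
  cmeasurable s -> cmeasurable t -> measurable_fun setT f ->
  measurable_fun setT (fun x => dil e (s x) (t x) (f x)).
Proof.
move=> ms mt mf; have mp : measurable_fun setT (fun x => proj e (f x)).
  by apply: measurable_rVZ; [exact: cmeasurable_hdot|exact: measurable_cst].
apply: measurable_rVD; first exact: measurable_rVZ.
apply: measurable_rVZ => //; apply: measurable_rVD => //; exact: measurable_rVN.
Qed.

End complex_measurable.

Section integral_scales.
Context d (T : measurableType d) (R : realType) (m : {measure set T -> \bar R}).
Local Open Scope ereal_scope.

Lemma integral_scales (f : T -> T) (k : R) (D : set T) (g : T -> \bar R) :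
  measurable_fun setT f -> (0 < k)%R -> scales m f k -> measurable D ->
  measurable_fun D g -> (forall x, D x -> 0 <= g x) ->
  \int[m]_(x in f @^-1` D) g (f x) = k%:E * \int[m]_(x in D) g x.
Proof.
move=> mf k0 sc mD mg g0.
have := @ge0_integral_pushforward _ _ _ _ R f mf m D g mD mg.
rewrite /comp => <-; last by move=> x; rewrite inE; exact: g0.
rewrite -(ge0_integral_mscale m mD (NngNum (ltW k0))) //.
by apply: eq_measure_integral => A mA _; exact: sc.
Qed.

Lemma scales_comp (f g : T -> T) (k l : R) : measurable_fun setT g ->
  scales m f k -> scales m g l -> scales m (g \o f) (k * l).
Proof.
move=> mg sf sg A mA; rewrite comp_preimage sf; last first.
  by rewrite -[X in measurable X]setTI; exact: mg.
by rewrite sg// muleA -EFinM.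
Qed.

End integral_scales.

(** * Uniqueness of translation-invariant measures *)

Section translation_invariant_unique.
Variables (R : realType) (n : nat).
Local Notation V := 'rV[R[i]]_n.
Local Open Scope ereal_scope.
Variables m1 m2 : {sigma_finite_measure set V -> \bar R}.
Hypothesis tr1 : forall v, scales m1 (fun x => x + v)%R 1.
Hypothesis tr2 : forall v, scales m2 (fun x => x + v)%R 1.

Let measurable_add_snd : measurable_fun setT (fun p : V * V => p.1 + p.2)%R.
Proof. by apply: measurable_rVD. Qed.

Let measurable_sub_snd : measurable_fun setT (fun p : V * V => p.1 - p.2)%R.
Proof. by apply: measurable_rVD => //; exact: measurable_rVN. Qed.

Let preim d (T : measurableType d) d' (T' : measurableType d') (f : T -> T') B :
  measurable_fun setT f -> measurable B -> measurable (f @^-1` B).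
Proof. by move=> mf mB; rewrite -[X in measurable X]setTI; exact: mf. Qed.

(* Evaluate the product measure of [{(x, y) | x \in A, x + y \in B}] in both orders,
   shifting [x] by [y] in between. *)
Lemma haar_swap (A B : set V) : measurable A -> measurable B ->
  (forall x, A (- x)%R <-> A x) -> m1 A * m2 B = m2 A * m1 B.
Proof.
move=> mA mB sA.
pose E := (fst @^-1` A) `&` ((fun p : V * V => p.1 + p.2)%R @^-1` B).
pose E' := (fst @^-1` B) `&` ((fun p : V * V => p.1 - p.2)%R @^-1` A).
have mE : measurable E.
  by apply: measurableI; apply: preim => //; exact: measurable_fst.
have mE' : measurable E'.
  by apply: measurableI; apply: preim => //; exact: measurable_fst.
have P2 X : measurable X -> (m1 \x m2) X = \int[m2]_y m1 (ysection X y).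
  move=> mX; rewrite (@product_measure_unique _ _ _ _ _ m1 m2 (m1 \x^ m2)%E)//.
  by move=> C D mC mD; exact: product_measure2E.
have t1 (v : V) (X : set V) : measurable X -> m1 ((fun x => x + v)%R @^-1` X) = m1 X.
  by move=> mX; rewrite tr1// mul1e.
have t2 (v : V) (X : set V) : measurable X -> m2 ((fun x => x + v)%R @^-1` X) = m2 X.
  by move=> mX; rewrite tr2// mul1e.
have EE : (m1 \x m2) E = (m1 \x m2) E'.
  rewrite !P2//; apply: eq_integral => y _.
  rewrite -(t1 y (ysection E' y)); last exact: measurable_ysection.
  congr (m1 _); apply/seteqP; split => x; rewrite /ysection /preimage /=;
    by rewrite !inE /E /E' /preimage /= addrK => -[].
have SE : (m1 \x m2) E = m1 A * m2 B.
  transitivity (\int[m1]_x (m2 B * (\1_A x)%:E)).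
    apply: eq_integral => x _ /=; rewrite indicE.
    have [xA|xA] := boolP (x \in A); last first.
      rewrite mule0 (_ : xsection E x = set0) ?measure0//.
      apply/seteqP; split => y //=; rewrite /xsection /= inE => -[/= Ax _].
      by move: xA; rewrite notin_setE.
    rewrite mule1 -(t2 x B)//; congr (m2 _); apply/seteqP; split => y;
      rewrite /xsection /preimage /= inE /E /preimage /= addrC; first by case.
    by move=> By; split => //; rewrite inE in xA.
  rewrite ge0_integralZl//; last by apply/measurable_EFinP; exact: measurable_indic.
  by rewrite integral_indic// setIT muleC.
have SE' : (m1 \x m2) E' = m2 A * m1 B.
  transitivity (\int[m1]_x (m2 A * (\1_B x)%:E)).
    apply: eq_integral => x _ /=; rewrite indicE.
    have [xB|xB] := boolP (x \in B); last first.
      rewrite mule0 (_ : xsection E' x = set0) ?measure0//.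
      apply/seteqP; split => y //=; rewrite /xsection /= inE => -[/= Bx _].
      by move: xB; rewrite notin_setE.
    rewrite mule1 -(t2 (- x)%R A)//; congr (m2 _); apply/seteqP; split => y;
      rewrite /xsection /preimage /= inE /E' /preimage /=.
      by move=> [_]; rewrite -(sA (x - y)%R) opprB.
    by move=> Ay; split; [rewrite inE in xB|rewrite -(sA (x - y)%R) opprB].
  rewrite ge0_integralZl//; last by apply/measurable_EFinP; exact: measurable_indic.
  by rewrite integral_indic// setIT.
by rewrite -SE EE SE'.
Qed.

End translation_invariant_unique.

Section lebesgue_complex.
Variables (R : realType).
Local Notation normc := (@Normc.normc R).
Local Open Scope ereal_scope.

Lemma lebesgue_complex_sigma_finite n : sigma_finite setT (@lebesgue_complex R n).
Proof.
apply: (sigma_finite_pushforward (m := @power_measure _ _ R (@lebesgue_area R) n)).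
- exact: measurable_pair_row.
- exact: complex_rowK.
- exact: sigma_finiteT.
Qed.

HB.instance Definition _ n := Measure_isSigmaFinite.Build _ _ _
  (@lebesgue_complex R n) (@lebesgue_complex_sigma_finite n).

Lemma scales_complex_diag n (al : 'I_n -> R) (be : 'rV[R[i]]_n) : (forall j, 0 < al j)%R ->
  scales (@lebesgue_complex R n)
    (fun z => \row_j ((al j)%:C * z 0 j + be 0 j)%R) (\prod_j ((al j)^-1 * (al j)^-1))%R.
Proof.
move=> al0 A mA.
pose g (j : 'I_n) (p : measurableTypeR R * measurableTypeR R) :=
  ((al j * p.1 + complex.Re (be 0 j))%R, (al j * p.2 + complex.Im (be 0 j))%R).
have maff (a b : R) : measurable_fun setT (fun x : measurableTypeR R => (a * x + b)%R).
  by apply: measurable_funD => //; apply: measurable_funM.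
have mg j : measurable_fun setT (g j).
  apply: measurable_fun_pair.
    exact: (measurableT_comp (maff (al j) _) measurable_fst).
  exact: (measurableT_comp (maff (al j) _) measurable_snd).
have sg j : scales (@lebesgue_area R) (g j) ((al j)^-1 * (al j)^-1)%R.
  have i0 : (0 < (al j)^-1)%R by rewrite invr_gt0.
  exact: (scales_product (m1 := @lebesgue_measure R) (m2 := @lebesgue_measure R)
    (maff (al j) (complex.Re (be 0%R j))) (maff (al j) (complex.Im (be 0%R j))) i0 i0
    (scales_lebesgue _ (al0 j)) (scales_lebesgue _ (al0 j))).
have kg j : (0 < (al j)^-1 * (al j)^-1)%R by rewrite mulr_gt0 ?invr_gt0 ?al0.
rewrite /lebesgue_complex /pushforward -(scales_power mg kg sg); last first.
  by rewrite -[X in measurable X]setTI; exact: measurable_complex_row.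
congr (power_measure _ _); apply/funext => t; rewrite /preimage /=; congr (A _).
apply/rowP => j; rewrite !mxE tnth_mktuple; case: (tnth t j) => x y.
apply/eqP; rewrite eq_complex !raddfD /=.
by apply/andP; split; apply/eqP; ring.
Qed.

Lemma lebesgue_complex_translation n (v : 'rV[R[i]]_n) :
  scales (@lebesgue_complex R n) (fun z => z + v)%R 1.
Proof.
have := @scales_complex_diag n (fun=> 1%R) v (fun=> ltr01).
rewrite (_ : (\prod_j _)%R = 1%R); last by rewrite big1// => j _; rewrite invr1 mulr1.
rewrite (_ : (fun z => \row_j _) = (fun z => z + v)%R)//.
by apply/funext => z; apply/rowP => j; rewrite !mxE mul1r.
Qed.

Lemma lebesgue_complex_shift n (v : 'rV[R[i]]_n) A : measurable A ->
  lebesgue_complex ((fun z => z + v)%R @^-1` A) = lebesgue_complex A.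
Proof. by move=> mA; rewrite lebesgue_complex_translation// mul1e. Qed.

Let cube n (M : R) : set 'rV[R[i]]_n :=
  [set z | forall j, (`|complex.Re (z 0 j)| <= M)%R /\ (`|complex.Im (z 0 j)| <= M)%R].

Let lebesgue_complex_cube n (M : R) : (0 < M)%R ->
  measurable (@cube n M) /\ lebesgue_complex (@cube n M) = (((2 * M) ^+ 2) ^+ n)%:E.
Proof.
move=> M0; pose I := `[(- M)%R, M]%classic : set (measurableTypeR R).
have mI : measurable (I `*` I) by apply: measurableX; exact: measurable_itv.
have E : complex_row (n := n) @^-1` cube M = [set t | forall j, (I `*` I) (tnth t j)].
  apply/seteqP; split => t /= h j; have := h j; rewrite !mxE /I /= !in_itv /=;
    by rewrite -!ler_norml.
split.
  rewrite (_ : cube M = @pair_row R n @^-1` [set t | forall j, (I `*` I) (tnth t j)]).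
    rewrite -[X in measurable X]setTI; apply: measurable_pair_row => //.
    rewrite (_ : [set t | _] = \bigcap_(j in [set: 'I_n]) ((@tnth n _ ^~ j) @^-1` (I `*` I))).
      apply: fin_bigcap_measurable => // j _; rewrite -[X in measurable X]setTI.
      exact: measurable_tnth.
    by apply/seteqP; split => t /= h; [move=> j _; exact: h|move=> j; exact: h].
  by rewrite -E; apply/funext => z; rewrite /preimage /= pair_rowK.
have aE : @lebesgue_area R (I `*` I) = lebesgue_measure I * lebesgue_measure I.
  by apply: product_measure1E; exact: measurable_itv.
rewrite /lebesgue_complex /pushforward E power_measure_cube//.
rewrite -[LHS]/(@lebesgue_area R (I `*` I) ^+ n) aE /I.
rewrite lebesgue_measure_itv /= lte_fin gtrN// -EFinD -EFinM -EFin_expe.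
by congr EFin; congr (_ ^+ _)%R; ring.
Qed.

Lemma lebesgue_complex_ball n (c : 'rV[R[i]]_n) (r : R) : (0 < r)%R ->
  0 < lebesgue_complex (euclid_ball c r) < +oo.
Proof.
move=> r0.
have -> : euclid_ball c r = (fun z => z + - c)%R @^-1` euclid_ball 0%R r.
  by apply/seteqP; split => z; rewrite /euclid_ball /preimage /= subr0.
rewrite lebesgue_complex_shift; last exact: measurable_euclid_ball.
(* A point of this cube has [2 * n] real coordinates of size at most [M], so its norm is at most
   [2 * n * M < r]. *)
pose M : R := (r / (2 * n)%N.+1%:R)%R.
have M0 : (0 < M)%R by rewrite divr_gt0.
have [mM ME] := lebesgue_complex_cube n M0; have [mr rE] := lebesgue_complex_cube n r0.
apply/andP; split.
  apply: (@lt_le_trans _ _ (lebesgue_complex (@cube n M))).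
    by rewrite ME lte_fin !exprn_gt0// mulr_gt0.
  apply: le_measure; rewrite ?inE//; first exact: measurable_euclid_ball.
  move=> z Mz; rewrite /euclid_ball /= subr0.
  apply: le_lt_trans (euclid_norm_le_sum _) _.
  apply: (@le_lt_trans _ _ (\sum_(j < n) (M + M))%R).
    apply: ler_sum => j _; have [] := Mz j; case: (z 0%R j) => x y /= xM yM.
    exact: le_trans (normc_le_absD _ _) (lerD xM yM).
  rewrite sumr_const card_ord -mulr2n -mulrnA -[X in (X < _)%R]mulr_natr mulrAC.
  by rewrite -mulrA gtr_pMr// ltr_pdivrMr// mul1r ltr_nat.
apply: (@le_lt_trans _ _ (lebesgue_complex (@cube n r))); last by rewrite rE ltry.
apply: le_measure; rewrite ?inE//; first exact: measurable_euclid_ball.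
move=> z; rewrite /euclid_ball /= subr0 => zr j; split.
  exact: le_trans (abs_Re_le_normc _) (le_trans (normc_le_euclid_norm _ _) (ltW zr)).
exact: le_trans (abs_Im_le_normc _) (le_trans (normc_le_euclid_norm _ _) (ltW zr)).
Qed.

(** The pushforward under [f] is again translation invariant, since [f x + v = f (x + g v)]. By
    [haar_swap] it is proportional to Lebesgue measure, and the unit ball, which [f] preserves and
    which has measure in []0, +oo[], fixes the factor at 1. *)
Lemma scales_isometry n (f g : 'rV[R[i]]_n -> 'rV[R[i]]_n) :
  measurable_fun setT f -> measurable_fun setT g -> cancel f g -> cancel g f ->
  {morph f : x y / (x + y)%R} -> (forall x, euclid_norm (f x) = euclid_norm x) ->
  scales (@lebesgue_complex R n) f 1.
Proof.
move=> mf mg fK gK fD fN A mA; rewrite mul1e.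
have [m2 m2E] := pushforward_sigma_finite_measure (m := @lebesgue_complex R n)
  mf mg fK (@lebesgue_complex_sigma_finite n).
have tr2 v : scales m2 (fun x => x + v)%R 1.
  move=> B mB; rewrite mul1e m2E /pushforward.
  rewrite -[RHS](@lebesgue_complex_shift n (g v)); last first.
    by rewrite -[X in measurable X]setTI; exact: mf.
  by congr lebesgue_complex; apply/funext => x; rewrite /preimage /= fD gK.
pose B := @euclid_ball R n 0%R 1%R.
have mB : measurable B by exact: measurable_euclid_ball.
have sB (x : 'rV[R[i]]_n) : B (- x)%R <-> B x.
  by rewrite /B /euclid_ball /= !subr0 euclid_normN.
have m2B : m2 B = lebesgue_complex B.
  rewrite m2E /pushforward; congr lebesgue_complex; apply/funext => x.
  by rewrite /B /euclid_ball /preimage /= !subr0 fN.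
have := haar_swap (@lebesgue_complex_translation n) tr2 mB mA sB.
have /andP[B0 Boo] := @lebesgue_complex_ball n 0%R 1%R ltr01.
have Bfin : lebesgue_complex B \is a fin_num by rewrite ge0_fin_numE// ltW.
rewrite m2B => E; rewrite -[LHS]/(pushforward (@lebesgue_complex R n) f A) -m2E.
have h1 := lee_pmul2l Bfin B0 (m2 A) (lebesgue_complex A).
have h2 := lee_pmul2l Bfin B0 (lebesgue_complex A) (m2 A).
by apply: le_anti; rewrite -h1 -h2 /= E lexx.
Qed.

End lebesgue_complex.

(** * Volume scaling of dilations along an arbitrary direction *)

Section scales_dil.
Variable R : realType.
Local Notation normc := (@Normc.normc R).

Lemma measurable_dil n (e : 'rV[R[i]]_n) (s t : R[i]) : measurable_fun setT (dil e s t).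
Proof.
apply: (@measurable_dil_comp _ _ R n e (fun=> s) (fun=> t) id).
- exact: cmeasurable_cst.
- exact: cmeasurable_cst.
- exact: measurable_id.
Qed.

Lemma scales_homothety n (t : R) : 0 < t ->
  scales (@lebesgue_complex R n) (fun z => t%:C *: z) ((t ^+ 2)^-1 ^+ n).
Proof.
move=> t0; have := @scales_complex_diag R n (fun=> t) 0 (fun=> t0).
rewrite (_ : \prod_j _ = (t ^+ 2)^-1 ^+ n); last first.
  by rewrite prodr_const card_ord -expr2 exprVn.
rewrite (_ : (fun z => \row_j _) = (fun z => t%:C *: z))//.
by apply/funext => z; apply/rowP => j; rewrite !mxE addr0.
Qed.

Lemma scales_dil_coord n (s t : R) : 0 < s -> 0 < t ->
  scales (@lebesgue_complex R n.+1) (dil (delta_mx 0 ord0) s%:C t%:C)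
    ((s ^+ 2)^-1 * (t ^+ 2)^-1 ^+ n).
Proof.
move=> s0 t0; pose al (j : 'I_n.+1) := if j == ord0 then s else t.
have al0 j : 0 < al j by rewrite /al; case: ifP.
have := scales_complex_diag 0 al0.
rewrite (_ : \prod_j _ = (s ^+ 2)^-1 * (t ^+ 2)^-1 ^+ n); last first.
  rewrite big_ord_recl /al eqxx -expr2 exprVn; congr (_ * _).
  under eq_bigr do rewrite (_ : lift ord0 _ == ord0 = false)// -expr2 exprVn.
  by rewrite prodr_const card_ord.
rewrite (_ : (fun z => \row_j _) = dil (delta_mx 0 ord0) s%:C t%:C)//.
apply/funext => z; apply/rowP => j; rewrite !mxE addr0.
have -> : hdot z (delta_mx 0 ord0) = z 0 ord0.
  rewrite /hdot (bigD1 ord0)//= mxE !eqxx conjc1 mulr1 big1 ?addr0// => i i0.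
  by rewrite mxE (negbTE i0) andbF conjc0 mulr0.
rewrite /al; case: eqVneq => [->|j0]; first by rewrite /= mulr1 subrr mulr0 addr0.
by rewrite /= !mulr0 add0r subr0.
Qed.

Lemma measurable_householder n (v : 'rV[R[i]]_n) : measurable_fun setT (householder v).
Proof.
apply: measurable_rVD => //; apply: measurable_rVN; apply: measurable_rVZ => //.
have E x : 2 * hdot x v / hdot v v = hdot x v * (2 / hdot v v) by ring.
under eq_fun do rewrite E.
by apply: cmeasurableM; [exact: cmeasurable_hdot|exact: cmeasurable_cst].
Qed.

Lemma scales_householder n (v : 'rV[R[i]]_n) :
  scales (@lebesgue_complex R n) (householder v) 1.
Proof.
apply: (@scales_isometry R n _ (householder v)) => //.
- exact: measurable_householder.
- exact: measurable_householder.
- exact: householderK.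
- exact: householderK.
- by move=> x y; rewrite -[x in LHS]scale1r householderZD scale1r.
move=> x; rewrite !euclid_normE; congr Num.sqrt.
have := hdot_householder v x x; rewrite !hdotxx.
by move=> /(congr1 (@complex.Re R)).
Qed.

Lemma dil_householder n (v e f : 'rV[R[i]]_n) (l s t : R[i]) :
  normc l = 1 -> householder v e = l *: f ->
  forall x, householder v (dil f s t (householder v x)) = dil e s t x.
Proof.
move=> l1 vE x; set H := householder v.
have ll : l * l^*%C = 1 by rewrite mulc_conj l1 expr1n.
have hHf : hdot (H x) f = l * hdot x e.
  by rewrite -(hdot_householder v x e) vE hdotZr mulrA ll mul1r.
have HZ a y : H (a *: y) = a *: H y.
  rewrite -[a *: y]addr0 /H householderZD [householder v 0](_ : _ = 0) ?addr0//.
  by rewrite /householder hdot0l mulr0 mul0r scale0r subr0.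
have Hf : l *: H f = e by rewrite -HZ -vE /H householderK.
have pE : H (proj f (H x)) = proj e x.
  by rewrite /proj HZ hHf mulrC -scalerA Hf.
rewrite /dil /H householderZD -/H [H (t *: _)]HZ pE; congr (_ + t *: _).
rewrite /perp addrC -scaleN1r /H householderZD -/H pE [H (H x)]householderK.
by rewrite scaleN1r addrC.
Qed.

(** A measure-preserving reflection takes [e] to a unimodular multiple of the first basis vector and
    conjugates [dil] to a diagonal map. Each complex coordinate contributes a square, and the
    complement of [e] has [n] of them. *)
Lemma scales_dil n (e : 'rV[R[i]]_n.+1) (s t : R) : sqn e = 1 -> 0 < s -> 0 < t ->
  scales (@lebesgue_complex R n.+1) (dil e s%:C t%:C) ((s ^+ 2)^-1 * (t ^+ 2)^-1 ^+ n).
Proof.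
move=> e1 s0 t0; pose f : 'rV[R[i]]_n.+1 := delta_mx 0 ord0.
have f1 : sqn f = 1.
  rewrite /sqn (bigD1 ord0)//= mxE !eqxx Normc.normc1 expr1n big1 ?addr0// => i i0.
  by rewrite mxE (negbTE i0) andbF Normc.normc0 expr0n.
have [v [l [l1 vE]]] := householder_swap e1 f1.
have -> : dil e s%:C t%:C = householder v \o (dil f s%:C t%:C \o householder v).
  by apply/funext => x /=; rewrite (dil_householder _ _ l1 vE).
rewrite -[_ * _]mulr1; apply: scales_comp.
- exact: measurable_householder.
- rewrite -[_ * _]mul1r; apply: scales_comp.
  + exact: measurable_dil.
  + exact: scales_householder.
  + exact: scales_dil_coord.
- exact: scales_householder.
Qed.

Lemma scales_dil_isometry n (e : 'rV[R[i]]_n) (s t : R[i]) : hdot e e *: e = e ->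
  normc s = 1 -> normc t = 1 -> scales (@lebesgue_complex R n) (dil e s t) 1.
Proof.
move=> he s1 t1.
have s0 : s != 0 by rewrite -normc_eq0 s1 oner_eq0.
have t0 : t != 0 by rewrite -normc_eq0 t1 oner_eq0.
apply: (@scales_isometry R n _ (dil e s^-1 t^-1)).
- exact: measurable_dil.
- exact: measurable_dil.
- exact: dilK.
- by move=> x; rewrite dil_comp// !mulfV// dil11.
- by move=> x y; exact: dilD.
move=> x; rewrite !euclid_normE sqn_dil// s1 t1 expr1n !mul1r.
by rewrite -sqn_proj_perp.
Qed.

End scales_dil.

(** * The contraction property of dilations *)

Section mobius.
Variable R : realType.
Local Notation normc := (@Normc.normc R).
Implicit Types (t : R) (w z : R[i]).

Definition mobius t w : R[i] := (w + t%:C) / (1 + t%:C * w).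

Lemma mobius0 t : mobius t 0 = t%:C.
Proof. by rewrite /mobius mulr0 addr0 divr1 add0r. Qed.

Lemma normc_denom_ge t w : 0 <= t -> 1 - t * normc w <= normc (1 + t%:C * w).
Proof.
move=> t0; have := le_normcD (1 + t%:C * w) (- (t%:C * w)).
by rewrite addrK normcN Normc.normc1 Normc.normcM normc_real ger0_norm// lerBlDr.
Qed.

Lemma sqr_normc_mobius t w : 1 + t%:C * w != 0 ->
  normc (mobius t w) ^+ 2 =
  1 + (1 - t ^+ 2) * (normc w ^+ 2 - 1) / normc (1 + t%:C * w) ^+ 2.
Proof.
move=> w0; have d0 : normc (1 + t%:C * w) ^+ 2 != 0 by rewrite sqrf_eq0 normc_eq0.
rewrite Normc.normcM Normc.normcV exprMn exprVn.
apply: (mulIf d0); rewrite mulfVK// mulrDl mulfVK// mul1r.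
rewrite !sqr_normc_def; case: w {w0 d0} => x y /=; ring.
Qed.

Lemma normc_mobius_cis t x : 0 <= t < 1 -> normc (mobius t (cis x)) = 1.
Proof.
move=> /andP[t0 t1]; have w0 : 1 + t%:C * cis x != 0.
  rewrite -normc_gt0; apply: lt_le_trans (normc_denom_ge _ t0).
  by rewrite normc_cis mulr1 subr_gt0.
have := sqr_normc_mobius w0; rewrite normc_cis expr1n subrr mulr0 mul0r addr0.
by move/eqP; rewrite sqrp_eq1 ?normc_ge0// => /eqP.
Qed.

Lemma cdifferentiable_mobius t w : 0 <= t < 1 -> 1 + t%:C * w != 0 ->
  cdifferentiable (mobius t) w.
Proof.
move=> /andP[t0 t1] w0; set m := normc (1 + t%:C * w).
have m0 : 0 < m by rewrite normc_gt0.
exists ((1 - t ^+ 2)%:C / (1 + t%:C * w) ^+ 2).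
apply: (@has_cderiv_quadratic _ _ _ _ (m / 2) (m ^- 2 * (m / 2)^-1)).
  by rewrite divr_gt0.
move=> z zw; have mz : m / 2 <= normc (1 + t%:C * z).
  have := le_normcD (1 + t%:C * z) (t%:C * (w - z)).
  have -> : 1 + t%:C * z + t%:C * (w - z) = 1 + t%:C * w by ring.
  rewrite -/m Normc.normcM normc_real ger0_norm// normc_sub.
  have : t * normc (z - w) <= m / 2.
    by apply: le_trans zw; rewrite ler_piMl ?normc_ge0// ltW.
  lra.
have z0 : 1 + t%:C * z != 0 by rewrite -normc_gt0 (lt_le_trans _ mz)// divr_gt0.
have -> : mobius t z - mobius t w - (1 - t ^+ 2)%:C / (1 + t%:C * w) ^+ 2 * (z - w)
  = - ((1 - t ^+ 2) * t)%:C * ((1 + t%:C * w) ^+ 2)^-1 * (1 + t%:C * z)^-1 * (z - w) ^+ 2.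
  by rewrite /mobius !rmorphM !rmorphB rmorph1 /= rmorphXn /=; field; rewrite w0 z0.
rewrite !Normc.normcM normcN normc_real !Normc.normcV !normcX -/m.
rewrite ler_wpM2r ?sqr_ge0//.
have c1 : 0 <= (1 - t ^+ 2) * t <= 1 by apply/andP; split; nra.
rewrite ger0_norm; last by case/andP: c1.
rewrite -[leRHS]mul1r -mulrA; case/andP: c1 => c0 c1.
have i1 : 0 <= m ^- 2 by rewrite invr_ge0 exprn_ge0// ltW.
have i2 : (normc (1 + t%:C * z))^-1 <= (m / 2)^-1.
  by rewrite lef_pV2 ?posrE ?divr_gt0// normc_gt0.
apply: ler_pM => //; last exact: ler_wpM2l.
by rewrite mulr_ge0// invr_ge0 normc_ge0.
Qed.

(** The mean value property asks for holomorphy slightly beyond the closed unit disc, where the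
    Moebius map may exceed modulus 1; [s] is the excess that can be tolerated. *)
Lemma mobius_disc t (s : R) : 0 <= t < 1 -> 1 < s -> exists2 b, 0 < b &
  forall w, normc w < expR b -> 1 + t%:C * w != 0 /\ normc (mobius t w) ^+ 2 < s.
Proof.
move=> /andP[t0 t1] s1.
(* The first bound keeps the denominator above [(1 - t) / 2]. The second gives [normc w ^+ 2 - 1 < 3
   * h < (s - 1) * ((1 - t) / 2) ^+ 2], because [3 / 16 < 1 / 4]. *)
pose h : R := Num.min ((1 - t) / 2) ((s - 1) * (1 - t) ^+ 2 / 16).
have h0 : 0 < h by rewrite lt_min !divr_gt0 ?mulr_gt0 ?exprn_gt0 ?subr_gt0.
have h1 : h <= (1 - t) / 2 by rewrite ge_min lexx.
have h2 : h <= (s - 1) * (1 - t) ^+ 2 / 16 by rewrite ge_min lexx orbT.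
exists (ln (1 + h)); first by rewrite ln_gt0// ltrDl.
move=> w; rewrite lnK ?posrE ?addr_gt0// => wh.
have wn := normc_ge0 w.
have d : (1 - t) / 2 <= normc (1 + t%:C * w).
  by apply: le_trans (normc_denom_ge _ t0); nra.
have d0 : 0 < (1 - t) / 2 by rewrite divr_gt0// subr_gt0.
have w0 : 1 + t%:C * w != 0 by rewrite -normc_gt0 (lt_le_trans d0).
split => //; rewrite sqr_normc_mobius// -ltrBrDl.
set D := normc (1 + _) in d *.
have D0 : 0 < D by exact: lt_le_trans d.
rewrite ltr_pdivrMr ?exprn_gt0//.
apply: (@lt_le_trans _ _ ((s - 1) * ((1 - t) / 2) ^+ 2)); last first.
  rewrite ler_wpM2l ?subr_ge0 ?(ltW s1)// ler_pXn2r// ?nnegrE ltW//.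
have W : normc w ^+ 2 - 1 < 3 * h by nra.
have T : 0 < 1 - t ^+ 2 <= 1 by apply/andP; split; nra.
have H : 3 * h < (s - 1) * ((1 - t) / 2) ^+ 2.
  have : 0 < (s - 1) * (1 - t) ^+ 2 by rewrite mulr_gt0 ?exprn_gt0 ?subr_gt0.
  by rewrite expr_div_n (_ : 2 ^+ 2 = 4); [lra|ring].
have H0 : 0 < 3 * h by rewrite mulr_gt0.
by nra.
Qed.

End mobius.

(** * Composition with a dilation does not increase the square integral over a centred ball *)

Section contraction.
Variables (R : realType) (n : nat).
Local Notation V := 'rV[R[i]]_n.
Local Notation normc := (@Normc.normc R).
Local Notation mu := (@lebesgue_complex R n).

Lemma differentiable_line (f : V -> R[i]) (x v : V) (z : R[i]) :
  differentiable f (x + z *: v) -> cdifferentiable (fun w => f (x + w *: v)) z.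
Proof.
move=> df; set y := x + z *: v in df; exists ('d f y v : R[i]) => e e0.
(* The norm of [v] lives in [R[i]] although it is real; [K] below is its value in [R]. *)
have vE : `|v| = (complex.Re `|v|)%:C by rewrite RRe_real// ger0_real.
set K := complex.Re `|v| in vE.
have K0 : 0 <= K by have := normr_ge0 v; rewrite vE lecR.
have e'0 : 0 < (e / (K + 1))%:C by rewrite ltcR divr_gt0// ltr_wpDl.
have /eqaddoP/(_ _ e'0) := diff_locally df.
move=> /nbhs_euclidP[k k0 kP].
have N0 : 0 < euclid_norm v + 1 by rewrite ltr_wpDl ?euclid_norm_ge0.
exists (k / 2 / (euclid_norm v + 1)); first by rewrite !divr_gt0.
move=> w; rewrite ler_pdivlMr// => wz.
have /kP : euclid_ball 0 k ((w - z) *: v).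
  rewrite /euclid_ball /= subr0 euclid_normZ.
  apply: (@le_lt_trans _ _ (k / 2)); last by rewrite ltr_pdivrMr// ltr_pMr// ltr1n.
  by apply: le_trans wz; rewrite ler_wpM2l ?normc_ge0// lerDl.
rewrite /= !fctE /= normrZ vE.
have -> : (w - z) *: v + y = x + w *: v by rewrite /y addrCA -scalerDl subrK.
have -> : 'd f y ((w - z) *: v) = (w - z) * 'd f y v by rewrite linearZ.
rewrite -[`|w - z|]/((normc (w - z))%:C) -!rmorphM lecR => h.
have -> : f (x + w *: v) - f y - 'd f y v * (w - z)
   = f (x + w *: v) - (f y + (w - z) * 'd f y v) by ring.
apply: le_trans h _; rewrite [normc _ * K]mulrC mulrA ler_wpM2r ?normc_ge0//.
by rewrite mulrAC ler_pdivrMr ?ltr_wpDl// ler_wpM2l ?(ltW e0)// lerDl.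
Qed.

Lemma continuous_sqr_normc (f : V -> R[i]) x : differentiable f x ->
  {for x, continuous (fun z => normc (f z) ^+ 2)}.
Proof.
move=> /differentiable_continuous cf.
have cn : {for f x, continuous (fun w : R[i] => normc w)}.
  move=> A /nbhs_ballP[e /= e0 eA]; apply/nbhs_ballP; exists e%:C; first by rewrite /= ltcR.
  move=> w; rewrite /ball /= ltcR => we; apply: eA; rewrite -ball_normE /=.
  apply: le_lt_trans we; rewrite -[X in _ <= X]/(normc (f x - w)).
  have h u v : normc u - normc v <= normc (u - v).
    by rewrite lerBlDr; apply: le_trans (le_normcD _ _); rewrite subrK.
  by rewrite ler_norml h andbT lerNl opprB (le_trans (h _ _))// normc_sub.
have c1 : {for x, continuous (normc \o f)} by apply: continuous_comp.
have c2 : {for normc (f x), continuous (fun u : R => u ^+ 2)} by exact: exprn_continuous.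
exact: (continuous_comp c1 c2).
Qed.

Lemma measurable_sqr_normc (W : set V) (f : V -> R[i]) : open W ->
  (forall z, W z -> differentiable f z) ->
  measurable_fun W (fun z => (normc (f z) ^+ 2)%:E).
Proof.
move=> oW df; apply/measurable_EFinP; apply: open_continuous_measurable_rV => //.
by move=> x /df; exact: continuous_sqr_normc.
Qed.

Lemma euclid_ball0E (rho : R) x : 0 < rho -> euclid_ball (0 : V) rho x <-> sqn x < rho ^+ 2.
Proof. by move=> r0; rewrite euclid_ballE// subr0. Qed.

Section mean_over_rotations.
Variables (e : V) (t rho : R) (f : V -> R[i]).
Hypotheses (he : hdot e e *: e = e) (t01 : 0 <= t < 1) (rho0 : 0 < rho).
Local Notation B := (euclid_ball (0 : V) rho).
Hypothesis df : forall z, B z -> differentiable f z.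
Local Notation lam := (@lebesgue_measure R).

Let I : set (measurableTypeR R) := `[(0 : R), pi *+ 2]%classic.

Lemma sqr_normc_dil_le z : B z ->
  ((pi *+ 2 * normc (f (dil e 1 t%:C z)) ^+ 2)%:E <=
   \int[lam]_(v in I) (normc (f (dil e 1 (mobius t (cis v)) z)) ^+ 2)%:E)%E.
Proof.
move=> /euclid_ball0E-/(_ rho0); rewrite (sqn_proj_perp he) => zB.
set P := sqn (perp e z) in zB; set Q := sqn (proj e z) in zB.
have P0 : 0 <= P by exact: sqn_ge0.
(* The ball is open, so the component of [z] orthogonal to [e] may be stretched slightly; this is
   the room needed when [w] leaves the closed unit disc. *)
have [s s1 sP] : exists2 s, 1 < s & Q + s * P < rho ^+ 2.
  exists (1 + (rho ^+ 2 - (Q + P)) / (2 * (P + 1))).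
    by rewrite ltrDl divr_gt0 ?subr_gt0// mulr_gt0// ltr_wpDl.
  have : (rho ^+ 2 - (Q + P)) / (2 * (P + 1)) * P < rho ^+ 2 - (Q + P).
    rewrite mulrAC ltr_pdivrMr ?mulr_gt0 ?ltr_wpDl// ltr_pM2l ?subr_gt0//.
    by nra.
  by nra.
have [b b0 bP] := mobius_disc t01 s1.
(* The square is holomorphic and its modulus is the integrand [|f|^2]. *)
pose H w := f (dil e 1 (mobius t w) z) ^+ 2.
have dH w : normc w < expR b -> cdifferentiable H w.
  move=> /bP[w0 ws].
  have d1 : cdifferentiable (fun y => f (dil e 1 y z)) (mobius t w).
    rewrite /dil; apply: differentiable_line; apply: df.
    apply/euclid_ball0E => //; rewrite -/(dil e 1 (mobius t w) z) (sqn_dil he).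
    rewrite Normc.normc1 expr1n mul1r -/P -/Q; apply: le_lt_trans sP.
    by rewrite lerD2l ler_wpM2r// ltW.
  apply: (@cdifferentiable_comp R (fun w => f (dil e 1 (mobius t w) z)) (fun u => u ^+ 2)).
    apply: (@cdifferentiable_comp R (mobius t) (fun y => f (dil e 1 y z))) => //.
    exact: cdifferentiable_mobius.
  by eexists; exact: has_cderiv_sqr.
have := sub_mean_value b0 dH; rewrite /H mobius0 normcX.
by under eq_integral do rewrite normcX.
Qed.

Let q : V -> \bar R := (fun z => (normc (f z) ^+ 2)%:E) \_ B.

Let mB : measurable B. Proof. exact: measurable_euclid_ball. Qed.

Let mq : measurable_fun setT q.
Proof.
apply/(measurable_restrictT _ mB).
by apply: measurable_sqr_normc => //; exact: open_euclid_ball.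
Qed.

Let q0 z : (0 <= q z)%E.
Proof. by rewrite /q patchE; case: ifP => // _; rewrite lee_fin sqr_ge0. Qed.

(** Nothing is known about [f] outside [B], so it is cut off by zero in [q]; the indicator does the
    same for the angle. This gives a measurable function on the whole product, as Tonelli's theorem
    requires. *)
Let G (p : V * measurableTypeR R) : \bar R :=
  (q (dil e 1%R (mobius t (cis p.2)) p.1) * (\1_I p.2)%:E)%E.

Let mI : measurable I. Proof. exact: measurable_itv. Qed.

Let G0 p : (0 <= G p)%E.
Proof. by rewrite /G mule_ge0// lee_fin. Qed.

Let cm_mobius : @cmeasurable _ (measurableTypeR R) R (fun x => mobius t (cis x)).
Proof.
have t0 : 0 <= t by case/andP: t01.
have cis_m : @cmeasurable _ (measurableTypeR R) R (@cis R).
  by split; apply: continuous_measurable_fun; [exact: continuous_cos|exact: continuous_sin].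
(* on the unit circle the inverse of the denominator is its conjugate over its square norm *)
pose D (x : measurableTypeR R) : R := (1 + t * cos x) ^+ 2 + (t * sin x) ^+ 2.
have w0 x : 1 + t%:C * cis x != 0.
  rewrite -normc_gt0; apply: lt_le_trans (normc_denom_ge _ t0).
  by rewrite normc_cis mulr1 subr_gt0; case/andP: t01.
have D0 x : D x != 0.
  have := w0 x; rewrite -normc_eq0 -sqrf_eq0 sqr_normc_def /= !mul0r subr0 add0r addr0.
  by rewrite /D.
have E x : mobius t (cis x) = (cis x + t%:C) *
    (((1 + t * cos x) / D x) +i* (- (t * sin x) / D x)).
  congr (_ * _); apply: (mulfI (w0 x)); rewrite mulfV//.
  have := D0 x; rewrite /D => Dx.
  by apply/eqP; rewrite eq_complex /=; apply/andP; split; apply/eqP; field.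
have mc : measurable_fun setT (@cos R : measurableTypeR R -> R).
  by apply: continuous_measurable_fun; exact: continuous_cos.
have ms : measurable_fun setT (@sin R : measurableTypeR R -> R).
  by apply: continuous_measurable_fun; exact: continuous_sin.
have m1 : measurable_fun setT (fun x : measurableTypeR R => 1 + t * cos x).
  by apply: measurable_funD => //; exact: measurable_funM.
have m2 : measurable_fun setT (fun x : measurableTypeR R => t * sin x).
  exact: measurable_funM.
have c1 : continuous (fun x : R => 1 + t * cos x).
  by move=> x; apply: cvgD; [exact: cvg_cst|apply: cvgM; [exact: cvg_cst|exact: continuous_cos]].
have c2 : continuous (fun x : R => t * sin x).
  by move=> x; apply: cvgM; [exact: cvg_cst|exact: continuous_sin].
have mi : measurable_fun setT (fun x : measurableTypeR R => (D x)^-1).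
  apply: continuous_measurable_fun => x; apply: cvgV => //.
  by apply: cvgD; apply: cvgM; [exact: c1|exact: c1|exact: c2|exact: c2].
rewrite (_ : (fun x => mobius t (cis x)) = (fun x => (cis x + t%:C) *
    (((1 + t * cos x) / D x) +i* (- (t * sin x) / D x)))); last by apply/funext => x.
apply: cmeasurableM.
  by apply: cmeasurableD => //; exact: cmeasurable_cst.
split; first exact: measurable_funM.
by apply: measurable_funM => //; exact: measurableT_comp.
Qed.

Let mG : measurable_fun setT G.
Proof.
apply: emeasurable_funM.
  apply: (measurableT_comp mq).
  apply: (@measurable_dil_comp _ (V * measurableTypeR R)%type R n e (fun=> 1)
    (fun p => mobius t (cis p.2)) fst); first exact: cmeasurable_cst.
    exact: (cmeasurable_comp measurable_snd cm_mobius).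
  exact: measurable_fst.
have mi : measurable_fun setT (\1_I : measurableTypeR R -> R) by exact: measurable_indic.
by apply/measurable_EFinP; exact: (measurableT_comp mi measurable_snd).
Qed.

Lemma contraction_lt1 :
  (\int[mu]_(z in B) (normc (f (dil e 1 t%:C z)) ^+ 2)%:E <=
   \int[mu]_(z in B) (normc (f z) ^+ 2)%:E)%E.
Proof.
have pi20 : 0 < pi *+ 2 :> R by rewrite pmulrn_lgt0// pi_gt0.
have Bdil s z : normc s = 1 -> B (dil e 1 s z) <-> B z.
  move=> s1; rewrite !euclid_ball0E// (sqn_dil he) s1 Normc.normc1 expr1n !mul1r.
  by rewrite -(sqn_proj_perp he).
have st (z : V) : (\int[lam]_v G (z, v) =
    \int[lam]_(v in I) q (dil e 1%R (mobius t (cis v)) z))%E.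
  rewrite [RHS]integral_mkcond; apply: eq_integral => v _.
  rewrite /G /= indicE patchE; case: ifPn => _; first by rewrite mule1.
  by rewrite mule0.
have mdil : measurable_fun B (fun z => (normc (f (dil e 1 t%:C z)) ^+ 2)%:E).
  apply: (@eq_measurable_fun _ _ _ _ _ (q \o dil e 1 t%:C)).
    move=> z; rewrite inE => zB /=; rewrite /q patchE mem_set//.
    apply/euclid_ball0E => //; move: zB => /(euclid_ball0E _ rho0).
    rewrite (sqn_dil he) Normc.normc1 expr1n mul1r (sqn_proj_perp he z).
    apply: le_lt_trans; rewrite lerD2l ler_piMl ?sqn_ge0// normc_real.
    case/andP: t01 => t0 t1; rewrite ger0_norm// expr_le1// ltW//.
  apply: measurable_funTS; apply: (measurableT_comp mq); exact: measurable_dil.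
have LB : ((pi *+ 2)%:E * \int[mu]_(z in B) (normc (f (dil e 1 t%:C z)) ^+ 2)%:E
    <= \int[mu]_z \int[lam]_v G (z, v))%E.
  rewrite -ge0_integralZl//; last 2 first.
  - by move=> z _; rewrite lee_fin sqr_ge0.
  - by rewrite lee_fin ltW.
  rewrite integral_mkcond; apply: ge0_le_integral => //.
  - by move=> z _; rewrite patchE; case: ifP => // _; rewrite mule_ge0// lee_fin ?sqr_ge0// ltW.
  - apply/(measurable_restrictT _ mB).
    by apply: emeasurable_funM => //; exact: measurable_cst.
  - exact: measurable_fun_fubini_tonelli_F.
  - move=> z _; rewrite patchE; case: ifPn => [|_]; last by apply: integral_ge0 => v _.
    rewrite inE => zB; rewrite -EFinM; apply: le_trans (sqr_normc_dil_le zB) _.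
    rewrite st le_eqVlt; apply/orP; left; apply/eqP; apply: eq_integral => v _.
    by rewrite /q patchE mem_set//; apply/Bdil => //; exact: normc_mobius_cis.
(* After exchanging the integrals, the dilation at each fixed angle preserves [mu], so the inner
   integral does not depend on the angle. *)
have RB : (\int[mu]_z \int[lam]_v G (z, v) =
    (pi *+ 2)%:E * \int[mu]_(z in B) (normc (f z) ^+ 2)%:E)%E.
  have qB : (\int[mu]_(z in B) (normc (f z) ^+ 2)%:E = \int[mu]_z q z)%E.
    by rewrite integral_mkcond.
  have -> : (\int[mu]_z \int[lam]_v G (z, v) = \int[lam]_v \int[mu]_z G (z, v))%E.
    exact: (fubini_tonelli (m1 := mu) (m2 := lam)).
  transitivity (\int[lam]_v ((\int[mu]_z q z) * (\1_I v)%:E))%E.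
    apply: eq_integral => v _; rewrite /G /=.
    rewrite ge0_integralZr//; last exact: (measurableT_comp mq (@measurable_dil _ _ _ _ _)).
    congr (_ * _)%E.
    have s1 := normc_mobius_cis v t01.
    have := @integral_scales _ _ R mu (dil e 1 (mobius t (cis v))) 1 setT q
      (@measurable_dil _ _ _ _ _) ltr01
      (scales_dil_isometry he (Normc.normc1 R) s1) measurableT mq (fun z _ => q0 z).
    by rewrite preimage_setT mul1e.
  rewrite ge0_integralZl//; last 2 first.
  - by apply/measurable_EFinP; exact: measurable_indic.
  - exact: integral_ge0.
  rewrite integral_indic// setIT qB muleC; congr (_ * _)%E.
  rewrite -[LHS]/(lebesgue_measure `[(0 : R)%R, (pi *+ 2)%R]%classic).
  by rewrite lebesgue_measure_itv /= lte_fin pi20 oppr0 adde0.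
rewrite -(@lee_pmul2l _ (pi *+ 2)%:E)//.
by rewrite -RB.
Qed.

End mean_over_rotations.
End contraction.

(** * Geometry of balls *)

Section balls.
Variables (R : realType) (n : nat).
Local Notation V := 'rV[R[i]]_n.+1.
Local Notation normc := (@Normc.normc R).
Implicit Types (a c p x y z u e : V).

Lemma euclid_norm_unit u (s : R) : sqn u = 1 -> euclid_norm (s%:C *: u) = `|s|.
Proof. by move=> u1; rewrite euclid_normZ euclid_normE u1 sqrtr1 mulr1 normc_real. Qed.

Lemma exists_direction x : exists2 u, sqn u = 1 & x = (euclid_norm x)%:C *: u.
Proof.
have [->|x0] := eqVneq x 0.
  exists (delta_mx 0 ord0); last by rewrite euclid_norm0 scale0r.
  rewrite /sqn (bigD1 ord0)//= mxE !eqxx Normc.normc1 expr1n big1 ?addr0// => i i0.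
  by rewrite mxE (negbTE i0) andbF Normc.normc0 expr0n.
have N0 : 0 < euclid_norm x by rewrite lt_def euclid_norm_eq0 x0 euclid_norm_ge0.
exists ((euclid_norm x)^-1%:C *: x).
  rewrite sqnZ normc_real ger0_norm ?invr_ge0 ?ltW// exprVn -sqr_euclid_norm.
  by rewrite mulVf// expf_neq0// gt_eqF.
by rewrite scalerA -rmorphM /= divff ?gt_eqF// scale1r.
Qed.

(** Points [c + s u] with [u] pointing from [a] to [c] are the farthest from [a]. Were the bound
    false, [s = rO - d] would be admissible and give a point of the small ball on the large
    sphere. *)
Lemma euclid_ball_sub (a c : V) (rO r : R) : 0 < r ->
  euclid_ball c r `<=` euclid_ball a rO -> euclid_norm (c - a) + r <= rO.
Proof.
move=> r0 sub; have [u u1 cE] := exists_direction (c - a).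
set d := euclid_norm (c - a) in cE *.
have d0 : 0 <= d by exact: euclid_norm_ge0.
have H s : 0 <= s -> s < r -> d + s < rO.
  move=> s0 sr; have : euclid_ball c r (c + s%:C *: u).
    by rewrite /euclid_ball /= addrC addKr euclid_norm_unit// ger0_norm.
  move=> /sub; rewrite /euclid_ball /= addrAC cE -scalerDl -rmorphD /=.
  by rewrite euclid_norm_unit// ger0_norm// addr_ge0.
rewrite leNgt; apply/negP => h; have h0 := H 0 (lexx _) r0.
have E : d + (rO - d) = rO by ring.
by have := H (rO - d); rewrite E ltxx; move: h h0; lra.
Qed.

Lemma boundary_euclid_ball (a : V) (rO : R) : 0 < rO ->
  boundary (euclid_ball a rO) = [set z | euclid_norm (z - a) = rO].
Proof.
move=> r0; apply/seteqP; split => z /=.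
  move=> [zc zi]; apply/eqP; rewrite eq_le; apply/andP; split; rewrite leNgt; apply/negP => h.
    have [|y [ya yz]] := zc (euclid_ball z (euclid_norm (z - a) - rO)).
      by apply/nbhs_euclidP; exists (euclid_norm (z - a) - rO) => //; rewrite subr_gt0.
    move: ya yz; rewrite /euclid_ball /= => ya yz.
    have := euclid_normD (z - y) (y - a); rewrite addrA subrK.
    by rewrite -[euclid_norm (z - y)]euclid_normN opprB; move: ya yz; lra.
  apply: zi; apply/nbhs_euclidP; exists (rO - euclid_norm (z - a)); first by rewrite subr_gt0.
  move=> y; rewrite /euclid_ball /= => yz.
  by have := euclid_normD (y - z) (z - a); rewrite addrA subrK; move: yz; lra.
move=> zr.
have move_along (s : R) : euclid_norm (z + s%:C *: (z - a) - z) = `|s| * rO /\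
    euclid_norm (z + s%:C *: (z - a) - a) = `|1 + s| * rO.
  split; first by rewrite addrC addKr euclid_normZ normc_real zr.
  have -> : z + s%:C *: (z - a) - a = (1 + s)%:C *: (z - a).
    by rewrite rmorphD rmorph1 scalerDl scale1r addrAC.
  by rewrite euclid_normZ normc_real zr.
split.
  move=> A /nbhs_euclidP[e e0 eA]; pose s := Num.min (1 / 2) (e / 2 / rO).
  have s0 : 0 < s by rewrite lt_min !divr_gt0.
  have s1 : s <= 1 / 2 by rewrite ge_min lexx.
  have s2 : s <= e / 2 / rO by rewrite ge_min lexx orbT.
  have [m1 m2] := move_along (- s).
  exists (z + (- s)%:C *: (z - a)); split.
    by rewrite /euclid_ball /= m2 ger0_norm; [nra|lra].
  apply: eA; rewrite /euclid_ball /= m1 normrN gtr0_norm//.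
  by move: s2; rewrite ler_pdivlMr// => s2; lra.
move=> /nbhs_euclidP[e e0 eA]; have s0 : 0 < e / 2 / rO by rewrite !divr_gt0.
have [m1 m2] := move_along (e / 2 / rO).
have : euclid_ball a rO (z + (e / 2 / rO)%:C *: (z - a)).
  by apply: eA; rewrite /euclid_ball /= m1 gtr0_norm// divfK ?gt_eqF//; lra.
rewrite /euclid_ball /= m2 gtr0_norm; last by lra.
by rewrite mulrDl mul1r -ltrBrDl subrr ltNge mulr_ge0// ltW.
Qed.

Lemma euclid_dist_sphere (a c : V) (rO : R) : 0 < rO -> euclid_norm (c - a) <= rO ->
  euclid_dist c (boundary (euclid_ball a rO)) = rO - euclid_norm (c - a).
Proof.
move=> r0 dr; rewrite boundary_euclid_ball// /euclid_dist.
have [u u1 cE] := exists_direction (c - a).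
set d := euclid_norm (c - a) in dr cE *.
have lb w : euclid_norm (w - a) = rO -> rO - d <= euclid_norm (c - w).
  move=> <-; have := euclid_normD (w - c) (c - a).
  by rewrite addrA subrK -[euclid_norm (w - c)]euclid_normN opprB -/d; lra.
have att : [set euclid_norm (c - w) | w in [set z | euclid_norm (z - a) = rO]] (rO - d).
  exists (a + rO%:C *: u) => /=; first by rewrite addrC addKr euclid_norm_unit// gtr0_norm.
  rewrite opprD addrA cE -scalerBl -rmorphB /= euclid_norm_unit//.
  by rewrite distrC ger0_norm// subr_ge0.
apply/eqP; rewrite eq_le; apply/andP; split.
  by apply: ge_inf => //; exists (rO - d) => _ [w /= wr <-]; exact: lb.
by apply: lb_le_inf; [exists (rO - d)|move=> _ [w /= wr <-]; exact: lb].
Qed.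

(** Equality in the triangle inequality puts [p], [c], [a] on one ray, and [e] is the common inner
    normal at [p]. Expanding the squared norm of [(c - p) - (r / rO) (a - p)] shows that it is 0. *)
Lemma touching_balls (a c p : V) (rO r : R) : 0 < r -> euclid_norm (c - a) + r <= rO ->
  euclid_norm (p - c) = r -> euclid_norm (p - a) = rO ->
  exists2 e, sqn e = 1 & [/\ a = p + rO%:C *: e, c = p + r%:C *: e &
    rO - euclid_norm (c - a) = r].
Proof.
move=> r0 dr pc pa; have d0 := euclid_norm_ge0 (c - a).
have rO0 : 0 < rO by lra.
have dE : euclid_norm (c - a) = rO - r.
  have := euclid_normD (p - c) (c - a); rewrite addrA subrK pc pa; lra.
exists (rO^-1%:C *: (a - p)).
  rewrite sqnZ normc_real ger0_norm ?invr_ge0 ?ltW// -sqr_euclid_norm -euclid_normN opprB pa.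
  by rewrite exprVn mulVf// expf_neq0// gt_eqF.
have sa : sqn (a - p) = rO ^+ 2 by rewrite -sqr_euclid_norm -euclid_normN opprB pa.
have sc : sqn (c - p) = r ^+ 2 by rewrite -sqr_euclid_norm -euclid_normN opprB pc.
have sd : sqn ((c - p) - (a - p)) = (rO - r) ^+ 2.
  by rewrite opprB addrA subrK -sqr_euclid_norm dE.
have h : complex.Re (hdot (c - p) (a - p)) = rO * r.
  by move: sd; rewrite sqnB sa sc mulr2n; lra.
split; last by rewrite dE; lra.
- by rewrite scalerA -rmorphM /= divff ?gt_eqF// scale1r addrC subrK.
apply/eqP; rewrite scalerA -rmorphM /= -subr_eq0 opprD addrA -sqn_eq0 sqnB sqnZ sa sc.
rewrite normc_real ger0_norm ?divr_ge0 ?ltW// hdotZr conjc_real.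
have ReM (k : R) (z : R[i]) : complex.Re (k%:C * z) = k * complex.Re z.
  by case: z => ? ? /=; rewrite mul0r subr0.
rewrite ReM h mulr2n; apply/eqP; field; rewrite gt_eqF//.
Qed.

Lemma dil_inv_ball_sub (a c e : V) (rO r : R) : sqn e = 1 -> 0 < rO -> 0 < r ->
  c - a = (euclid_norm (c - a))%:C *: e -> euclid_norm (c - a) + r <= rO ->
  forall t, 0 < t -> t ^+ 2 = (rO - euclid_norm (c - a)) / rO ->
  forall x, euclid_ball c r (a + dil e 1 t%:C x) -> euclid_ball 0 rO x.
Proof.
move=> e1 rO0 r0 cE dr t t0 tE x.
have he := unit_idem e1; set d := euclid_norm (c - a) in cE dr tE.
have d0 : 0 <= d by exact: euclid_norm_ge0.
rewrite euclid_ballE// euclid_ball0E//.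
have -> (y : V) : a + y - c = y - d%:C *: e by rewrite -cE opprB addrA [y + a]addrC.
rewrite sqnB (sqn_dil he) Normc.normc1 expr1n mul1r normc_real gtr0_norm// tE.
rewrite sqnZ e1 mulr1 normc_real ger0_norm// hdotZr (hdot_dil he) mul1r conjc_real.
rewrite (sqn_proj_perp he x) sqn_proj//.
move: (sqn_ge0 (perp e x)); move: (sqn _) => q q0.
rewrite sqr_normc_def; case: (hdot x e) => s1 s2 /=; rewrite mul0r subr0.
set N := (s1 ^+ 2 + s2 ^+ 2) => H.
(* The small ball is enlarged to the largest one about [c] that fits, of radius [rO - d]; this is
   why the upper bound involves [delta] rather than [r]. *)
have H2 : r ^+ 2 <= (rO - d) ^+ 2 by rewrite ler_pXn2r ?nnegrE//; lra.
have D0 : 0 < rO - d by lra.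
have {}H : N * rO + (rO - d) * q + d ^+ 2 * rO - (d * s1) *+ 2 * rO < (rO - d) ^+ 2 * rO.
  have := lt_le_trans H H2; rewrite -(ltr_pM2r rO0); apply: le_lt_trans.
  by rewrite le_eqVlt; apply/orP; left; apply/eqP; field; rewrite gt_eqF//.
rewrite -(ltr_pM2l D0); rewrite /N in H *; rewrite mulr2n in H.
(* The completed square: goal and [H] differ by exactly this term. The choice of [t] is what gives
   [q] the same coefficient [rO - d] in both. *)
have : 0 <= d * ((s1 - rO) ^+ 2 + s2 ^+ 2) by rewrite mulr_ge0// addr_ge0// sqr_ge0.
nra.
Qed.

End balls.

(** * Bounds on the restriction operator *)

Section restriction_operator.
Variables (R : realType) (n : nat).
Local Notation V := 'rV[R[i]]_n.
Local Notation normc := (@Normc.normc R).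
Local Notation mu := (@lebesgue_complex R n).
Implicit Types (f g : V -> R[i]) (W Omega U : set V).

(** Elements of [bergman_space] vanish outside their domain, so test functions must be cut off; this
    shows that the cut-off stays differentiable inside. *)
Lemma differentiable_eq_open W f g z : open W -> W z -> {in W, f =1 g} ->
  differentiable f z -> differentiable g z.
Proof.
move=> oW Wz fg df; have /diff_locallyP[cdf fE] := df.
have nW : nbhs z W by exact: open_nbhs_nbhs.
have gE : g \o shift z = cst (g z) + 'd f z +o_ 0 id.
  apply/eqaddoP => eps eps0; move/eqaddoP: fE => /(_ _ eps0) fE.
  have /nbhs_euclidP[k k0 kW] := nW.
  have W0 : nbhs (0 : V) [set h | W (h + z)].
    apply/nbhs_euclidP; exists k => // h; rewrite /euclid_ball /= subr0 => hk.
    by apply: kW; rewrite /euclid_ball /= addrK.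
  have : nbhs (0 : V) ([set h | `|(f \o shift z - (cst (f z) + 'd f z)) h| <= eps * `|h|]
     `&` [set h | W (h + z)]) by exact: filterI.
  apply: filterS => h [/= h1 h2].
  by rewrite !fctE /= -(fg (h + z)) ?inE// -(fg z) ?inE.
have dE := diff_unique cdf gE.
apply/diff_locallyP; rewrite dE; split; [exact: cdf|exact: gE].
Qed.

Lemma sq_integral_ge0 W f : (0 <= sq_integral W f)%E.
Proof. by apply: integral_ge0 => z _; rewrite lee_fin sqr_ge0. Qed.

Lemma sq_integral_patch W U f : W `<=` U -> sq_integral W (f \_ U) = sq_integral W f.
Proof.
move=> WU; apply: eq_integral => z; rewrite inE => Wz.
by rewrite patchE mem_set//; exact: WU.
Qed.

Lemma restriction_norm_le Omega U (C : R) : 0 <= C ->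
  (forall f, (forall z, Omega z -> differentiable f z) ->
     (sq_integral U f <= (C ^+ 2)%:E * sq_integral Omega f)%E) ->
  (restriction_norm Omega U <= C%:E)%E.
Proof.
move=> C0 H; apply: ge_ereal_sup => _ [f [[df [foo _]] f1] <-].
rewrite lee_fin /bergman_norm /restriction_op sq_integral_patch//.
have fO : sq_integral Omega f \is a fin_num by rewrite ge0_fin_numE// sq_integral_ge0.
rewrite -[leRHS](ger0_norm C0) -sqrtr_sqr; apply: ler_wsqrtr.
have h1 : fine (sq_integral Omega f) <= 1.
  have : bergman_norm Omega f ^+ 2 <= 1 by rewrite expr_le1// sqrtr_ge0.
  by rewrite sqr_sqrtr// fine_ge0// sq_integral_ge0.
have := H f df; rewrite -(fineK fO) -EFinM => h2.
have h3 : sq_integral U f \is a fin_num.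
  by rewrite ge0_fin_numE ?sq_integral_ge0// (le_lt_trans h2)// ltry.
move: h2; rewrite -(fineK h3) lee_fin => /le_trans; apply.
by rewrite ler_piMr// sqr_ge0.
Qed.

Lemma le_restriction_norm Omega U f (l : R) : open Omega -> open U -> U `<=` Omega ->
  0 <= l -> (forall z, Omega z -> differentiable f z) ->
  (0 < sq_integral Omega f < +oo)%E ->
  (l%:E * sq_integral Omega f <= sq_integral U f)%E ->
  ((Num.sqrt l)%:E <= restriction_norm Omega U)%E.
Proof.
move=> oO oU UO l0 df /andP[f0 foo] lf.
have fO : sq_integral Omega f \is a fin_num by rewrite ge0_fin_numE// sq_integral_ge0.
set N := fine (sq_integral Omega f).
have NE : sq_integral Omega f = N%:E by rewrite /N fineK.
have N0 : 0 < N by rewrite NE lte_fin in f0.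
pose c : R[i] := (Num.sqrt N)^-1%:C.
have c2 : normc c ^+ 2 = N^-1.
  by rewrite normc_real ger0_norm ?invr_ge0 ?sqrtr_ge0// exprVn sqr_sqrtr// ltW.
pose g := (fun z => c * f z) \_ Omega.
have gint W : open W -> W `<=` Omega -> sq_integral W g = (N^-1%:E * sq_integral W f)%E.
  move=> oW WO; rewrite /g sq_integral_patch// /sq_integral -ge0_integralZl//.
  - by apply: eq_integral => z _; rewrite Normc.normcM exprMn c2 EFinM.
  - exact: open_measurable_rV.
  - by apply: measurable_sqr_normc => // z /WO; exact: df.
  - by move=> z _; rewrite lee_fin sqr_ge0.
  - by rewrite lee_fin invr_ge0 ltW.
have gO : sq_integral Omega g = 1%:E by rewrite gint// NE -EFinM mulVf// gt_eqF.
have gU : (l%:E <= sq_integral U g)%E.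
  rewrite gint//; have : (N^-1%:E * (l%:E * sq_integral Omega f) <= N^-1%:E * sq_integral U f)%E.
    by apply: lee_wpmul2l => //; rewrite lee_fin invr_ge0 ltW.
  by rewrite NE -!EFinM mulrCA mulVf ?gt_eqF// mulr1.
(* Finiteness over [U] has to be secured, because [fine] sends an infinite integral to 0. *)
have gU1 : (sq_integral U g <= 1%:E)%E.
  rewrite -gO; apply: ge0_subset_integral => //; try exact: open_measurable_rV.
  - apply: measurable_sqr_normc => // z Oz.
    apply: (differentiable_eq_open oO Oz (f := fun z => c * f z)).
      by move=> y yO; rewrite /g patchE yO.
    by apply: differentiableM; [exact: differentiable_cst|exact: df].
  - by move=> z _; rewrite lee_fin sqr_ge0.
have gfin : sq_integral U g \is a fin_num.
  by rewrite ge0_fin_numE ?sq_integral_ge0// (le_lt_trans gU1)// ltry.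
apply: le_trans (_ : (bergman_norm U (restriction_op U g))%:E <= _)%E.
  rewrite lee_fin /bergman_norm /restriction_op sq_integral_patch//; apply: ler_wsqrtr.
  by rewrite -lee_fin fineK.
apply: ereal_sup_ubound; exists g => //; split; last by rewrite /bergman_norm gO /= sqrtr1.
split; [|split].
- move=> z Oz; apply: (differentiable_eq_open oO Oz (f := fun z => c * f z)).
    by move=> y yO; rewrite /g patchE yO.
  by apply: differentiableM; [exact: differentiable_cst|exact: df].
- by rewrite gO ltry.
- by apply/funext => z; rewrite /g !patchE; case: (z \in Omega).
Qed.

Lemma contraction_dil (e : V) (t rho : R) f : hdot e e *: e = e -> 0 < t <= 1 -> 0 < rho ->
  (forall z, euclid_ball 0%R rho z -> differentiable f z) ->
  (sq_integral (euclid_ball 0%R rho) (fun z => f (dil e 1%R t%:C z)) <=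
   sq_integral (euclid_ball 0%R rho) f)%E.
Proof.
(* At [t = 1] the denominator of the Moebius map vanishes at a point of the unit circle; there the
   dilation is the identity and the claim is trivial. *)
move=> he /andP[t0 t1] r0 df; move: t1; rewrite le_eqVlt => /predU1P[->|t1].
  by rewrite /sq_integral; under eq_integral do rewrite dil11.
by apply: contraction_lt1 => //; rewrite ltW.
Qed.

Lemma sq_integral_shift (a : V) (W : set V) f : measurable W ->
  measurable_fun W (fun z => (normc (f z) ^+ 2)%:E) ->
  sq_integral ((fun z => z + a) @^-1` W) (fun z => f (z + a)) = sq_integral W f.
Proof.
move=> mW mf; have ma : measurable_fun setT (fun z : V => z + a).
  by apply: measurable_rVD.
rewrite /sq_integral (@integral_scales _ _ _ mu (fun z => z + a) 1 W
  (fun z => (normc (f z) ^+ 2)%:E))// ?mul1e//.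
- exact: lebesgue_complex_translation.
- by move=> z _; rewrite lee_fin sqr_ge0.
Qed.

(** Common core of both upper bounds. After moving [a] to 0, [k] times the integral over [U] is that
    of [|f|^2] composed with the dilation over the preimage of [U]; the preimage lies in the centred
    ball, where the contraction property applies. *)
Lemma dil_image_bound (e a : V) (t rho k : R) U f : hdot e e *: e = e ->
  0 < t <= 1 -> 0 < rho -> 0 < k -> scales mu (dil e 1%R t%:C) k ->
  open U -> U `<=` euclid_ball a rho ->
  (forall x, U (a + dil e 1%R t%:C x) -> euclid_ball 0%R rho x) ->
  (forall z, euclid_ball a rho z -> differentiable f z) ->
  (sq_integral U f <= k^-1%:E * sq_integral (euclid_ball a rho) f)%E.
Proof.
move=> he t01 r0 k0 sk oU UO UB df.
pose B := euclid_ball (0 : V) rho; set O := euclid_ball a rho in UO df *.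
have BE : (fun z => z + a) @^-1` O = B.
  by apply/seteqP; split => z; rewrite /O /B /euclid_ball /preimage /= addrK subr0.
have oO : open O by exact: open_euclid_ball.
have mO : measurable O by exact: open_measurable_rV.
have mU : measurable U by exact: open_measurable_rV.
have mfO := measurable_sqr_normc oO df.
have mfU : measurable_fun U (fun z => (normc (f z) ^+ 2)%:E).
  by apply: measurable_sqr_normc => // z /UO; exact: df.
pose g z := f (z + a).
have dg z : B z -> differentiable g z.
  rewrite -BE => Oz; apply: (@differentiable_comp _ _ _ _ (fun z : V => z + a) f); last exact: df.
  by apply: differentiableD; [exact: ex_diff|exact: differentiable_cst].
pose U' := (fun z => z + a) @^-1` U.
have mU' : measurable U'.
  rewrite -[X in measurable X]setTI; apply: measurable_rVD => //.
have U'B : U' `<=` B by move=> z /UO; rewrite -BE.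
have mgU' : measurable_fun U' (fun z => (normc (g z) ^+ 2)%:E).
  apply: (measurable_funS _ U'B); first exact: measurable_euclid_ball.
  by apply: measurable_sqr_normc => //; exact: open_euclid_ball.
have mB : measurable B by exact: measurable_euclid_ball.
have mg : measurable_fun B (fun z => (normc (g z) ^+ 2)%:E).
  by apply: measurable_sqr_normc => //; exact: open_euclid_ball.
have /andP[t0 t1] := t01.
have Bdil x : B x -> B (dil e 1%R t%:C x).
  rewrite /B !euclid_ball0E// (sqn_dil he) (sqn_proj_perp he x) Normc.normc1 expr1n mul1r.
  apply: le_lt_trans; rewrite lerD2l ler_piMl ?sqn_ge0// normc_real gtr0_norm//.
  by rewrite expr_le1// ltW.
pose q : V -> \bar R := (fun z => (normc (g z) ^+ 2)%:E) \_ B.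
have mq : measurable_fun setT q by apply/(measurable_restrictT _ mB).
have mgd : measurable_fun B (fun z => (normc (g (dil e 1%R t%:C z)) ^+ 2)%:E).
  apply: (@eq_measurable_fun _ _ _ _ _ (q \o dil e 1%R t%:C)).
    by move=> z; rewrite inE => zB /=; rewrite /q patchE mem_set//; exact: Bdil.
  by apply: measurable_funTS; apply: (measurableT_comp mq); exact: measurable_dil.
have H1 : (sq_integral (dil e 1%R t%:C @^-1` U') (fun z => g (dil e 1%R t%:C z)) <=
    sq_integral B (fun z => g (dil e 1%R t%:C z)))%E.
  apply: ge0_subset_integral => //.
  - by rewrite -[X in measurable X]setTI; apply: measurable_dil.
  - by move=> z _; rewrite lee_fin sqr_ge0.
  - by move=> x xU; apply: UB; rewrite addrC.
have H2 : sq_integral (dil e 1%R t%:C @^-1` U') (fun z => g (dil e 1%R t%:C z)) =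
    (k%:E * sq_integral U' g)%E.
  apply: (@integral_scales _ _ _ mu (dil e 1%R t%:C) k U' (fun z => (normc (g z) ^+ 2)%:E)) => //.
  - exact: measurable_dil.
  - by move=> z _; rewrite lee_fin sqr_ge0.
have H3 := contraction_dil he t01 r0 dg.
have eU : sq_integral U' g = sq_integral U f by exact: sq_integral_shift.
have eO : sq_integral B g = sq_integral O f by rewrite -BE; exact: sq_integral_shift.
have := le_trans H1 H3; rewrite H2 eU eO => H4.
have : (k^-1%:E * (k%:E * sq_integral U f) <= k^-1%:E * sq_integral O f)%E.
  by apply: lee_wpmul2l => //; rewrite lee_fin invr_ge0 ltW.
by rewrite muleA -EFinM mulVf ?gt_eqF// mul1e.
Qed.

Lemma restriction_norm_ball_ge (a c : V) (rO r : R) : 0 < rO -> 0 < r ->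
  euclid_ball c r `<=` euclid_ball a rO ->
  (((r / rO) ^+ n)%:E <= restriction_norm (euclid_ball a rO) (euclid_ball c r))%E.
Proof.
move=> rO0 r0 sub; have s0 : 0 < rO / r by rewrite divr_gt0.
have one W : measurable W -> sq_integral W (cst 1) = mu W.
  move=> mW; rewrite /sq_integral (_ : (fun z => _) = cst 1%E).
    by rewrite integral_cst// mul1e.
  by apply/funext => z /=; rewrite expr0n addr0 expr1n sqrtr1 expr1n.
have mE : (mu (euclid_ball c r) = (((r / rO) ^+ n) ^+ 2)%:E * mu (euclid_ball a rO))%E.
  have -> : euclid_ball c r = (fun z => z + - c) @^-1` ((fun z => (rO / r)%:C *: z) @^-1`
      ((fun z => z + a) @^-1` euclid_ball a rO)).
    apply/seteqP; split => z; rewrite /euclid_ball /preimage /= addrK euclid_normZ normc_real;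
      by rewrite gtr0_norm// mulrAC ltr_pdivrMr// ltr_pM2l.
  have m1 : measurable ((fun z => z + a) @^-1` euclid_ball a rO).
    rewrite -[X in measurable X]setTI; apply: measurable_rVD => //.
    exact: measurable_euclid_ball.
  have m2 : measurable ((fun z => (rO / r)%:C *: z) @^-1`
      ((fun z => z + a) @^-1` euclid_ball a rO)).
    rewrite -[X in measurable X]setTI.
    apply: (@measurable_rVZ _ V R n (fun=> (rO / r)%:C) id) => //; exact: cmeasurable_cst.
  rewrite lebesgue_complex_shift// scales_homothety//.
  rewrite lebesgue_complex_shift; last exact: measurable_euclid_ball.
  by congr (_%:E * _)%E; rewrite -exprVn invf_div -exprM mulnC exprM.
have pE : Num.sqrt (((r / rO) ^+ n) ^+ 2) = (r / rO) ^+ n.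
  by rewrite sqrtr_sqr ger0_norm// exprn_ge0// divr_ge0 ?ltW.
have := @le_restriction_norm (euclid_ball a rO) (euclid_ball c r) (cst 1) (((r / rO) ^+ n) ^+ 2).
rewrite pE; apply => //.
- exact: open_euclid_ball.
- exact: open_euclid_ball.
- exact: sqr_ge0.
- by rewrite one; [exact: lebesgue_complex_ball|exact: measurable_euclid_ball].
- by rewrite !one ?mE//; exact: measurable_euclid_ball.
Qed.

End restriction_operator.

Section upper_bounds.
Variable R : realType.

Lemma restriction_norm_concentric_le n (a : 'rV[R[i]]_n) (rO r : R) : 0 < rO -> 0 < r ->
  r <= rO -> euclid_ball a r `<=` euclid_ball a rO ->
  (restriction_norm (euclid_ball a rO) (euclid_ball a r) <= ((r / rO) ^+ n)%:E)%E.
Proof.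
move=> rO0 r0 rr sub; set t := r / rO; have t0 : 0 < t by rewrite divr_gt0.
have t1 : t <= 1 by rewrite ler_pdivrMr// mul1r.
apply: restriction_norm_le => [|f df]; first by rewrite exprn_ge0// ltW.
have dE (x : 'rV[R[i]]_n) : dil 0 1 t%:C x = t%:C *: x by rewrite dil_zero.
have k0 : 0 < (t ^+ 2)^-1 ^+ n by rewrite exprn_gt0// invr_gt0 exprn_gt0.
have -> : (t ^+ n) ^+ 2 = ((t ^+ 2)^-1 ^+ n)^-1 by rewrite exprVn invrK -!exprM mulnC.
apply: (dil_image_bound (e := 0) (t := t)) => //.
- exact: zero_idem.
- by rewrite t0.
- rewrite (_ : dil 0 1 t%:C = fun x => t%:C *: x); first exact: scales_homothety.
  exact/funext.
- exact: open_euclid_ball.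
move=> x; rewrite dE /euclid_ball /= addrC addKr subr0 euclid_normZ normc_real gtr0_norm//.
by rewrite /t mulrAC ltr_pdivrMr// ltr_pM2l.
Qed.

Lemma restriction_norm_ball_le n (a c : 'rV[R[i]]_n.+1) (rO r : R) : 0 < rO -> 0 < r ->
  euclid_ball c r `<=` euclid_ball a rO ->
  (restriction_norm (euclid_ball a rO) (euclid_ball c r) <=
   (Num.sqrt ((rO - euclid_norm (c - a)) / rO) ^+ n)%:E)%E.
Proof.
move=> rO0 r0 sub; have dr := euclid_ball_sub r0 sub.
have d0 := euclid_norm_ge0 (c - a).
have q0 : 0 < (rO - euclid_norm (c - a)) / rO by rewrite divr_gt0//; lra.
set t := Num.sqrt _; have t0 : 0 < t by rewrite sqrtr_gt0.
have tE : t ^+ 2 = (rO - euclid_norm (c - a)) / rO by rewrite sqr_sqrtr// ltW.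
have t1 : t <= 1.
  have : t ^+ 2 <= 1 by rewrite tE ler_pdivrMr// mul1r; lra.
  by rewrite expr_le1// ltW.
have [e e1 cE] := exists_direction (c - a).
apply: restriction_norm_le => [|f df]; first by rewrite exprn_ge0// ltW.
have k0 : 0 < (1 ^+ 2)^-1 * (t ^+ 2)^-1 ^+ n.
  by rewrite expr1n invr1 mul1r exprn_gt0// invr_gt0 exprn_gt0.
have -> : (t ^+ n) ^+ 2 = ((1 ^+ 2)^-1 * (t ^+ 2)^-1 ^+ n)^-1.
  by rewrite expr1n invr1 mul1r exprVn invrK -!exprM mulnC.
apply: (dil_image_bound (e := e) (t := t)) => //.
- exact: unit_idem.
- by rewrite t0.
- have := scales_dil e1 ltr01 t0; rewrite (_ : (1 : R)%:C = 1)//.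
- exact: open_euclid_ball.
by move=> x; exact: (dil_inv_ball_sub e1 rO0 r0 cE dr t0 tE).
Qed.

End upper_bounds.

(** * Sharpness for touching balls *)

Section paraboloid.
Variables (R : realType) (n : nat) (e : 'rV[R[i]]_n.+1).
Hypothesis e1 : sqn e = 1.
Local Notation V := 'rV[R[i]]_n.+1.
Local Notation normc := (@Normc.normc R).
Local Notation mu := (@lebesgue_complex R n.+1).
Implicit Types (al rho eps s t : R) (x p : V).

Let he : hdot e e *: e = e. Proof. exact: unit_idem. Qed.

(* For [al = 1] this is the ball of radius [rho] touching the origin, with inner
   normal [e]; for [al = 0] it is an unbounded Siegel domain. *)
Definition paraboloid al rho : set V :=
  [set x | al * normc (hdot x e) ^+ 2 + sqn (perp e x) < 2 * rho * complex.Re (hdot x e)].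

Lemma paraboloid_ball p rho x : 0 < rho ->
  euclid_ball (p + rho%:C *: e) rho x <-> paraboloid 1 rho (x - p).
Proof.
move=> r0; rewrite euclid_ballE// /paraboloid /= opprD addrA sqnB sqnZ e1 normc_real.
rewrite gtr0_norm// hdotZr conjc_real mul1r (sqn_proj_perp he (x - p)) sqn_proj//.
have -> : complex.Re (rho%:C * hdot (x - p) e) = rho * complex.Re (hdot (x - p) e).
  by case: (hdot _ _) => ? ? /=; rewrite mul0r subr0.
by rewrite mulr2n; split; lra.
Qed.

(** For [s = t ^+ 2] the radius is kept and [al] is multiplied by [s]: the parabolic blow-up that
    opens a ball towards a Siegel domain. For [s = 1] the ratio [al / rho] is kept, which relates
    different radii. *)
Lemma preimage_paraboloid al rho s t : 0 < s -> 0 < t ->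
  dil e s%:C t%:C @^-1` paraboloid al rho =
  paraboloid (al * s ^+ 2 / t ^+ 2) (rho * s / t ^+ 2).
Proof.
move=> s0 t0; apply/funext => x; rewrite /paraboloid /preimage /=; apply/propext.
rewrite (hdot_dil he) (perp_dil he) sqnZ Normc.normcM !normc_real !gtr0_norm// exprMn.
have -> : complex.Re (s%:C * hdot x e) = s * complex.Re (hdot x e).
  by case: (hdot _ _) => ? ? /=; rewrite mul0r subr0.
have t20 : 0 < t ^+ 2 by rewrite exprn_gt0.
rewrite -[X in _ <-> is_true X](ltr_pM2r t20).
move: (normc _ ^+ 2) (sqn _) (complex.Re _) => A B C.
have -> : (al * s ^+ 2 / t ^+ 2 * A + B) * t ^+ 2 = al * (s ^+ 2 * A) + t ^+ 2 * B.
  by field; rewrite gt_eqF.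
have -> : 2 * (rho * s / t ^+ 2) * C * t ^+ 2 = 2 * rho * (s * C).
  by field; rewrite gt_eqF.
by [].
Qed.

Lemma measurable_paraboloid al rho : 0 < al -> 0 < rho -> measurable (paraboloid al rho).
Proof.
move=> a0 r0; have sa : 0 < Num.sqrt al by rewrite sqrtr_gt0.
have -> : paraboloid al rho = dil e al%:C (Num.sqrt al)%:C @^-1` euclid_ball (rho%:C *: e) rho.
  have -> : euclid_ball (rho%:C *: e) rho = paraboloid 1 rho.
    apply/funext => x; apply/propext; have := paraboloid_ball 0 x r0.
    by rewrite add0r subr0.
  rewrite preimage_paraboloid// sqr_sqrtr ?(ltW a0)// mul1r expr2 mulfK ?gt_eqF//.
  by rewrite mulfK ?gt_eqF.
rewrite -[X in measurable X]setTI; apply: measurable_dil => //.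
exact: measurable_euclid_ball.
Qed.

Lemma paraboloid_mono al al' rho : al <= al' -> paraboloid al' rho `<=` paraboloid al rho.
Proof.
move=> aa x; rewrite /paraboloid /=; apply: le_lt_trans.
by rewrite lerD2r ler_wpM2r// sqr_ge0.
Qed.

(** An open set containing all the paraboloids, on which the peaks with [eps >= 0] have no pole. *)
Definition halfspace : set V := [set x | 0 < complex.Re (hdot x e)].

Lemma paraboloid_halfspace al rho : 0 <= al -> 0 < rho -> paraboloid al rho `<=` halfspace.
Proof.
move=> a0 r0 x; rewrite /paraboloid /halfspace /= => h.
have : 0 < 2 * rho * complex.Re (hdot x e).
  by apply: le_lt_trans h; rewrite addr_ge0 ?sqn_ge0// mulr_ge0// sqr_ge0.
by rewrite pmulr_rgt0// mulr_gt0.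
Qed.

Lemma open_halfspace : open halfspace.
Proof.
rewrite openE => x xh; apply/nbhs_euclidP; exists (complex.Re (hdot x e)) => // y yx.
rewrite /halfspace /=; have := normc_hdot_le (y - x) e.
rewrite [euclid_norm e]euclid_normE e1 sqrtr1 mulr1 hdotBl.
move=> /(le_trans (abs_Re_le_normc _)); rewrite raddfB /=.
move: yx; rewrite /euclid_ball /= => yx /le_lt_trans -/(_ _ yx).
by rewrite ltr_norml; lra.
Qed.

Definition peak m (c : R[i]) x : R[i] := (c + hdot x e)^-1 ^+ m.+1.

Lemma differentiable_peak m c x : c + hdot x e != 0 -> differentiable (peak m c) x.
Proof.
move=> h0; have dh : differentiable (fun y : V => c + hdot y e) x.
  apply: differentiableD; first exact: differentiable_cst.
  rewrite (_ : (fun y : V => hdot y e) = \sum_j (fun y : V => y 0 j * (e 0 j)^*%C)).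
    apply: differentiable_sum => j; apply: differentiableM.
      exact: differentiable_coord.
    exact: differentiable_cst.
  by apply/funext => y; rewrite fct_sumE.
have di := differentiableV dh h0.
have -> : peak m c = (fun y => (c + hdot y e)^-1) ^+ m.+1.
  by apply/funext => y; rewrite exprfctE.
exact: differentiableX.
Qed.

Definition peak2 m eps x : R := (normc (eps%:C + hdot x e) ^+ 2) ^- m.+1.

Lemma sqr_normc_peak m eps x : normc (peak m eps%:C x) ^+ 2 = peak2 m eps x.
Proof.
by rewrite /peak normcX Normc.normcV -exprM mulnC exprM exprVn exprVn.
Qed.

Lemma peak2_ge0 m eps x : 0 <= peak2 m eps x.
Proof. by rewrite invr_ge0 exprn_ge0// sqr_ge0. Qed.

Lemma halfspace_neq0 eps x : 0 <= eps -> halfspace x -> eps%:C + hdot x e != 0.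
Proof.
move=> eps0; rewrite /halfspace /= => xh; apply/negP => /eqP /(congr1 (@complex.Re R)).
by rewrite raddfD /= => h; move: xh; lra.
Qed.

Lemma measurable_peak2 m eps al rho : 0 <= eps -> 0 < al -> 0 < rho ->
  measurable_fun (paraboloid al rho) (fun x => (peak2 m eps x)%:E).
Proof.
move=> eps0 a0 r0; apply: (@measurable_funS _ _ _ _ halfspace).
- by apply: open_measurable_rV; exact: open_halfspace.
- by apply: paraboloid_halfspace => //; exact: ltW.
under eq_fun do rewrite -sqr_normc_peak.
apply: measurable_sqr_normc; first exact: open_halfspace.
by move=> z zh; apply: differentiable_peak; exact: halfspace_neq0.
Qed.

Definition peak_mass m eps al rho : \bar R :=
  (\int[mu]_(x in paraboloid al rho) (peak2 m eps x)%:E)%E.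

Lemma peak_mass_dil m eps al rho s t : 0 <= eps -> 0 < al -> 0 < rho -> 0 < s -> 0 < t ->
  (\int[mu]_(x in paraboloid (al * s ^+ 2 / t ^+ 2) (rho * s / t ^+ 2))
      (peak2 m eps (dil e s%:C t%:C x))%:E =
   ((s ^+ 2)^-1 * (t ^+ 2)^-1 ^+ n)%:E * peak_mass m eps al rho)%E.
Proof.
move=> eps0 a0 r0 s0 t0; rewrite -preimage_paraboloid//.
apply: (@integral_scales _ _ _ mu (dil e s%:C t%:C) _ (paraboloid al rho)
  (fun x => (peak2 m eps x)%:E)).
- exact: measurable_dil.
- by rewrite mulr_gt0 ?exprn_gt0 ?invr_gt0 ?exprn_gt0.
- exact: scales_dil.
- exact: measurable_paraboloid.
- exact: measurable_peak2.
- by move=> x _; rewrite lee_fin peak2_ge0.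
Qed.

(* [eps] enters only through the scaling of the peak, so masses over different
   balls have the same ratio as the masses over the rescaled paraboloids. *)
Lemma peak_mass_eps m eps : 0 < eps -> exists2 k : R, 0 < k &
  forall rho, 0 < rho -> peak_mass m eps 1 rho = (k%:E * peak_mass m 1 eps rho)%E.
Proof.
move=> eps0; set t := Num.sqrt eps; have t0 : 0 < t by rewrite sqrtr_gt0.
have t2 : t ^+ 2 = eps by rewrite sqr_sqrtr// ltW.
set K : R := (eps ^+ 2)^-1 * (t ^+ 2)^-1 ^+ n.
have K0 : 0 < K by rewrite mulr_gt0 ?exprn_gt0 ?invr_gt0 ?exprn_gt0.
pose L : R := (eps ^+ 2) ^- m.+1.
have L0 : 0 < L by rewrite invr_gt0 !exprn_gt0.
exists (K^-1 * L) => [|rho r0]; first by rewrite mulr_gt0// invr_gt0.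
have E := peak_mass_dil m (ltW eps0) ltr01 r0 eps0 t0.
have i1 : 1 * eps ^+ 2 / t ^+ 2 = eps by rewrite t2; field; rewrite gt_eqF.
have i2 : rho * eps / t ^+ 2 = rho by rewrite t2; field; rewrite gt_eqF.
rewrite i1 i2 -/K in E.
transitivity (K^-1%:E * (K%:E * peak_mass m eps 1 rho))%E.
  by rewrite muleA -EFinM mulVf ?gt_eqF// mul1e.
rewrite -E EFinM -muleA; congr (_ * _)%E.
rewrite /peak_mass -ge0_integralZl//.
- apply: eq_integral => x _; rewrite -EFinM /peak2 (hdot_dil he).
  have -> : eps%:C + eps%:C * hdot x e = eps%:C * ((1 : R)%:C + hdot x e).
    by rewrite rmorph1; ring.
  rewrite Normc.normcM normc_real gtr0_norm// [(eps * _) ^+ 2]exprMn.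
  by rewrite [(eps ^+ 2 * _) ^+ m.+1]exprMn invfM.
- exact: measurable_paraboloid.
- exact: measurable_peak2.
- by move=> x _; rewrite lee_fin peak2_ge0.
- by rewrite lee_fin ltW.
Qed.

(** The peak depends on [x] only through [hdot x e], which this dilation fixes; only domain and
    volume change. The volume factor is the square of the sharp norm when [t ^+ 2 = r / rO]. *)
Lemma peak_mass_shrink m al rho t : 0 < al -> 0 < rho -> 0 < t ->
  peak_mass m 1 al rho =
    (((t ^+ 2) ^+ n)%:E * peak_mass m 1 (al / t ^+ 2) (rho / t ^+ 2))%E.
Proof.
move=> a0 r0 t0; have E := peak_mass_dil m ler01 a0 r0 ltr01 t0.
have t20 : 0 < (t ^+ 2) ^+ n by rewrite !exprn_gt0.
rewrite expr1n !mulr1 invr1 mul1r exprVn in E.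
transitivity (((t ^+ 2) ^+ n)%:E * (((t ^+ 2) ^+ n)^-1%:E * peak_mass m 1 al rho))%E.
  by rewrite muleA -EFinM mulfV ?gt_eqF// mul1e.
rewrite -E; congr (_ * _)%E; apply: eq_integral => x _.
by rewrite /peak2 (hdot_dil he) rmorph1 mul1r.
Qed.

Lemma peak2_le1 m x : halfspace x -> peak2 m 1 x <= 1.
Proof.
rewrite /halfspace /peak2 /= => xh; rewrite invf_le1; last first.
  by rewrite !exprn_gt0// normc_gt0 (halfspace_neq0 ler01).
rewrite exprn_ege1// sqr_normc_def raddfD /=.
by have := sqr_ge0 (complex.Im (1%:C + hdot x e)); nra.
Qed.

(* [m = n + 3] makes the peak decay fast enough against the factor [16 * 4 ^ n] by
   which [dil e 4 2] multiplies volumes. *)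
Lemma peak2_dil_le x : halfspace x ->
  4 ^+ n.+3 * peak2 n.+2 1 (dil e 4%:C 2%:C x) <=
  peak2 n.+2 1 x + 4 ^+ n.+3 * (normc (hdot x e) < 1 / 2)%R%:R.
Proof.
move=> xh; have d0 : halfspace (dil e 4%:C 2%:C x).
  rewrite /halfspace /= (hdot_dil he).
  by move: xh; rewrite /halfspace /=; case: (hdot x e) => u v /=; lra.
have p0 := peak2_ge0 n.+2 1 x; have p1 := peak2_le1 n.+2 d0.
have f0 : 0 < 4 ^+ n.+3 :> R by rewrite exprn_gt0.
case: ltP => [_|h]; first by rewrite mulr1; apply: ler_wpDl => //; rewrite ler_piMr// ltW.
rewrite mulr0 addr0 /peak2 (hdot_dil he).
have A0 : 0 < normc (1%:C + 4%:C * hdot x e) ^+ 2.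
  rewrite exprn_gt0// normc_gt0; have := halfspace_neq0 ler01 d0.
  by rewrite (hdot_dil he).
have B0 : 0 < normc (1%:C + hdot x e) ^+ 2.
  by rewrite exprn_gt0// normc_gt0 (halfspace_neq0 ler01).
have aux (u v w : R) : 0 < v -> 0 < w -> u * w <= v -> u * v^-1 <= w^-1.
  by move=> v0 w0 uw; rewrite ler_pdivrMr// mulrC ler_pdivlMr.
apply: aux; first exact: exprn_gt0.
  exact: exprn_gt0.
rewrite -exprMn.
apply: lerXn2r; [by rewrite nnegrE mulr_ge0// sqr_ge0|by rewrite nnegrE sqr_ge0|].
(* With [z = hdot x e], [|1 + 4 z|^2 - 4 |1 + z|^2 = 12 |z|^2 - 3], nonnegative exactly for
   [|z| >= 1 / 2]. *)
have : (1 / 2) ^+ 2 <= normc (hdot x e) ^+ 2 by rewrite ler_pXn2r ?nnegrE ?normc_ge0.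
move: xh; rewrite /halfspace /= !sqr_normc_def; case: (hdot x e) => u v /=.
nra.
Qed.

End paraboloid.

(** * Near-extremal peaks for touching balls *)

Section sharpness.
Variables (R : realType) (n : nat) (e : 'rV[R[i]]_n.+1).
Hypothesis e1 : sqn e = 1.
Local Notation V := 'rV[R[i]]_n.+1.
Local Notation normc := (@Normc.normc R).
Local Notation mu := (@lebesgue_complex R n.+1).
Local Notation mass := (peak_mass e n.+2).
Local Notation mass1 := (peak_mass e n.+2 1).
Implicit Types (al rho eps t : R) (x p : V).

Let he : hdot e e *: e = e. Proof. exact: unit_idem. Qed.

Lemma lebesgue_paraboloid al rho : 0 < al -> 0 < rho ->
  (0 < mu (paraboloid e al rho) < +oo)%E.
Proof.
move=> a0 r0; set s := Num.sqrt al; have s0 : 0 < s by rewrite sqrtr_gt0.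
have s2 : s ^+ 2 = al by rewrite sqr_sqrtr// ltW.
have ballE : euclid_ball (rho%:C *: e) rho = paraboloid e 1 rho.
  apply/funext => x; apply/propext; have := paraboloid_ball e1 0 x r0.
  by rewrite add0r subr0.
have pE : dil e al%:C s%:C @^-1` paraboloid e 1 rho = paraboloid e al rho.
  rewrite preimage_paraboloid// s2; congr (paraboloid e _ _); field; rewrite gt_eqF//.
set k : R := (al ^+ 2)^-1 * (s ^+ 2)^-1 ^+ n.
have k0 : 0 < k by rewrite mulr_gt0 ?exprn_gt0 ?invr_gt0 ?exprn_gt0.
have : mu (paraboloid e al rho) = (k%:E * mu (euclid_ball (rho%:C *: e) rho))%E.
  rewrite -pE -ballE; apply: (scales_dil e1 a0 s0); exact: measurable_euclid_ball.
have /andP[b0 boo] := lebesgue_complex_ball (rho%:C *: e) r0.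
by move=> ->; rewrite mule_gt0//= lte_mul_pinfty// ?lee_fin ltW.
Qed.

Lemma peak_mass_fin al rho : 0 < al -> 0 < rho -> (0 < mass1 al rho < +oo)%E.
Proof.
move=> a0 r0; have /andP[m0 moo] := lebesgue_paraboloid a0 r0.
have mP := measurable_paraboloid e1 a0 r0.
have mG := measurable_peak2 e1 n.+2 ler01 a0 r0.
have sub := paraboloid_halfspace (ltW a0) r0.
(* On the paraboloid [al * |z|^2 < 2 * rho * |z|] for [z = hdot x e], so
   [|1 + z| <= 1 + 2 * rho / al] and the peak is bounded below. *)
pose M : R := ((1 + 2 * rho / al) ^+ 2) ^- n.+3.
have M0 : 0 < M.
  by rewrite invr_gt0 !exprn_gt0// addr_gt0// divr_gt0// mulr_gt0.
apply/andP; split.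
  apply: (@lt_le_trans _ _ (\int[mu]_(x in paraboloid e al rho) M%:E)%E).
    by rewrite integral_cst// mule_gt0.
  apply: ge0_le_integral => //.
  - by move=> x _; rewrite lee_fin ltW.
  - move=> x Px; rewrite lee_fin /peak2 /M lef_pV2 ?posrE ?exprn_gt0//; last 2 first.
    + by rewrite addr_gt0// divr_gt0// mulr_gt0.
    + by rewrite normc_gt0 (halfspace_neq0 ler01)//; exact: sub.
    apply: lerXn2r; rewrite ?nnegrE ?sqr_ge0//.
    apply: lerXn2r; rewrite ?nnegrE ?normc_ge0//.
      by rewrite addr_ge0// divr_ge0 ?mulr_ge0// ltW.
    apply: le_trans (le_normcD _ _) _.
    rewrite normc_real normr1 lerD2l ler_pdivlMr// mulrC.
    move: Px; rewrite /paraboloid /= => Px.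
    have q0 := sqn_ge0 (perp e x); have N0 := normc_ge0 (hdot x e).
    have Re1 := le_trans (ler_norm _) (abs_Re_le_normc (hdot x e)).
    have [->|N1] := eqVneq (normc (hdot x e)) 0; first by rewrite mulr0 mulr_ge0// ltW.
    have N2 : 0 < normc (hdot x e) by rewrite lt_def N1.
    rewrite -(ler_pM2r N2); nra.
apply: (@le_lt_trans _ _ (\int[mu]_(x in paraboloid e al rho) 1)%E).
  apply: ge0_le_integral => //.
  - by move=> x _; rewrite lee_fin peak2_ge0.
  - by move=> x /sub xh; rewrite lee_fin peak2_le1.
by rewrite integral_cst// mul1e.
Qed.

(** The domains grow without bound as [al] tends to 0, so a bound by volume is useless. The dilation
    by [(4, 2)] keeps [rho], replaces [al] by [4 * al] and bounds four times the mass by the mass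
    plus a constant; finiteness for each [al] allows subtraction. *)
Lemma peak_mass_bounded rho : 0 < rho -> exists C : R, forall al, 0 < al ->
  (mass1 al rho <= C%:E)%E.
Proof.
move=> r0; have r1 : 0 < 1 + rho by rewrite addr_gt0.
(* Contains the part of the paraboloid with [|hdot x e| < 1 / 2]: there the squared norm is below
   [1 / 4 + rho]. *)
pose A : set V := euclid_ball 0 (1 + rho).
have /andP[A0 Aoo] := lebesgue_complex_ball (0 : V) r1; rewrite -/A in A0 Aoo.
have mA : measurable A by exact: measurable_euclid_ball.
pose c : R := 4 ^+ n.+3; have c0 : 0 < c by rewrite exprn_gt0.
have Af : mu A \is a fin_num by rewrite ge0_fin_numE// ltW.
exists (c * fine (mu A)) => al a0.
have a40 : 0 < al * 4 ^+ 2 / 2 ^+ 2 by rewrite divr_gt0 ?mulr_gt0.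
have aE : al <= al * 4 ^+ 2 / 2 ^+ 2.
  by rewrite (_ : _ / _ = 4 * al); [lra|field].
have rE : rho * 4 / 2 ^+ 2 = rho by field.
have E := peak_mass_dil e1 n.+2 ler01 a0 r0 (ltr0n _ 4) (ltr0n _ 2).
rewrite rE in E; set al' := al * 4 ^+ 2 / 2 ^+ 2 in a40 aE E.
set P := paraboloid e al' rho in E.
have mP : measurable P by exact: measurable_paraboloid.
have PH : P `<=` halfspace e by exact: paraboloid_halfspace (ltW a40) r0.
have mG := measurable_peak2 e1 n.+2 ler01 a40 r0.
have /andP[I0 Ioo] := peak_mass_fin a0 r0.
have If : mass1 al rho \is a fin_num by rewrite ge0_fin_numE// ltW.
have mass_mono : (mass1 al' rho <= mass1 al rho)%E.
  apply: ge0_subset_integral => //.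
  - exact: measurable_paraboloid.
  - exact: measurable_peak2.
  - by move=> x _; rewrite lee_fin peak2_ge0.
  - exact: paraboloid_mono.
pose D x : R := peak2 e n.+2 1 (dil e 4%:C 2%:C x).
have mD : measurable_fun P (fun x => (D x)%:E).
  have mH : measurable (halfspace e) by apply: open_measurable_rV; exact: open_halfspace.
  apply: (measurable_funS (E := halfspace e)) => //.
  have mh := measurable_sqr_normc (open_halfspace e1)
    (fun z zh => differentiable_peak n.+2 (halfspace_neq0 ler01 zh)).
  pose q : V -> \bar R := (fun z => (normc (peak e n.+2 (1%:C) z) ^+ 2)%:E) \_ (halfspace e).
  apply: (@eq_measurable_fun _ _ _ _ _ (q \o dil e 4%:C 2%:C)).
    move=> z; rewrite inE => zh /=; rewrite /q patchE mem_set; last first.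
      rewrite /halfspace /= (hdot_dil he).
      by move: zh; rewrite /halfspace /=; case: (hdot z e) => u v /=; lra.
    by rewrite sqr_normc_peak.
  apply: measurable_funTS; apply: (measurableT_comp (f := q)); last exact: measurable_dil.
  exact/(measurable_restrictT _ mH).
have mcD : measurable_fun P (fun x => (c * D x)%:E).
  by under eq_fun do rewrite EFinM; apply: emeasurable_funM => //; exact: measurable_cst.
have mcA : measurable_fun P (fun x => (c * \1_A x)%:E).
  under eq_fun do rewrite EFinM; apply: emeasurable_funM; first exact: measurable_cst.
  by apply/measurable_EFinP; exact: measurable_indic.
have key : (\int[mu]_(x in P) (c * D x)%:E <= mass1 al rho + (c * fine (mu A))%:E)%E.
  apply: (@le_trans _ _ (\int[mu]_(x in P) ((peak2 e n.+2 1 x)%:E + (c * \1_A x)%:E))%E).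
    apply: ge0_le_integral => //.
    - by move=> x _; rewrite lee_fin mulr_ge0 ?peak2_ge0// ltW.
    - by apply: emeasurable_funD => //; exact: mcA.
    - move=> x Px; rewrite -EFinD lee_fin.
      apply: le_trans (peak2_dil_le e1 (PH x Px)) _; rewrite lerD2l ler_pM2l// indicE ler_nat.
      case: ltP => // xs; rewrite mem_set//.
      apply/euclid_ball0E => //; rewrite (sqn_proj_perp he) sqn_proj//.
      move: Px; rewrite /P /paraboloid /= => Px.
      have N0 := normc_ge0 (hdot x e); have q0 := sqn_ge0 (perp e x).
      have Re1 := le_trans (ler_norm _) (abs_Re_le_normc (hdot x e)).
      have : 0 <= al' * normc (hdot x e) ^+ 2 by rewrite mulr_ge0 ?sqr_ge0// ltW.
      nra.
  rewrite ge0_integralD//; last 2 first.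
  - by move=> x _; rewrite lee_fin peak2_ge0.
  - by move=> x _; rewrite lee_fin mulr_ge0// ltW.
  apply: leeD => //.
  under eq_integral do rewrite EFinM.
  rewrite ge0_integralZl//; last 2 first.
  - by apply/measurable_EFinP; exact: measurable_indic.
  - by rewrite lee_fin ltW.
  rewrite integral_indic// [(c * fine _)%:E]EFinM fineK//.
  apply: lee_wpmul2l; first by rewrite lee_fin ltW.
  by apply: le_measure; rewrite ?inE//; exact: measurableI.
move: key; under eq_integral do rewrite EFinM.
rewrite ge0_integralZl//; last 2 first.
- by move=> x _; rewrite lee_fin peak2_ge0.
- by rewrite lee_fin ltW.
rewrite E muleA -EFinM -(fineK If) -EFinM -EFinD !lee_fin.
(* The pointwise gain [4 ^+ n.+3] against the volume factor [16 * 4 ^ n] leaves 4, which exceeds 1,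
   so the mass is absorbed. *)
have -> : c * ((4 ^+ 2)^-1 * (2 ^+ 2)^-1 ^+ n) = 4 :> R.
  have -> : (2 : R) ^+ 2 = 4 by ring.
  rewrite /c exprVn !exprS; field.
  by rewrite expf_neq0.
have : 0 <= fine (mass1 al rho) by rewrite fine_ge0// ltW.
have : 0 <= c * fine (mu A) by rewrite mulr_ge0 ?fine_ge0// ltW.
lra.
Qed.

(** A near-maximiser [al] of the mass over radius [rO] replaces the limit. After rescaling, the
    small ball carries [(r / rO) ^+ n] times this near-maximal mass, while the large ball carries a
    mass of the same family, hence at most the supremum. *)
Lemma peak_mass_ratio (rO r l : R) : 0 < r -> 0 < rO -> 0 < l < 1 ->
  exists2 eps, 0 < eps &
    ((l * (r / rO) ^+ n)%:E * mass eps 1 rO <= mass eps 1 r)%E.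
Proof.
move=> r0 rO0 /andP[l0 l1]; have [C CP] := peak_mass_bounded rO0.
have mf al : 0 < al -> mass1 al rO = (fine (mass1 al rO))%:E.
  move=> a0; have /andP[I0 Ioo] := peak_mass_fin a0 rO0.
  by rewrite fineK// ge0_fin_numE// ltW.
pose S := sup [set fine (mass1 al rO) | al in [set al | 0 < al]].
have hs : has_sup [set fine (mass1 al rO) | al in [set al | 0 < al]].
  split; first by exists (fine (mass1 1 rO)); exists 1 => /=.
  by exists C => _ [al /= a0 <-]; rewrite -lee_fin -mf// CP.
have leS al : 0 < al -> fine (mass1 al rO) <= S.
  by move=> a0; apply: ub_le_sup; [case: hs|exists al].
have S0 : 0 < S.
  apply: lt_le_trans (leS 1 ltr01); have /andP[I0 _] := peak_mass_fin ltr01 rO0.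
  by rewrite -lte_fin -mf.
have l0S : 0 < (1 - l) * S by rewrite mulr_gt0// subr_gt0.
have [_ [al /= a0 <-]] := sup_adherent l0S hs; rewrite -/S => alS.
set q := r / rO; have q0 : 0 < q by rewrite divr_gt0.
pose t := Num.sqrt q; have t0 : 0 < t by rewrite sqrtr_gt0.
have t2 : t ^+ 2 = q by rewrite sqr_sqrtr// ltW.
have eps0 : 0 < al * q by rewrite mulr_gt0.
(* Chosen so that shrinking with [t ^+ 2 = q] takes the parameters [(al * q, r)] to [(al, rO)]. *)
exists (al * q) => //; have [k k0 kE] := peak_mass_eps e1 n.+2 eps0.
have E1 : al * q / t ^+ 2 = al by rewrite t2 mulfK// gt_eqF.
have E2 : r / t ^+ 2 = rO by rewrite t2 /q; field; rewrite !gt_eqF.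
rewrite !kE// (peak_mass_shrink e1 n.+2 eps0 r0 t0) E1 E2 t2 (mf al)// (mf (al * q))//.
rewrite -!EFinM lee_fin.
have := leS _ eps0; set I1 := fine _; set I2 := fine (mass1 al rO) in alS *.
move=> I1S; have : l * I1 <= I2.
  by apply: le_trans (ler_wpM2l (ltW l0) I1S) _; apply: ltW; apply: le_lt_trans alS; lra.
move=> lI; have Q0 : 0 < k * q ^+ n by rewrite mulr_gt0// exprn_gt0.
have := ler_wpM2l (ltW Q0) lI.
have -> : l * q ^+ n * (k * I1) = k * q ^+ n * (l * I1) by ring.
by have -> : k * (q ^+ n * I2) = k * q ^+ n * I2 by ring.
Qed.

Lemma restriction_norm_touching_ge p (rO r : R) : 0 < r -> 0 < rO ->
  euclid_ball (p + r%:C *: e) r `<=` euclid_ball (p + rO%:C *: e) rO ->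
  ((Num.sqrt (r / rO) ^+ n)%:E <=
   restriction_norm (euclid_ball (p + rO%:C *: e) rO) (euclid_ball (p + r%:C *: e) r))%E.
Proof.
move=> r0 rO0 sub; set N := restriction_norm _ _.
have q0 : 0 < r / rO by rewrite divr_gt0.
apply/lee_mul01Pr; first by rewrite lee_fin exprn_ge0// sqrtr_ge0.
move=> l /andP[l0 l1]; rewrite -EFinM.
(* Masses are squared norms, so a loss of [l] in the norm allows a loss of [l ^+ 2] in the mass
   ratio. *)
have l2 : 0 < l ^+ 2 < 1 by rewrite exprn_gt0//= expr_lt1// ltW.
have [eps eps0 ratio] := peak_mass_ratio r0 rO0 l2.
have -> : l * Num.sqrt (r / rO) ^+ n = Num.sqrt (l ^+ 2 * (r / rO) ^+ n).
  rewrite [RHS]sqrtrM ?sqr_ge0// sqrtr_sqr gtr0_norm//; congr (_ * _).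
  apply/eqP; rewrite -(eqrXn2 (n := 2))// ?sqrtr_ge0 ?exprn_ge0 ?sqrtr_ge0//.
  by rewrite -exprM mulnC exprM !sqr_sqrtr ?exprn_ge0// ltW.
have ballE rho : 0 < rho -> euclid_ball (p + rho%:C *: e) rho =
    (fun z => z + - p) @^-1` paraboloid e 1 rho.
  by move=> rho0; apply/funext => x; apply/propext; exact: paraboloid_ball.
have intE rho : 0 < rho -> sq_integral (euclid_ball (p + rho%:C *: e) rho)
    (fun z => peak e n.+2 eps%:C (z + - p)) = mass eps 1 rho.
  move=> rho0; rewrite ballE// sq_integral_shift.
  - by apply: eq_integral => x _; rewrite sqr_normc_peak.
  - exact: measurable_paraboloid.
  - under eq_fun do rewrite sqr_normc_peak.
    by apply: measurable_peak2 => //; exact: ltW.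
have [k k0 kE] := peak_mass_eps e1 n.+2 eps0.
apply: (le_restriction_norm (f := fun z => peak e n.+2 eps%:C (z + - p))) => //.
- exact: open_euclid_ball.
- exact: open_euclid_ball.
- by rewrite mulr_ge0 ?sqr_ge0// exprn_ge0// ltW.
- move=> z; rewrite ballE// => Pz.
  apply: (@differentiable_comp _ _ _ _ (fun z : V => z + - p) (peak e n.+2 eps%:C)).
    by apply: differentiableD; [exact: ex_diff|exact: differentiable_cst].
  apply: differentiable_peak; apply: halfspace_neq0; first exact: ltW.
  exact: (paraboloid_halfspace ler01 rO0).
- rewrite intE// kE//; have /andP[m0 moo] := peak_mass_fin eps0 rO0.
  by rewrite mule_gt0//= lte_mul_pinfty// lee_fin ltW.
- by rewrite !intE.
Qed.

End sharpness.

Lemma powR_half_sqrt (R : realType) n (x : R) : 0 <= x ->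
  x `^ ((n.+1%:R - 1) / 2) = Num.sqrt x ^+ n.
Proof.
move=> x0; rewrite -[n.+1]addn1 natrD addrK mulrC powRrM.
by rewrite powR12_sqrt// powR_mulrn// sqrtr_ge0.
Qed.

Theorem theorem2 (R : realType) (n : nat) (n_gt0 : (0 < n)%N)
    (a c : 'rV[R[i]]_n) (rO r : R) (rO_gt0 : 0 < rO) (r_gt0 : 0 < r)
    (Omega U : set 'rV[R[i]]_n) (OmegaE : Omega = euclid_ball a rO)
    (UE : U = euclid_ball c r) (U_sub : U `<=` Omega)
    (delta : R) (deltaE : delta = euclid_dist c (boundary Omega)) :
  (((r / rO) ^+ n)%:E <= restriction_norm Omega U)%E /\
  (restriction_norm Omega U <= ((delta / rO) `^ ((n%:R - 1) / 2))%:E)%E /\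
  (c = a -> restriction_norm Omega U = ((r / rO) ^+ n)%:E) /\
  (boundary U `&` boundary Omega !=set0 ->
   restriction_norm Omega U = ((delta / rO) `^ ((n%:R - 1) / 2))%:E).
Proof.
case: n n_gt0 => // n _ in a c Omega U OmegaE UE U_sub deltaE *.
subst Omega U; have dr := euclid_ball_sub r_gt0 U_sub.
have d0 := euclid_norm_ge0 (c - a).
rewrite euclid_dist_sphere// in deltaE; last by lra.
have delta0 : 0 < delta by rewrite deltaE; lra.
rewrite powR_half_sqrt; last by rewrite divr_ge0 ?ltW.
have ge := restriction_norm_ball_ge rO_gt0 r_gt0 U_sub.
have le := restriction_norm_ball_le rO_gt0 r_gt0 U_sub; rewrite -deltaE in le.
split => //; split => //; split.
  (* Concentric balls have [delta = rO], where the general upper bound is only 1; the dilation of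
     all coordinates gives the matching bound. *)
  move=> ca; subst c; rewrite subrr euclid_norm0 add0r in dr.
  by apply: le_anti; rewrite ge restriction_norm_concentric_le.
move=> [p []]; rewrite !boundary_euclid_ball//= => pc pa.
(* Contact forces [delta = r], so the general upper bound meets the lower bound from the peaks. *)
have [e e1 [aE cE rE]] := touching_balls r_gt0 dr pc pa.
apply: le_anti; rewrite le /= deltaE rE.
by subst a c; exact: restriction_norm_touching_ge.
Qed.
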